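(* Assume that hypotheses H1 to H5 (listed in the context) are satisfied. Then $\widehat\eta_n$ and $\widehat\zeta_n$ converge almost surely to $\eta$ and $\zeta$ respectively. More precisely, $$\|\widehat\eta_n-\eta_n\|=\mathcal{O}\left(\frac{n}{|\mathbb{T}_{n-1}|}\right)\quad\text{a.s.},\qquad \|\widehat\zeta_n-\zeta_n\|=\mathcal{O}\left(\frac{n}{|\mathbb{T}_{n-1}|}\right)\quad\text{a.s.}$$ In addition, $\widehat\nu_n$ converges almost surely to $\nu$ with $$\|\widehat\nu_n-\nu_n\|=\mathcal{O}\left(\frac{n}{|\mathbb{T}_{n-1}|}\right)\quad\text{a.s.}$$
   Context: **Model.** The first-order random coefficient bifurcating autoregressive (RCBAR) process $(X_n)_{n\ge1}$ is a real-valued process given, for all $n\ge1$, by $X_{2n}=a_nX_n+\varepsilon_{2n}$ and $X_{2n+1}=b_nX_n+\varepsilon_{2n+1}$, where $X_1$ is the initial state with $\mathbb{E}[X_1^2]<\infty$. The sequences $(a_n,b_n)_{n\ge1}$ and $(\varepsilon_{2n},\varepsilon_{2n+1})_{n\ge1}$ are each i.i.d. and are independent of each other. Put $\mathbb{G}_n=\{2^n,2^n+1,\dots,2^{n+1}-1\}$, $\mathbb{T}_n=\bigcup_{k=0}^n\mathbb{G}_k$ (so $|\mathbb{G}_n|=2^n$, $|\mathbb{T}_n|=2^{n+1}-1$), and $\mathcal{F}_n=\sigma\{X_k,\ k\in\mathbb{T}_n\}$. $[x]$ is the integer part of $x$. It is assumed throughout that for constants $a,b,c,d\in\mathbb{R}$,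 for all $n\ge0$ and $k\in\mathbb{G}_n$, a.s.: $\mathbb{E}[a_k|\mathcal{F}_n]=a$, $\mathbb{E}[b_k|\mathcal{F}_n]=b$, $\mathbb{E}[\varepsilon_{2k}|\mathcal{F}_n]=c$, $\mathbb{E}[\varepsilon_{2k+1}|\mathcal{F}_n]=d$. **Hypotheses.** H1: for all $k\ge1$, $\mathbb{E}[a_k^2]<1$ and $\mathbb{E}[b_k^2]<1$. H2: for all $n\ge0$, $k\in\mathbb{G}_n$, a.s. $\mathrm{Var}[a_k|\mathcal{F}_n]=\sigma_a^2\ge0$, $\mathrm{Var}[b_k|\mathcal{F}_n]=\sigma_b^2\ge0$, $\mathrm{Var}[\varepsilon_{2k}|\mathcal{F}_n]=\sigma_c^2>0$, $\mathrm{Var}[\varepsilon_{2k+1}|\mathcal{F}_n]=\sigma_d^2>0$. H3: for all $n\ge0$: for $k,l\in\mathbb{G}_{n+1}$ with $[k/2]\ne[l/2]$, $\varepsilon_k$ and $\varepsilon_l$ are conditionally independent given $\mathcal{F}_n$; for $k\ne l$ in $\mathbb{G}_n$, $(a_k,b_k)$ and $(a_l,b_l)$ are conditionally independent given $\mathcal{F}_n$; and there exist $\rho_{cd},\rho_{ab}$ with $\rho_{cd}^2<\sigma_c^2\sigma_d^2$, $\rho_{ab}^2\le\sigma_a^2\sigma_b^2$ such that for all $k\in\mathbb{G}_n$, a.s. $\mathbb{E}[(\varepsilon_{2k}-c)(\varepsilon_{2k+1}-d)|\mathcal{F}_n]=\rho_{cd}$ and $\mathbb{E}[(a_k-a)(b_k-b)|\mathcal{F}_n]=\rho_{ab}$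 (the constants not depending on $n$). H4: there exist $\mu_a^4\ge\sigma_a^4$, $\mu_b^4\ge\sigma_b^4$, $\mu_c^4>\sigma_c^4$, $\mu_d^4>\sigma_d^4$ such that for all $n\ge0$, $k\in\mathbb{G}_n$, a.s. $\mathbb{E}[(a_k-a)^4|\mathcal{F}_n]=\mu_a^4$, $\mathbb{E}[(b_k-b)^4|\mathcal{F}_n]=\mu_b^4$, $\mathbb{E}[(\varepsilon_{2k}-c)^4|\mathcal{F}_n]=\mu_c^4$, $\mathbb{E}[(\varepsilon_{2k+1}-d)^4|\mathcal{F}_n]=\mu_d^4$; moreover $\mathbb{E}[\varepsilon_{2k}^4]>\mathbb{E}[\varepsilon_{2k}^2]^2$ and $\mathbb{E}[\varepsilon_{2k+1}^4]>\mathbb{E}[\varepsilon_{2k+1}^2]^2$; and there exist $\nu_{ab}^2\ge\rho_{ab}^2$, $\nu_{cd}^2>\rho_{cd}^2$ such that for all $k\in\mathbb{G}_n$, a.s. $\mathbb{E}[(a_k-a)^2(b_k-b)^2|\mathcal{F}_n]=\nu_{ab}^2$, $\mathbb{E}[(\varepsilon_{2k}-c)^2(\varepsilon_{2k+1}-d)^2|\mathcal{F}_n]=\nu_{cd}^2$. H5: there exists $\alpha>4$ such that a.s. the four quantities $\sup_{n\ge0}\sup_{k\in\mathbb{G}_n}\mathbb{E}[|Z_k|^\alpha|\mathcal{F}_n]$ are finite, for $Z_k=a_k-a$, $b_k-b$, $\varepsilon_{2k}-c$, $\varepsilon_{2k+1}-d$. **Estimator of $\theta$.** Let $c_n=1+X_n^2$,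 $\Phi_n=(X_n,1)^t$, $\chi_n=(X_{2n},X_{2n+1})^t$, $S_n=\sum_{k\in\mathbb{T}_n}\frac1{c_k}\Phi_k\Phi_k^t$. By convention $S_n$ is taken to be invertible for all $n\ge0$; otherwise $S_n$ is replaced by $S_n+I_2$, where $I_2$ is the identity matrix of order 2. For $n\ge1$, set $$\begin{pmatrix}\widehat a_n&\widehat b_n\\\widehat c_n&\widehat d_n\end{pmatrix}=S_{n-1}^{-1}\sum_{k\in\mathbb{T}_{n-1}}\frac1{c_k}\Phi_k\chi_k^t,$$ and let $\widehat a_0,\widehat b_0,\widehat c_0,\widehat d_0$ be arbitrary fixed real numbers. **Variance and covariance estimators.** For $n\ge0$, $k\in\mathbb{G}_n$, let $V_{2k}=X_{2k}-aX_k-c$, $V_{2k+1}=X_{2k+1}-bX_k-d$, $\widehat V_{2k}=X_{2k}-\widehat a_nX_k-\widehat c_n$, $\widehat V_{2k+1}=X_{2k+1}-\widehat b_nX_k-\widehat d_n$. Let $d_k=(1+X_k^2)^2$ for $k\ge1$, $\psi_k=(X_k^2,1)^t$ and $Q_n=\sum_{k\in\mathbb{T}_n}\frac1{d_k}\psi_k\psi_k^t$ (with the same invertibility convention as for $S_n$). Put $\eta=(\sigma_a^2,\sigma_c^2)^t$, $\zeta=(\sigma_b^2,\sigma_d^2)^t$, $\nu=(\rho_{ab},\rho_{cd})^t$ and, for $n\ge1$, $$\widehat\eta_n=Q_{n-1}^{-1}\sum_{k\in\mathbb{T}_{n-1}}\frac1{d_k}\widehat V_{2k}^2\psi_k,\quad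 \widehat\zeta_n=Q_{n-1}^{-1}\sum_{k\in\mathbb{T}_{n-1}}\frac1{d_k}\widehat V_{2k+1}^2\psi_k,\quad \widehat\nu_n=Q_{n-1}^{-1}\sum_{k\in\mathbb{T}_{n-1}}\frac1{d_k}\widehat V_{2k}\widehat V_{2k+1}\psi_k,$$ $$\eta_n=Q_{n-1}^{-1}\sum_{k\in\mathbb{T}_{n-1}}\frac1{d_k}V_{2k}^2\psi_k,\quad \zeta_n=Q_{n-1}^{-1}\sum_{k\in\mathbb{T}_{n-1}}\frac1{d_k}V_{2k+1}^2\psi_k,\quad \nu_n=Q_{n-1}^{-1}\sum_{k\in\mathbb{T}_{n-1}}\frac1{d_k}V_{2k}V_{2k+1}\psi_k.$$ $\|\cdot\|$ is the Euclidean norm. *)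

(* Defs.v *)
From HB Require Import structures.
From mathcomp Require Import all_boot all_order all_algebra.
From mathcomp Require Import all_classical all_reals all_analysis.
From mathcomp Require Import measurable_realfun.

Set Implicit Arguments.
Unset Strict Implicit.
Unset Printing Implicit Defensive.

Import Order.TTheory GRing.Theory Num.Theory.
Import numFieldNormedType.Exports.

Local Open Scope classical_set_scope.
Local Open Scope ring_scope.

(* The binary tree: GG n is the n-th generation, TT n the tree up to it.
   Both are duplicate-free, so that [size] is the cardinal. *)
Definition GG (n : nat) : seq nat := index_iota (2 ^ n) (2 ^ n.+1).
Definition TT (n : nat) : seq nat := index_iota 1 (2 ^ n.+1).

Section conditioning.
Context {disp} {T : measurableType disp} {R : realType} (P : probability T R).

Definition sigma_gen {d'} {T' : measurableType d'} (D : set nat)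
    (Y : nat -> T -> T') : set (set T) :=
  <<s \bigcup_(k in D) g_sigma_algebra_preimage (Y k) >>.

Definition indep_sigma (G G' : set (set T)) : Prop :=
  forall A B, G A -> G' B -> P (A `&` B) = (P A * P B)%E.

Definition iid {d'} {T' : measurableType d'} (D : set nat)
    (Y : nat -> T -> T') : Prop :=
  (forall i j B, D i -> D j -> measurable B ->
     P (Y i @^-1` B) = P (Y j @^-1` B)) /\
  (forall (s : seq nat) (B : nat -> set T'), uniq s ->
     (forall i, i \in s -> D i) -> (forall i, measurable (B i)) ->
     fine (P (\bigcap_(i in [set` s]) (Y i @^-1` B i))) =
     \prod_(i <- s) fine (P (Y i @^-1` B i))).

(* Y is a version of E[X | G], for an integrable X *)
Definition is_condexp (G : set (set T)) (X Y : T -> R) : Prop :=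
  [/\ P.-integrable setT (EFin \o X),
      P.-integrable setT (EFin \o Y),
      g_sigma_algebra_preimage Y `<=` G
    & forall A, G A ->
        (\int[P]_(w in A) (Y w)%:E = \int[P]_(w in A) (X w)%:E)%E].

(* Y is a version of E[X | G], for a nonnegative X, possibly not integrable *)
Definition is_condexp_ge0 (G : set (set T)) (X : T -> R) (Y : T -> \bar R) :
    Prop :=
  [/\ (forall w, 0 <= X w) /\ measurable_fun setT X,
      forall w, (0 <= Y w)%E,
      g_sigma_algebra_preimage Y `<=` G
    & forall A, G A ->
        (\int[P]_(w in A) Y w = \int[P]_(w in A) (X w)%:E)%E].

(* V is a version of Var[X | G] = E[(X - E[X | G])^2 | G] *)
Definition is_condvar (G : set (set T)) (X V : T -> R) : Prop :=
  exists2 Y, is_condexp G X Y & is_condexp G (fun w => (X w - Y w) ^+ 2) V.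

(* P(Y \in B, Z \in C | G) = P(Y \in B | G) P(Z \in C | G) a.s. *)
Definition cond_indep {d1 d2} {T1 : measurableType d1} {T2 : measurableType d2}
    (G : set (set T)) (Y : T -> T1) (Z : T -> T2) : Prop :=
  forall B C, measurable B -> measurable C ->
  exists p q : T -> R,
    [/\ is_condexp G \1_(Y @^-1` B) p,
        is_condexp G \1_(Z @^-1` C) q
      & is_condexp G \1_(Y @^-1` B `&` Z @^-1` C) (fun w => p w * q w)].

End conditioning.

(* Only the indices k >= 1 of X_, a_, b_ and k >= 2 of eps_ are meaningful. *)
Section model.
Context {disp} {T : measurableType disp} {R : realType} (P : probability T R).
Variables X_ a_ b_ eps_ : nat -> {RV P >-> R}.

Definition FF (n : nat) : set (set T) :=
  sigma_gen [set` TT n] (fun k => X_ k : T -> R).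

Definition rcbar (a b c d : R) : Prop :=
  let ab n w := (a_ n w, b_ n w) in
  let ee n w := (eps_ n.*2 w, eps_ n.*2.+1 w) in
  let pos := [set n | (1 <= n)%N] in
  [/\ forall n w, (1 <= n)%N ->
        X_ n.*2 w = a_ n w * X_ n w + eps_ n.*2 w /\
        X_ n.*2.+1 w = b_ n w * X_ n w + eps_ n.*2.+1 w,
      ('E_P[(fun w => (X_ 1%N w ^+ 2)%R)] < +oo)%E,
      [/\ iid P pos ab, iid P pos ee
        & indep_sigma P (sigma_gen pos ab) (sigma_gen pos ee)]
    & forall n k, k \in GG n ->
        [/\ is_condexp P (FF n) (a_ k) (cst a),
            is_condexp P (FF n) (b_ k) (cst b),
            is_condexp P (FF n) (eps_ k.*2) (cst c)
          & is_condexp P (FF n) (eps_ k.*2.+1) (cst d)]].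

Definition H1 : Prop :=
  forall k, (1 <= k)%N ->
    ('E_P[(fun w => (a_ k w ^+ 2)%R)] < 1)%E /\
    ('E_P[(fun w => (b_ k w ^+ 2)%R)] < 1)%E.

Definition H2 (sigma_a sigma_b sigma_c sigma_d : R) : Prop :=
  [/\ 0 <= sigma_a ^+ 2, 0 <= sigma_b ^+ 2,
      0 < sigma_c ^+ 2, 0 < sigma_d ^+ 2
    & forall n k, k \in GG n ->
        [/\ is_condvar P (FF n) (a_ k) (cst (sigma_a ^+ 2)),
            is_condvar P (FF n) (b_ k) (cst (sigma_b ^+ 2)),
            is_condvar P (FF n) (eps_ k.*2) (cst (sigma_c ^+ 2))
          & is_condvar P (FF n) (eps_ k.*2.+1) (cst (sigma_d ^+ 2))]].

Definition H3 (a b c d sigma_a sigma_b sigma_c sigma_d rho_ab rho_cd : R) :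
    Prop :=
  [/\ forall n k l, k \in GG n.+1 -> l \in GG n.+1 -> k./2 != l./2 ->
        cond_indep P (FF n) (eps_ k) (eps_ l),
      forall n k l, k \in GG n -> l \in GG n -> k != l ->
        cond_indep P (FF n) (fun w => (a_ k w, b_ k w))
                            (fun w => (a_ l w, b_ l w)),
      rho_cd ^+ 2 < sigma_c ^+ 2 * sigma_d ^+ 2,
      rho_ab ^+ 2 <= sigma_a ^+ 2 * sigma_b ^+ 2
    & forall n k, k \in GG n ->
        is_condexp P (FF n)
          (fun w => (eps_ k.*2 w - c) * (eps_ k.*2.+1 w - d)) (cst rho_cd) /\
        is_condexp P (FF n)
          (fun w => (a_ k w - a) * (b_ k w - b)) (cst rho_ab)].

Definition H4 (a b c d sigma_a sigma_b sigma_c sigma_d rho_ab rho_cd : R) :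
    Prop :=
  [/\ exists mu_a mu_b mu_c mu_d : R,
        [/\ sigma_a ^+ 4 <= mu_a ^+ 4 /\ sigma_b ^+ 4 <= mu_b ^+ 4,
            sigma_c ^+ 4 < mu_c ^+ 4 /\ sigma_d ^+ 4 < mu_d ^+ 4
          & forall n k, k \in GG n ->
            [/\ is_condexp P (FF n)
                  (fun w => (a_ k w - a) ^+ 4) (cst (mu_a ^+ 4)),
                is_condexp P (FF n)
                  (fun w => (b_ k w - b) ^+ 4) (cst (mu_b ^+ 4)),
                is_condexp P (FF n)
                  (fun w => (eps_ k.*2 w - c) ^+ 4) (cst (mu_c ^+ 4))
              & is_condexp P (FF n)
                  (fun w => (eps_ k.*2.+1 w - d) ^+ 4) (cst (mu_d ^+ 4))]],
      forall k, (1 <= k)%N ->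
        let m2 j := ('E_P[(fun w => (eps_ j w ^+ 2)%R)])%E in
        let m4 j := ('E_P[(fun w => (eps_ j w ^+ 4)%R)])%E in
        (m2 k.*2 * m2 k.*2 < m4 k.*2)%E /\
        (m2 k.*2.+1 * m2 k.*2.+1 < m4 k.*2.+1)%E
    & exists nu_ab nu_cd : R,
        [/\ rho_ab ^+ 2 <= nu_ab ^+ 2,
            rho_cd ^+ 2 < nu_cd ^+ 2
          & forall n k, k \in GG n ->
            is_condexp P (FF n)
              (fun w => (a_ k w - a) ^+ 2 * (b_ k w - b) ^+ 2)
              (cst (nu_ab ^+ 2)) /\
            is_condexp P (FF n)
              (fun w => (eps_ k.*2 w - c) ^+ 2 * (eps_ k.*2.+1 w - d) ^+ 2)
              (cst (nu_cd ^+ 2))]].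

(* sup_n sup_(k in G_n) E[|Z k|^alpha | F_n] is a.s. finite.  Conditional
   expectations being unique a.s. and k ranging over a countable set, the choice
   of the versions W k is immaterial. *)
Definition sup_condmoment_finite (alpha : R) (Z : nat -> T -> R) : Prop :=
  exists2 W : nat -> T -> \bar R,
    (forall n k, k \in GG n ->
       is_condexp_ge0 P (FF n) (fun w => `|Z k w| `^ alpha) (W k)) &
    {ae P, forall w,
       (ereal_sup [set y | exists n k, k \in GG n /\ y = W k w] < +oo)%E}.

Definition H5 (a b c d : R) : Prop :=
  exists2 alpha : R, 4 < alpha &
    [/\ sup_condmoment_finite alpha (fun k w => a_ k w - a),
        sup_condmoment_finite alpha (fun k w => b_ k w - b),
        sup_condmoment_finite alpha (fun k w => eps_ k.*2 w - c)
      & sup_condmoment_finite alpha (fun k w => eps_ k.*2.+1 w - d)].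

End model.

Arguments FF {disp T R} P X_ n.
Arguments rcbar {disp T R} P X_ a_ b_ eps_ a b c d.
Arguments H1 {disp T R} P a_ b_.
Arguments H2 {disp T R} P X_ a_ b_ eps_ sigma_a sigma_b sigma_c sigma_d.
Arguments H3 {disp T R} P X_ a_ b_ eps_ a b c d
  sigma_a sigma_b sigma_c sigma_d rho_ab rho_cd.
Arguments H4 {disp T R} P X_ a_ b_ eps_ a b c d
  sigma_a sigma_b sigma_c sigma_d rho_ab rho_cd.
Arguments H5 {disp T R} P X_ a_ b_ eps_ a b c d.

(* The estimators are functions of the observed trajectory x = (x_k)_(k >= 1);
   the random estimators are obtained at x = (X_k(w))_k. *)
Section estimators.
Context {R : realType}.

Definition col2 (u v : R) : 'cV[R]_2 := \col_i (if i == 0 then u else v).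

(* The norm of 'cV[R]_2 in the library is the sup norm. *)
Definition enorm (v : 'cV[R]_2) : R := Num.sqrt (\sum_i v i 0 ^+ 2).

(* Convention for normalizing matrices that are not invertible *)
Definition regularize (S : 'M[R]_2) : 'M[R]_2 :=
  if S \in unitmx then S else S + 1%:M.

Variable x : nat -> R.

Definition Phi (k : nat) : 'cV[R]_2 := col2 (x k) 1.
Definition chi (k : nat) : 'cV[R]_2 := col2 (x k.*2) (x k.*2.+1).

Definition S_mx (n : nat) : 'M[R]_2 :=
  \sum_(k <- TT n) (1 + x k ^+ 2)^-1 *: (Phi k *m (Phi k)^T).

(* theta_hat n = [[a^_n, b^_n], [c^_n, d^_n]]; theta0 is the initial value. *)
Definition theta_hat (theta0 : 'M[R]_2) (n : nat) : 'M[R]_2 :=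
  if n is m.+1 then
    invmx (regularize (S_mx m)) *m
      \sum_(k <- TT m) (1 + x k ^+ 2)^-1 *: (Phi k *m (chi k)^T)
  else theta0.

(* V_even k, V_odd k stand for V_(2k), V_(2k+1); likewise for the hat versions,
   where trunc_log 2 k is the generation n of k, i.e., k \in GG n. *)
Definition V_even (a c : R) (k : nat) : R := x k.*2 - a * x k - c.
Definition V_odd (b d : R) (k : nat) : R := x k.*2.+1 - b * x k - d.

Definition Vhat_even (theta0 : 'M[R]_2) (k : nat) : R :=
  let th := theta_hat theta0 (trunc_log 2 k) in V_even (th 0 0) (th 1 0) k.
Definition Vhat_odd (theta0 : 'M[R]_2) (k : nat) : R :=
  let th := theta_hat theta0 (trunc_log 2 k) in V_odd (th 0 1) (th 1 1) k.

Definition psi (k : nat) : 'cV[R]_2 := col2 (x k ^+ 2) 1.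

Definition Q_mx (n : nat) : 'M[R]_2 :=
  \sum_(k <- TT n) ((1 + x k ^+ 2) ^+ 2)^-1 *: (psi k *m (psi k)^T).

(* Q_(n-1)^-1 \sum_(k in T_(n-1)) 1/d_k g_k psi_k, meant for n >= 1 *)
Definition quad_est (g : nat -> R) (n : nat) : 'cV[R]_2 :=
  invmx (regularize (Q_mx n.-1)) *m
    \sum_(k <- TT n.-1) (((1 + x k ^+ 2) ^+ 2)^-1 * g k) *: psi k.

Definition eta_hat (theta0 : 'M[R]_2) : nat -> 'cV[R]_2 :=
  quad_est (fun k => Vhat_even theta0 k ^+ 2).
Definition zeta_hat (theta0 : 'M[R]_2) : nat -> 'cV[R]_2 :=
  quad_est (fun k => Vhat_odd theta0 k ^+ 2).
Definition nu_hat (theta0 : 'M[R]_2) : nat -> 'cV[R]_2 :=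
  quad_est (fun k => Vhat_even theta0 k * Vhat_odd theta0 k).

Definition eta_n (a c : R) : nat -> 'cV[R]_2 :=
  quad_est (fun k => V_even a c k ^+ 2).
Definition zeta_n (b d : R) : nat -> 'cV[R]_2 :=
  quad_est (fun k => V_odd b d k ^+ 2).
Definition nu_n (a b c d : R) : nat -> 'cV[R]_2 :=
  quad_est (fun k => V_even a c k * V_odd b d k).

End estimators.

Definition rate (R : realType) (n : nat) : R := n%:R / (size (TT n.-1))%:R.
Arguments rate : clear implicits.

(* Main.v *)
Require Import Defs.
From HB Require Import structures.
From mathcomp Require Import all_boot all_order all_algebra.
From mathcomp Require Import all_classical all_reals all_analysis.
From mathcomp Require Import measurable_realfun.
From mathcomp Require Import ring lra zify.

Set Implicit Arguments.
Unset Strict Implicit.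
Unset Printing Implicit Defensive.

Import Order.TTheory GRing.Theory Num.Theory.
Import numFieldNormedType.Exports.

Local Open Scope classical_set_scope.
Local Open Scope ring_scope.

(* Idea. The sibling noises N_k = ((a_k, b_k), (eps_2k, eps_(2k+1))) are i.i.d. with
   independent components; of the conditional hypotheses only the total
   expectations are used. X_1 may depend on the noise, so write
   X_k = Y_k + X_1 A_k with Y started at 0 and A_k the product of the coefficients
   along the path from the root to k; E|A_k| and E A_k^2 decay geometrically in the
   generation of k.
   (1) For f bounded and Lipschitz and U_j = sum_(k in G_j) f(X_k) xi_k with xi_k a
   centered function of N_k, sum_(j < n) U_j^2 / 2^j = O(n) a.s.: for Y this is an
   L^2 law of large numbers for martingale differences in the order of the tree,
   and it is transferred to X uniformly over the possible values of X_1.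
   (2) det Q_n = |T_n| sum u_k^2 - (sum u_k)^2 with u_k = 1 / (1 + X_k^2), and
   det Q_n <= 2 det S_n. This empirical variance of u is at least of order 4^n:
   otherwise some starting point x would have u constant on both its even child and
   its even grandchild, which forces eps^2 to be constant, against E eps^4 > (E eps^2)^2.
   (3) By (2), theta_hat_l - theta = O(2^-l) sum_(j < l) U_j, hence by (1)
   sum_(l <= n) 2^l |theta_hat_l - theta|^2 = O(n). Expanding
   hatV hatV' - V V' gives a term bounded by this sum and cross terms bounded by
   it and (1) through Cauchy-Schwarz; Q_(n-1)^-1 = O(2^-n) yields the rate. *)

(** * Expectations and square-integrable variables *)

(** Nothing makes [X_1] independent of the noise, so [X_k] need not be adapted to the filtration of
    the noise. Limit theorems are therefore proved for the whole family [Y0 + x * Apath], with the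
    real [x] quantified inside the almost sure statement, and [x = X_1(w)] is substituted at the
    end. For the law of large numbers a Lipschitz bound in [x] is enough; for the squares it would
    leave a factor 2^j, which is recovered by a grid of mesh 2^-j in generation j. The numerator n
    of the rate comes from U_j^2 / 2^j: its mean is bounded, and what is controlled almost surely is
    its sum over j < n. The spread of u needs two steps of the chain: from one particular state the
    even child may live on {r, -r}, where u is constant, and only the next step tests r and -r as
    starting points. Positivity at each state becomes a uniform bound by continuity on a compact
    set, and tightness keeps enough nodes in that set. Once the squares, the spread and the law of
    large numbers hold at a sample point, everything about the estimators is deterministic. *)

Section expectation.
Context {disp} {T : measurableType disp} {R : realType} (P : probability T R).
Implicit Types F G : T -> R.

Definition Ex F : R := \int[P]_w F w.

Definition integ F : Prop := P.-integrable setT (EFin \o F).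

Definition L2 F : Prop := measurable_fun setT F /\ integ (fun w => F w ^+ 2).

Lemma integ_meas F : integ F -> measurable_fun setT F.
Proof. by move/measurable_int/measurable_EFinP. Qed.

Lemma eq_Ex F G : F =1 G -> Ex F = Ex G.
Proof. by move=> /funext ->. Qed.

Lemma eq_integ F G : F =1 G -> integ F -> integ G.
Proof. by move=> /funext ->. Qed.

Lemma Ex_cst c : Ex (fun=> c) = c.
Proof.
rewrite /Ex Rintegral_cst// -[RHS]mulr1; congr (_ * _).
by transitivity (fine (1%E : \bar R)) => //; congr fine; exact: probability_setT.
Qed.

Lemma integ_cst c : integ (fun=> c).
Proof.
apply: (@finite_measure_integrable_cst _ _ _ P setT c).
exact: measurableT.
Qed.

Lemma integD F G : integ F -> integ G -> integ (fun w => F w + G w).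
Proof. by move=> iF iG; exact: (integrableD _ iF iG). Qed.

Lemma integZ c F : integ F -> integ (fun w => c * F w).
Proof. by move=> iF; exact: (integrableZl _ _ iF). Qed.

Lemma integN F : integ F -> integ (fun w => - F w).
Proof. by move=> iF; exact: (integrableN iF). Qed.

Lemma integB F G : integ F -> integ G -> integ (fun w => F w - G w).
Proof. by move=> iF iG; apply: integD => //; exact: integN. Qed.

Lemma integ_sum (I : Type) (s : seq I) (p : pred I) (F : I -> T -> R) :
  (forall i, p i -> integ (F i)) -> integ (fun w => \sum_(i <- s | p i) F i w).
Proof.
move=> iF; rewrite /integ.
have -> : EFin \o (fun w => \sum_(i <- s | p i) F i w) =
    (fun w => \sum_(i <- s | p i) (F i w)%:E)%E.
  by apply/funext => w /=; rewrite sumEFin.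
by apply: integrable_sum => // i pi; exact: iF.
Qed.

Lemma le_integ F G : measurable_fun setT F -> (forall w, `|F w| <= G w) ->
  integ G -> integ F.
Proof.
move=> mF FG iG; apply: (le_integrable _ _ _ iG) => //.
  exact/measurable_EFinP.
by move=> w _ /=; rewrite lee_fin (le_trans (FG w))// ler_norm.
Qed.

Lemma integ_bounded F c : measurable_fun setT F -> (forall w, `|F w| <= c) ->
  integ F.
Proof. by move=> mF Fc; apply: (le_integ mF Fc); exact: integ_cst. Qed.

Lemma integ_norm F : integ F -> integ (fun w => `|F w|).
Proof. by move=> iF; exact: (integrable_abse iF). Qed.

Lemma ExD F G : integ F -> integ G -> Ex (fun w => F w + G w) = Ex F + Ex G.
Proof. by move=> iF iG; exact: RintegralD. Qed.

Lemma ExB F G : integ F -> integ G -> Ex (fun w => F w - G w) = Ex F - Ex G.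
Proof. by move=> iF iG; exact: RintegralB. Qed.

Lemma ExZ c F : integ F -> Ex (fun w => c * F w) = c * Ex F.
Proof. by move=> iF; exact: RintegralZl. Qed.

Lemma Ex_ge0 F : (forall w, 0 <= F w) -> 0 <= Ex F.
Proof. by move=> F0; apply: Rintegral_ge0 => w _. Qed.

Lemma le_Ex F G : integ F -> integ G -> (forall w, F w <= G w) -> Ex F <= Ex G.
Proof. by move=> iF iG FG; apply: le_Rintegral => // w _. Qed.

Lemma ler_norm_Ex F : integ F -> `|Ex F| <= Ex (fun w => `|F w|).
Proof. by move=> iF; exact: le_normr_Rintegral. Qed.

Lemma Ex_sum (I : Type) (s : seq I) (p : pred I) (F : I -> T -> R) :
  (forall i, p i -> integ (F i)) ->
  Ex (fun w => \sum_(i <- s | p i) F i w) = \sum_(i <- s | p i) Ex (F i).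
Proof.
move=> iF; elim: s => [|i s IH].
  by rewrite big_nil -[RHS](Ex_cst 0); apply: eq_Ex => w; rewrite big_nil.
rewrite big_cons; case: ifPn => pi.
  rewrite -IH -ExD//; [|exact: iF|exact: integ_sum].
  by apply: eq_Ex => w; rewrite big_cons pi.
by rewrite -IH; apply: eq_Ex => w; rewrite big_cons (negbTE pi).
Qed.

Lemma EFin_Ex F : integ F -> (\int[P]_w (F w)%:E = (Ex F)%:E)%E.
Proof. by move=> iF; rewrite /Ex /Rintegral fineK// integrable_fin_num. Qed.

Lemma integ_ge0 F (c : R) : measurable_fun setT F -> (forall w, 0 <= F w) ->
  (\int[P]_w (F w)%:E <= c%:E)%E -> integ F.
Proof.
move=> mF F0 Fc; apply/integrableP; split; first exact/measurable_EFinP.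
apply: le_lt_trans (ltry c).
by under eq_integral do rewrite /= ger0_norm//.
Qed.

Lemma Ex_eq0 F : integ F -> (forall w, 0 <= F w) -> Ex F = 0 ->
  {ae P, forall w, F w = 0}.
Proof.
move=> iF F0 E0.
have [+ _] := ae_eq_integral_abs P measurableT (measurable_int P iF).
have -> : (\int[P]_w `|(EFin \o F) w| = 0)%E.
  under eq_integral do rewrite /= ger0_norm//.
  by rewrite EFin_Ex// E0.
move=> /(_ erefl); apply: filterS => w /(_ I) /=.
by case.
Qed.

Lemma ae_Ex_eq F G : integ F -> integ G -> {ae P, forall w, F w = G w} ->
  Ex F = Ex G.
Proof.
move=> iF iG FG; congr fine; apply: ae_eq_integral => //.
- exact: measurable_int iF.
- exact: measurable_int iG.
by apply: filterS FG => w /= ->.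
Qed.

Lemma ae_event (A : set T) : {ae P, forall w, A w} -> exists w, A w.
Proof.
move=> aeA; apply/not_existsP => nA.
have [B [mB PB sB]] := aeA.
have BT : B = setT by rewrite -subTset => w _; apply: sB; exact: nA.
by move: PB; rewrite BT => /eqP; rewrite probability_setT onee_eq0.
Qed.

Lemma eq_L2 F G : F =1 G -> L2 F -> L2 G.
Proof. by move=> /funext ->. Qed.

Lemma L2_meas F : L2 F -> measurable_fun setT F. Proof. by case. Qed.

Lemma integM F G : L2 F -> L2 G -> integ (fun w => F w * G w).
Proof.
move=> [mF F2] [mG G2].
apply: (@le_integ _ (fun w => F w ^+ 2 + G w ^+ 2)); last exact: integD.
  exact: measurable_funM.
move=> w; rewrite normrM -(real_normK (num_real (F w))).
rewrite -(real_normK (num_real (G w))).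
have := normr_ge0 (F w); have := normr_ge0 (G w).
by nra.
Qed.

Lemma L2_bounded F c : measurable_fun setT F -> (forall w, `|F w| <= c) -> L2 F.
Proof.
move=> mF Fc; split => //; apply: (@integ_bounded _ (c ^+ 2)).
  exact: measurable_funX.
move=> w; rewrite normrX lerXn2r// ?nnegrE//.
exact: le_trans (Fc w).
Qed.

Lemma L2_cst c : L2 (fun=> c).
Proof. by apply: (@L2_bounded _ `|c|). Qed.

Lemma L2_integ F : L2 F -> integ F.
Proof.
move=> LF; have := integM LF (L2_cst 1).
by apply: eq_integrable => // w _ /=; rewrite mulr1.
Qed.

Lemma L2D F G : L2 F -> L2 G -> L2 (fun w => F w + G w).
Proof.
move=> LF LG; split; first by apply: measurable_funD; [case: LF|case: LG].
have := integD (integD LF.2 (integZ 2 (integM LF LG))) LG.2.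
by apply: eq_integrable => // w _ /=; congr EFin; ring.
Qed.

Lemma L2Z c F : L2 F -> L2 (fun w => c * F w).
Proof.
move=> LF; split; first by apply: measurable_funM => //; case: LF.
have := integZ (c ^+ 2) LF.2.
by apply: eq_integrable => // w _ /=; rewrite exprMn.
Qed.

Lemma L2B F G : L2 F -> L2 G -> L2 (fun w => F w - G w).
Proof.
move=> LF LG; have := L2D LF (L2Z (-1) LG).
by congr L2; apply/funext => w; rewrite mulN1r.
Qed.

Lemma L2_sum (I : Type) (s : seq I) (p : pred I) (F : I -> T -> R) :
  (forall i, p i -> L2 (F i)) -> L2 (fun w => \sum_(i <- s | p i) F i w).
Proof.
move=> LF; elim: s => [|i s IH].
  by apply: (eq_L2 _ (L2_cst 0)) => w; rewrite big_nil.
case: (boolP (p i)) => pi; last first.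
  by apply: (eq_L2 _ IH) => w; rewrite big_cons (negbTE pi).
by apply: (eq_L2 _ (L2D (LF _ pi) IH)) => w; rewrite big_cons pi.
Qed.

Lemma le_L2 F G : measurable_fun setT F -> (forall w, `|F w| <= `|G w|) ->
  L2 G -> L2 F.
Proof.
move=> mF FG [mG G2]; split => //.
apply: (le_integ _ _ G2); first exact: measurable_funX.
by move=> w; rewrite normrX -(real_normK (num_real (G w))) lerXn2r ?nnegrE.
Qed.

End expectation.

(** * Almost sure bounds from summable expectations *)

Section almost_sure_summability.
Context {disp} {T : measurableType disp} {R : realType} (P : probability T R).

(** By monotone convergence the full series has expectation at most [C], so it is finite almost
    everywhere, and its value bounds all partial sums. Every almost sure limit below starts from a
    summable moment in this way. *)
Lemma ae_bounded_series (F : nat -> T -> R) (C : R) :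
  (forall n, measurable_fun setT (F n)) -> (forall n w, 0 <= F n w) ->
  (forall n, integ P (F n)) ->
  (forall n, \sum_(i < n) Ex P (F i) <= C) ->
  {ae P, forall w, exists M, forall n, \sum_(i < n) F i w <= M}.
Proof.
move=> mF F0 iF FC.
pose S w := (\sum_(i <oo) (F i w)%:E)%E.
have S0 w : (0 <= S w)%E by apply: nneseries_ge0 => i _ _; rewrite lee_fin.
have mS : measurable_fun setT S.
  apply: ge0_emeasurable_sum => //; first by move=> k w _ _; rewrite lee_fin.
  by move=> k _; exact/measurable_EFinP.
have iS : P.-integrable setT S.
  apply/integrableP; split => //.
  apply: (@le_lt_trans _ _ C%:E); last exact: ltry.
  under eq_integral do rewrite gee0_abs//.
  rewrite integral_nneseries//; last 2 first.
    by move=> k; exact/measurable_EFinP.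
    by move=> k w _; rewrite lee_fin.
  apply: lime_le.
    apply: is_cvg_nneseries => n _ _; apply: integral_ge0 => w _.
    by rewrite lee_fin.
  apply: nearW => n; rewrite big_mkord.
  under eq_bigr do rewrite EFin_Ex//.
  by rewrite sumEFin lee_fin.
have := integrable_ae measurableT iS; apply: filterS => w /(_ I) Sfin.
exists (fine (S w)) => n; rewrite -lee_fin fineK// -sumEFin.
rewrite -(big_mkord xpredT (fun i => (F i w)%:E)).
by apply: nneseries_lim_ge => k _; rewrite lee_fin.
Qed.

Lemma geometric_sum_le (r : R) n : 0 <= r < 1 ->
  \sum_(i < n) r ^+ i <= (1 - r)^-1.
Proof.
move=> /andP[r0 r1]; have r1' : 0 < 1 - r by rewrite subr_gt0.
rewrite -[leRHS]mul1r ler_pdivlMr// mulrC.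
have := subrX1 r n; rewrite -opprB -[1 - r]opprB mulNr => H.
have -> : (r - 1) * \sum_(i < n) r ^+ i = r ^+ n - 1 by rewrite -H opprB.
by rewrite opprB gerBl exprn_ge0.
Qed.

Lemma ae_bounded_geometric (F : nat -> T -> R) (C r : R) :
  0 <= r < 1 -> (forall n, measurable_fun setT (F n)) ->
  (forall n w, 0 <= F n w) ->
  (forall n, integ P (F n)) -> (forall n, Ex P (F n) <= C * r ^+ n) ->
  {ae P, forall w, exists M, forall n, \sum_(i < n) F i w <= M}.
Proof.
move=> r01 mF F0 iF FC.
have C0 : 0 <= C.
  by have := le_trans (Ex_ge0 P (F0 0)) (FC 0); rewrite expr0 mulr1.
apply: (@ae_bounded_series _ (C / (1 - r))) => // n.
apply: (@le_trans _ _ (\sum_(i < n) C * r ^+ i)); first exact: ler_sum.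
by rewrite -mulr_sumr ler_wpM2l// geometric_sum_le.
Qed.

Lemma bounded_series_cvg0 (u : nat -> R) (M : R) : (forall n, 0 <= u n) ->
  (forall n, \sum_(i < n) u i <= M) -> u n @[n --> \oo] --> 0.
Proof.
move=> u0 uM; apply: cvg_series_cvg_0; apply: nondecreasing_is_cvgn.
  by apply: nondecreasing_series => n _ _.
exists M => _ [n _ <-]; rewrite /series/= big_mkord; exact: uM.
Qed.

End almost_sure_summability.

(** * Independence *)

Section independence.
Context {disp} {T : measurableType disp} {R : realType} (P : probability T R).

(** Uniqueness of measures on a pi-system, used twice: for fixed [B] in [D'] the restriction of [P]
    to [B] and the multiple [P B] of [P] agree on [D], hence on [<<s D >>]; then the two sides
    exchange roles. *)
Lemma indep_generated (D D' : set (set T)) :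
  D `<=` measurable -> D' `<=` measurable ->
  setI_closed D -> setI_closed D' -> D setT -> D' setT ->
  (forall A B, D A -> D' B -> P (A `&` B) = (P A * P B)%E) ->
  indep_sigma P <<s D >> <<s D' >>.
Proof.
move=> mD mD' ID ID' DT D'T PDD'.
have sm (G : set (set T)) : G `<=` measurable -> <<s G >> `<=` measurable.
  by move=> mG; apply: smallest_sub => //; exact: sigma_algebra_measurable.
have half (G G' : set (set T)) : G `<=` measurable -> G' `<=` measurable ->
    setI_closed G -> G setT ->
    (forall A B, G A -> G' B -> P (A `&` B) = (P A * P B)%E) ->
    forall A B, <<s G >> A -> G' B -> P (A `&` B) = (P A * P B)%E.
  move=> mG mG' IG GT PGG' A B sA G'B.
  have PBfin : P B = (fine (P B))%:E by rewrite fineK//; apply: fin_num_measure; exact: mG'.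
  have PB0 : (0 <= fine (P B))%R by rewrite fine_ge0// measure_ge0.
  have := @g_sigma_algebra_measure_unique _ R T G mG (fun=> setT) (fun=> GT) _
    (mrestr P (mG' _ G'B)) (mscale (NngNum PB0) P) IG.
  have -> : (P A * P B = mscale (NngNum PB0) P A)%E.
    by rewrite /mscale/= muleC -PBfin.
  apply => //.
  - by rewrite bigcup_const.
  - move=> C GC; rewrite /= /mrestr /mscale/= -PBfin muleC.
    exact: PGG'.
  - move=> _; rewrite /= /mrestr.
    exact: (le_lt_trans (probability_le1 P (measurableI _ _ measurableT (mG' _ G'B))) (ltry _)).
have h1 := half _ _ mD mD' ID DT PDD'.
move=> A B sA sB; rewrite setIC muleC.
apply: (half D' <<s D >>) => //.
- exact: sm.
- by move=> B' A' DB' DA'; rewrite setIC muleC; exact: h1.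
Qed.

Section freezing.
Context {d1 d2} {S1 : measurableType d1} {S2 : measurableType d2}.
Variables (U : T -> S1) (V : T -> S2).
Hypotheses (mU : measurable_fun setT U) (mV : measurable_fun setT V).
Hypothesis indUV : forall A B, measurable A -> measurable B ->
  P (U @^-1` A `&` V @^-1` B) = (P (U @^-1` A) * P (V @^-1` B))%E.

Let U' : {mfun T >-> S1} := mfun_Sub (mem_set mU).
Let V' : {mfun T >-> S2} := mfun_Sub (mem_set mV).
Let mUV : measurable_fun setT (fun w => (U w, V w)).
Proof. exact: measurable_fun_pair. Qed.
Let W' : {mfun T >-> (S1 * S2)%type} := mfun_Sub (mem_set mUV).
Let m1 := distribution P U'.
Let m2 := distribution P V'.

Let law_pair A : measurable A -> (m1 \x m2)%E A = distribution P W' A.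
Proof.
by move=> mA; apply: product_measure_unique.
Qed.

(** Independence says that the law of the pair is the product [m1 \x m2], so the integral is
    iterated. The Tonelli form comes first because it is what proves products integrable, before
    [freezing] can be applied to them. *)
Lemma freezing_ge0 (Psi : S1 * S2 -> R) :
  measurable_fun setT Psi -> (forall z, 0 <= Psi z) ->
  (\int[P]_w (Psi (U w, V w))%:E =
   \int[P]_w \int[P]_w' (Psi (U w, V w'))%:E)%E.
Proof.
move=> mPsi Psi0; have mE : measurable_fun setT (EFin \o Psi) by exact/measurable_EFinP.
transitivity (\int[distribution P W']_z (Psi z)%:E)%E.
  by rewrite (@ge0_integral_distribution _ _ _ _ _ P W')// => z; rewrite lee_fin.
transitivity (\int[(m1 \x m2)%E]_z (Psi z)%:E)%E.
  by apply: eq_measure_integral => A mA _; exact/esym/law_pair.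
rewrite (fubini_tonelli1 (EFin \o Psi))//.
rewrite /fubini_F (@ge0_integral_distribution _ _ _ _ _ P U').
- apply: eq_integral => w _ /=.
  rewrite (@ge0_integral_distribution _ _ _ _ _ P V')//.
    by apply/measurable_EFinP; exact: measurable_fun_pair2.
  by move=> y; rewrite /= lee_fin.
- by apply: measurable_fun_fubini_tonelli_F => // z; rewrite /= lee_fin.
- by move=> x; apply: integral_ge0 => y _; rewrite /= lee_fin.
Qed.

Lemma freezing (Psi : S1 * S2 -> R) :
  measurable_fun setT Psi -> integ P (fun w => Psi (U w, V w)) ->
  (forall x, integ P (fun w => Psi (x, V w))) ->
  (\int[P]_w (Psi (U w, V w))%:E =
   \int[P]_w \int[P]_w' (Psi (U w, V w'))%:E)%E.
Proof.
move=> mPsi iPsi iV; have mE : measurable_fun setT (EFin \o Psi) by exact/measurable_EFinP.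
have iW : (distribution P W').-integrable setT (EFin \o Psi).
  by apply: (integrable_pushforward (phi := W')).
transitivity (\int[distribution P W']_z (Psi z)%:E)%E.
  by rewrite (@integral_distribution _ _ _ _ _ P W').
have iprod : (m1 \x m2)%E.-integrable setT (EFin \o Psi).
  apply/integrableP; split => //.
  move/integrableP : iW => [_]; congr (_ < _)%E.
  by apply: eq_measure_integral => A mA _; exact/esym/law_pair.
transitivity (\int[(m1 \x m2)%E]_z (Psi z)%:E)%E.
  by apply: eq_measure_integral => A mA _; exact/esym/law_pair.
rewrite -(integral12_prod_meas1 iprod) /fubini_F.
have eqF x : (\int[m2]_y (Psi (x, y))%:E = \int[P]_w' (Psi (x, V w'))%:E)%E.
  rewrite (@integral_distribution _ _ _ _ _ P V' (fun y => (Psi (x, y))%:E))//.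
    by apply/measurable_EFinP; exact: measurable_fun_pair2.
  exact: iV.
rewrite (@integral_distribution _ _ _ _ _ P U').
- by apply: eq_integral => w _ /=; exact: eqF.
- exact: (measurable_fubini_F iprod).
- have /integrableP[mF] := integrable_fubini_F iprod.
  rewrite (@ge0_integral_distribution _ _ _ _ _ P U' (fun x => `|fubini_F _ _ x|%E))//.
  + by move=> iF; apply/integrableP; split => //; exact: measurableT_comp.
  + exact: measurableT_comp.
Qed.

End freezing.
End independence.

(** * Martingale differences in the order of the tree *)

Lemma cvg_sqr0 (R : realType) (u : nat -> R) :
  u n ^+ 2 @[n --> \oo] --> 0 -> u n @[n --> \oo] --> 0.
Proof.
move=> u2; apply/cvgrPdist_lt => e e0.
have e20 : 0 < e ^+ 2 by rewrite exprn_gt0.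
move/cvgrPdist_lt : u2 => /(_ _ e20); apply: filterS => n.
rewrite !sub0r !normrN normrX => h.
by move: h; rewrite ltr_pXn2r// nnegrE// ltW.
Qed.

Section filtration.
Context {disp} {T : measurableType disp} {R : realType} (P : probability T R).
Context {d'} {S : measurableType d'} (N : nat -> T -> S).

(** The past is indexed by nodes, not by generations. The value at node k depends only on the noise
    of its strict ancestors, all numbered below k, while [N k] serves the children of k; the strict
    bound [j < k] thus puts the value of k in the past and leaves [N k] independent of it. *)
Definition past_gen (k : nat) : set (set T) :=
  \bigcup_(j in [set j | (1 <= j < k)%N]) g_sigma_algebra_preimage (N j).

Definition past_meas (k : nat) {d} {S' : measurableType d} (F : T -> S') : Prop :=
  measurable_fun (setT : set (g_sigma_algebraType (past_gen k))) F.

(** Vanishing conditional expectation given the past, expressed as orthogonality to all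
    square-integrable variables of the past; this is the only form in which it is used. *)
Definition mdiff (k : nat) (Psi : T -> R) : Prop :=
  [/\ L2 P Psi, past_meas k.+1 Psi
    & forall Z, past_meas k Z -> L2 P Z -> Ex P (fun w => Z w * Psi w) = 0].

Definition noise_indep : Prop := forall k A B, (1 <= k)%N ->
  <<s past_gen k >> A -> measurable B ->
  P (A `&` N k @^-1` B) = (P A * P (N k @^-1` B))%E.

Hypothesis mN : forall k, measurable_fun setT (N k).

Lemma past_sub k : <<s past_gen k >> `<=` measurable.
Proof.
apply: smallest_sub; first exact: sigma_algebra_measurable.
by move=> A [j _ [B mB <-]]; exact: mN.
Qed.

Lemma past_meas_meas k {d} {S' : measurableType d} (F : T -> S') :
  past_meas k F -> measurable_fun setT F.
Proof. by move=> mF _ B mB; apply: (@past_sub k); exact: mF. Qed.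

Lemma past_meas_le k l {d} {S' : measurableType d} (F : T -> S') : (k <= l)%N ->
  past_meas k F -> past_meas l F.
Proof.
move=> kl mF _ B mB; apply: sub_sigma_algebra2 (mF measurableT B mB).
move=> A [j /= /andP[j1 jk] NA].
by exists j => //=; rewrite j1 (leq_trans jk).
Qed.

Lemma past_meas_noise j k : (1 <= j < k)%N -> past_meas k (N j).
Proof.
move=> jk _ B mB; apply: sub_sigma_algebra.
by exists j => //; exists B => //; rewrite setTI.
Qed.

Lemma past_meas_fnoise j k {d} {S' : measurableType d} (q : S -> S') :
  measurable_fun setT q ->
  (1 <= j < k)%N -> past_meas k (fun w => q (N j w)).
Proof.
by move=> mq jk; apply: (measurableT_comp mq); exact: past_meas_noise.
Qed.

Hypothesis indN : noise_indep.

Lemma indep_Ex k F (q : S -> R) : (1 <= k)%N -> past_meas k F ->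
  measurable_fun setT q -> integ P F -> integ P (fun w => q (N k w)) ->
  integ P (fun w => F w * q (N k w)) /\
  Ex P (fun w => F w * q (N k w)) = Ex P F * Ex P (fun w => q (N k w)).
Proof.
move=> k1 pF mq iF iq.
have mF := past_meas_meas pF.
have ind A B : measurable A -> measurable B ->
    P (F @^-1` A `&` N k @^-1` B) = (P (F @^-1` A) * P (N k @^-1` B))%E.
  move=> mA mB; apply: indN => //.
  by have := pF measurableT A mA; rewrite setTI.
have mFq : measurable_fun setT (fun w => F w * q (N k w)).
  by apply: measurable_funM => //; exact: measurableT_comp.
have mPsi : measurable_fun setT (fun z : R * S => z.1 * q z.2).
  by apply: measurable_funM => //; exact: measurableT_comp.
(* Integrability comes first, from Tonelli applied to the absolute values; the signed identity then
   follows from Fubini. *)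
have iFq : integ P (fun w => F w * q (N k w)).
  suff : integ P (fun w => `|F w * q (N k w)|).
    by apply: le_integ => // w; rewrite ?normr_id.
  apply: (@integ_ge0 _ _ _ _ _ (Ex P (fun w => `|F w|) *
      Ex P (fun w => `|q (N k w)|))) => //.
    exact: measurableT_comp.
  rewrite (freezing_ge0 mF (mN k) ind (Psi := fun z => `|z.1 * q z.2|))//; last first.
    exact: measurableT_comp.
  under eq_integral => w _.
    have -> : (\int[P]_w' (`|F w * q (N k w')|)%:E =
        (Ex P (fun w => `|q (N k w)|) * `|F w|)%:E)%E.
      rewrite EFin_Ex; last by apply: integ_norm; exact: integZ.
      congr EFin; rewrite mulrC -ExZ; last exact: integ_norm.
      by apply: eq_Ex => w'; rewrite normrM.
    over.
  by rewrite EFin_Ex ?ExZ 1?mulrC//; do 1?[apply: integZ]; exact: integ_norm.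
split => //.
apply: EFin_inj; rewrite -EFin_Ex//.
rewrite (freezing mF (mN k) ind (Psi := fun z => z.1 * q z.2))//; last first.
  by move=> x; exact: integZ.
under eq_integral => w _.
  rewrite /= EFin_Ex; last exact: integZ.
  rewrite ExZ// mulrC.
  over.
by rewrite EFin_Ex ?ExZ 1?mulrC//; exact: integZ.
Qed.

Lemma mdiffM k F (q : S -> R) : (1 <= k)%N -> past_meas k F -> L2 P F ->
  measurable_fun setT q -> L2 P (fun w => q (N k w)) ->
  Ex P (fun w => q (N k w)) = 0 ->
  mdiff k (fun w => F w * q (N k w)) /\
  Ex P (fun w => (F w * q (N k w)) ^+ 2) =
  Ex P (fun w => F w ^+ 2) * Ex P (fun w => q (N k w) ^+ 2).
Proof.
move=> k1 pF LF mq Lq q0.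
have mFq : measurable_fun setT (fun w => F w * q (N k w)).
  by apply: measurable_funM; [case: LF|case: Lq].
have [i2 E2] := indep_Ex (F := fun w => F w ^+ 2) (q := fun s => q s ^+ 2) k1
  (measurable_funX _ pF) (measurable_funX _ mq) LF.2 Lq.2.
split; last by rewrite -E2; apply: eq_Ex => w; rewrite exprMn.
split.
- by split => //; apply: (eq_integ _ i2) => w; rewrite exprMn.
- apply: measurable_funM; first exact: past_meas_le (leqnSn k) pF.
  by apply: past_meas_fnoise => //; rewrite k1 ltnS leqnn.
- move=> Z pZ LZ.
  have [_] := indep_Ex (F := fun w => Z w * F w) (q := q) k1
    (measurable_funM pZ pF) mq (integM LZ LF) (L2_integ Lq).
  rewrite q0 mulr0 => <-; apply: eq_Ex => w; ring.
Qed.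

Lemma mdiffD k F G : mdiff k F -> mdiff k G -> mdiff k (fun w => F w + G w).
Proof.
move=> [LF pF F0] [LG pG G0]; split; first exact: L2D.
  exact: measurable_funD.
move=> Z pZ LZ; rewrite -[RHS]addr0 -{1}(F0 Z)// -(G0 Z)// -ExD.
- by apply: eq_Ex => w; rewrite mulrDr.
- exact: integM.
- exact: integM.
Qed.

Lemma mdiffZ k c F : mdiff k F -> mdiff k (fun w => c * F w).
Proof.
move=> [LF pF F0]; split; first exact: L2Z.
  exact: measurable_funM.
move=> Z pZ LZ; rewrite -[RHS](mulr0 c) -(F0 Z)// -ExZ; last exact: integM.
by apply: eq_Ex => w; rewrite mulrCA.
Qed.

Lemma mdiff_sum_L2 (Psi : nat -> T -> R) m n :
  (forall k, (1 <= k)%N -> mdiff k (Psi k)) -> (1 <= m)%N ->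
  L2 P (fun w => \sum_(m <= k < n) Psi k w) /\
  past_meas n (fun w => \sum_(m <= k < n) Psi k w).
Proof.
move=> mP m1; split.
  apply: (@eq_L2 _ _ _ _
    (fun w => \sum_(m <= k < n | (m <= k < n)%N) Psi k w)) => [w|].
    by rewrite [RHS]big_nat.
  by apply: L2_sum => k /andP[mk _]; have [] := mP k (leq_trans m1 mk).
have -> : (fun w => \sum_(m <= k < n) Psi k w) = (fun w =>
    \sum_(m <= k < n) (if (m <= k < n)%N then Psi k w else 0)).
  by apply/funext => w; rewrite big_nat big_mkcond.
apply: measurable_sum => k.
case: (boolP (m <= k < n)%N) => // /andP[mk kn].
have [_ + _] := mP k (leq_trans m1 mk).
exact: past_meas_le.
Qed.

Lemma mdiff_sum_sqr (Psi : nat -> T -> R) m n :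
  (forall k, (1 <= k)%N -> mdiff k (Psi k)) -> (1 <= m <= n)%N ->
  Ex P (fun w => (\sum_(m <= k < n) Psi k w) ^+ 2) =
  \sum_(m <= k < n) Ex P (fun w => Psi k w ^+ 2).
Proof.
move=> mP /andP[m1]; elim: n => [|n IH]; first by rewrite leqn0 => /eqP m0; rewrite m0 in m1.
rewrite leq_eqVlt => /predU1P[<-|].
  rewrite big_geq// -[RHS](Ex_cst P 0); apply: eq_Ex => w.
  by rewrite big_geq// expr0n.
rewrite ltnS => mn; rewrite big_nat_recr//= -IH//.
have [LS pS] := mdiff_sum_L2 n mP m1.
have [Ln pn n0] := mP n (leq_trans m1 mn).
have := n0 _ pS LS => c0.
transitivity (Ex P (fun w => ((\sum_(m <= k < n) Psi k w) ^+ 2 +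
    2 * ((\sum_(m <= k < n) Psi k w) * Psi n w)) + Psi n w ^+ 2)).
  by apply: eq_Ex => w; rewrite big_nat_recr//=; ring.
have iM := integM LS Ln.
rewrite ExD ?ExD ?ExZ ?c0 ?mulr0 ?addr0//.
- exact: LS.2.
- exact: integZ.
- by apply: integD; [exact: LS.2|exact: integZ].
- exact: Ln.2.
Qed.

(** Orthogonality bounds the variance of the sum over generation n by [B * 2^n], so the squared
    average has expectation at most [B * 2^-n]. This is summable, and no finer martingale
    convergence is required. *)
Lemma mdiff_lln (Psi : nat -> T -> R) (B : R) :
  (forall k, (1 <= k)%N -> mdiff k (Psi k)) ->
  (forall k, (1 <= k)%N -> Ex P (fun w => Psi k w ^+ 2) <= B) ->
  {ae P, forall w,
    (\sum_(k <- GG n) Psi k w) / 2 ^+ n @[n --> \oo] --> 0}.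
Proof.
move=> mP PB.
pose F n w := ((\sum_(k <- GG n) Psi k w) / 2 ^+ n) ^+ 2.
have LF n : L2 P (fun w => \sum_(k <- GG n) Psi k w).
  by have [] := mdiff_sum_L2 (2 ^ n.+1) mP (m := 2 ^ n) _; rewrite ?expn_gt0.
have LF' n : L2 P (fun w => (\sum_(k <- GG n) Psi k w) / 2 ^+ n).
  by apply: (eq_L2 _ (L2Z (2 ^+ n)^-1 (LF n))) => w; rewrite mulrC.
have := @ae_bounded_geometric _ _ _ P F B 2^-1.
have -> : 0 <= (2^-1 : R) < 1 by lra.
move=> /(_ erefl).
have mF n : measurable_fun setT (F n) by apply: measurable_funX; case: (LF' n).
have F0 n w : 0 <= F n w by exact: sqr_ge0.
have iF n : integ P (F n) by case: (LF' n).
have EF n : Ex P (F n) <= B * 2^-1 ^+ n.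
  have -> : F n = (fun w => (4 ^+ n)^-1 * (\sum_(k <- GG n) Psi k w) ^+ 2).
    apply/funext => w; rewrite /F exprMn exprVn -exprM mulnC exprM mulrC.
    by rewrite (_ : 2 ^+ 2 = 4)//; ring.
  rewrite ExZ; last by case: (LF n).
  rewrite mdiff_sum_sqr//; last by rewrite expn_gt0 leq_exp2l/=.
  rewrite ler_pdivrMl ?exprn_gt0//.
  rewrite mulrCA -exprMn (_ : 4 * 2^-1 = 2 :> R); last by field.
  rewrite -natrX -[X in X%:R](_ : (2 ^ n.+1 - 2 ^ n)%N = _); last first.
    by rewrite expnS mul2n -addnn addnK.
  rewrite mulr_natr -sumr_const_nat; apply: ler_sum_nat => k /andP[nk _].
  by apply: PB; apply: leq_trans nk; rewrite expn_gt0.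
move=> /(_ mF F0 iF EF); apply: filterS => w [M FM].
apply: cvg_sqr0; apply: (@bounded_series_cvg0 _ _ M) => // n.
exact: F0.
Qed.

End filtration.

(** * Autoregression along the tree *)

Lemma half_ind (Q : nat -> Prop) : Q 1%N ->
  (forall k, (1 < k)%N -> Q k./2 -> Q k) -> forall k, (1 <= k)%N -> Q k.
Proof.
move=> Q1 Qh k; elim/ltn_ind: k => k IH k1.
case: (leqP k 1) => [k1'|k1']; first by rewrite (_ : k = 1%N)//; lia.
by apply: Qh => //; apply: IH; lia.
Qed.

Lemma trunc_log_GG n k : k \in GG n -> trunc_log 2 k = n.
Proof. by rewrite mem_index_iota => h; apply: trunc_log_eq. Qed.

Lemma mem_GG_trunc_log k : (1 <= k)%N -> k \in GG (trunc_log 2 k).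
Proof. by move=> k1; rewrite mem_index_iota; exact: trunc_log_bounds. Qed.

Lemma trunc_log_half k : (1 < k)%N -> trunc_log 2 k = (trunc_log 2 k./2).+1.
Proof.
move=> k1; apply: trunc_log_eq => //.
have h0 : (0 < k./2)%N by lia.
have /andP[h1 h2] := trunc_log_bounds (ltnSn 1) h0.
by rewrite expnS in h2; rewrite !expnS; lia.
Qed.

Section tree_recursion.
Context {R : realType}.
Implicit Types (co er : nat -> R) (x : R).

(* The argument [n] is fuel: any [n >= k] gives the value at node [k]. *)
Fixpoint ar_fuel (n : nat) co er x (k : nat) : R :=
  if n is n'.+1 then
    if (k <= 1)%N then x else co k * ar_fuel n' co er x k./2 + er k
  else x.

Definition ar co er x (k : nat) : R := ar_fuel k co er x k.

Lemma ar1 co er x : ar co er x 1 = x. Proof. by []. Qed.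

Lemma arS co er x k : (1 < k)%N ->
  ar co er x k = co k * ar co er x k./2 + er k.
Proof.
have fuel n m l : (l <= n)%N -> (l <= m)%N ->
    ar_fuel n co er x l = ar_fuel m co er x l.
  elim: n m l => [|n IH] [|m] l //=.
  - by move=> l0 _; rewrite (leq_trans l0).
  - by move=> _ l0; rewrite (leq_trans l0).
  - move=> ln lm; case: ifPn => // l1; congr (_ * _ + _); apply: IH; lia.
case: k => // k k1; rewrite /ar /= ifN -?ltnNge//; congr (_ * _ + _).
by apply: fuel => //; lia.
Qed.

Lemma ar_affine co er x k : (1 <= k)%N ->
  ar co er x k = ar co er 0 k + x * ar co (fun=> 0) 1 k.
Proof.
move=> k1; elim/half_ind: k / k1 => [|k k1 IH]; first by rewrite !ar1; ring.
by rewrite !(arS _ _ _ k1) IH; ring.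
Qed.

End tree_recursion.

(** A noise block is ((a_k, b_k), (eps_2k, eps_(2k+1))), shared by the two children of k. The parity
    of the child selects the coefficient and the innovation it receives: [false] for the even child,
    [true] for the odd one. *)
Definition csel {R : realType} (odd_child : bool) (s : (R * R) * (R * R)) : R :=
  if odd_child then s.1.2 else s.1.1.

Definition esel {R : realType} (odd_child : bool) (s : (R * R) * (R * R)) : R :=
  if odd_child then s.2.2 else s.2.1.

Lemma measurable_csel (R : realType) b : measurable_fun setT (@csel R b).
Proof. by case: b; rewrite /csel; do ?apply: measurableT_comp. Qed.

Lemma measurable_esel (R : realType) b : measurable_fun setT (@esel R b).
Proof. by case: b; rewrite /esel; do ?apply: measurableT_comp. Qed.

Section process.
Context {disp} {T : measurableType disp} {R : realType} (P : probability T R).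
Variable N : nat -> T -> ((R * R) * (R * R))%type.
Definition coef (w : T) (k : nat) : R := csel (odd k) (N k./2 w).
Definition innov (w : T) (k : nat) : R := esel (odd k) (N k./2 w).
Definition Y0 (k : nat) (w : T) : R := ar (coef w) (innov w) 0 k.
Definition Apath (k : nat) (w : T) : R := ar (coef w) (fun=> 0) 1 k.

Lemma past_meas_Apath k : (1 <= k)%N -> past_meas N k (Apath k).
Proof.
move: k; apply: half_ind => [|k k1 IH]; first exact: measurable_cst.
have -> : Apath k = (fun w => coef w k * Apath k./2 w).
  by apply/funext => w; rewrite /Apath arS// addr0.
have h2 : (1 <= k./2 < k)%N by lia.
apply: measurable_funM; last by apply: past_meas_le IH; lia.
by apply: past_meas_fnoise => //; exact: measurable_csel.
Qed.

Lemma past_meas_Y0 k : (1 <= k)%N -> past_meas N k (Y0 k).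
Proof.
move: k; apply: half_ind => [|k k1 IH]; first exact: measurable_cst.
have -> : Y0 k = (fun w => coef w k * Y0 k./2 w + innov w k).
  by apply/funext => w; rewrite /Y0 arS.
have h2 : (1 <= k./2 < k)%N by lia.
apply: measurable_funD; last first.
  by apply: past_meas_fnoise => //; exact: measurable_esel.
apply: measurable_funM; last by apply: past_meas_le IH; lia.
by apply: past_meas_fnoise => //; exact: measurable_csel.
Qed.

Hypothesis mN : forall k, measurable_fun setT (N k).
Hypothesis indN : noise_indep P N.
Variables rho ce : R.
Hypothesis rho1 : 0 <= rho < 1.
Hypothesis L2c : forall b k, (1 <= k)%N -> L2 P (fun w => csel b (N k w)).
Hypothesis L2e : forall b k, (1 <= k)%N -> L2 P (fun w => esel b (N k w)).
Hypothesis Ec : forall b k, (1 <= k)%N ->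
  Ex P (fun w => csel b (N k w) ^+ 2) <= rho.
Hypothesis Eabsc : forall b k, (1 <= k)%N ->
  Ex P (fun w => `|csel b (N k w)|) <= rho.
Hypothesis Ee : forall b k, (1 <= k)%N ->
  Ex P (fun w => esel b (N k w) ^+ 2) <= ce.

(** Along a path the factors are independent, one per generation, so moments multiply. The first
    absolute moment will control [remainder]; the second moment, in [Apath_sqr], controls increments
    in the initial state. *)
Lemma Apath_abs k : (1 <= k)%N -> integ P (Apath k) /\
  Ex P (fun w => `|Apath k w|) <= rho ^+ trunc_log 2 k.
Proof.
move: k; apply: half_ind => [|k k1 [iA EA]].
  split; first exact: integ_cst.
  rewrite trunc_log1 expr0 -[leRHS](Ex_cst P 1).
  by rewrite le_eqVlt; apply/orP; left; apply/eqP/eq_Ex => w; exact: normr1.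
have h1 : (1 <= k./2)%N by lia.
have AE w : Apath k w = Apath k./2 w * csel (odd k) (N k./2 w).
  by rewrite /Apath arS// addr0 mulrC.
have [] := indep_Ex mN indN h1 (past_meas_Apath h1) (measurable_csel (odd k))
  iA (L2_integ (L2c _ h1)).
move=> i _; split; first by apply: (eq_integ _ i) => w; rewrite AE.
have pA : past_meas N k./2 (fun w => `|Apath k./2 w|).
  by apply: measurableT_comp => //; exact: past_meas_Apath.
have mc : measurable_fun setT (fun s => `|@csel R (odd k) s|).
  by apply: measurableT_comp => //; exact: measurable_csel.
have [_] := indep_Ex mN indN h1 (F := fun w => `|Apath k./2 w|)
  (q := fun s => `|csel (odd k) s|)
  pA mc
  (integ_norm iA) (integ_norm (L2_integ (L2c _ h1))).
have -> : (fun w => `|Apath k./2 w| * `|csel (odd k) (N k./2 w)|) =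
  (fun w => `|Apath k w|) by apply/funext => w; rewrite AE normrM.
move=> ->; rewrite trunc_log_half// exprSr.
by apply: ler_pM => //; [exact: Ex_ge0|exact: Ex_ge0|exact: Eabsc].
Qed.

Lemma Apath_sqr k : (1 <= k)%N -> L2 P (Apath k) /\
  Ex P (fun w => Apath k w ^+ 2) <= rho ^+ trunc_log 2 k.
Proof.
move: k; apply: half_ind => [|k k1 [LA EA]].
  split; first exact: L2_cst.
  rewrite trunc_log1 expr0 -[leRHS](Ex_cst P 1).
  by rewrite le_eqVlt; apply/orP; left; apply/eqP/eq_Ex => w; exact: expr1n.
have h1 : (1 <= k./2)%N by lia.
have AE w : Apath k w = Apath k./2 w * csel (odd k) (N k./2 w).
  by rewrite /Apath arS// addr0 mulrC.
have [i E] := indep_Ex mN indN h1 (F := fun w => Apath k./2 w ^+ 2)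
  (q := fun s => csel (odd k) s ^+ 2)
  (measurable_funX _ (past_meas_Apath h1))
  (measurable_funX _ (measurable_csel (odd k)))
  LA.2 (L2c _ h1).2.
have A2 : (fun w => Apath k./2 w ^+ 2 * csel (odd k) (N k./2 w) ^+ 2) =
  (fun w => Apath k w ^+ 2) by apply/funext => w; rewrite AE exprMn.
rewrite A2 in i E; split.
  split => //; by apply: (past_meas_meas mN); apply: past_meas_Apath; exact: ltnW.
rewrite E trunc_log_half// exprSr.
by apply: ler_pM; rewrite ?EA ?EY ?Ec//; apply: Ex_ge0 => w; exact: sqr_ge0.
Qed.

Lemma Y0_sqr_bounded : exists B : R, forall k, (1 <= k)%N ->
  L2 P (Y0 k) /\ Ex P (fun w => Y0 k w ^+ 2) <= B.
Proof.
have /andP[r0 r1] := rho1.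
have ce0 : 0 <= ce.
  by apply: le_trans (Ee false (leqnn 1)); apply: Ex_ge0 => w; exact: sqr_ge0.
(* Young's inequality gives E Y_k^2 <= (1 + t) rho E Y_(k/2)^2 + (1 + t^-1) ce, without any
   information on the cross term. Here [t] satisfies (1 + t) rho + t <= 1, and [B] makes the last
   term equal to [B * t], so that the bound [B] reproduces itself. *)
pose t := (1 - rho) / 2; pose B := (1 + t^-1) * ce / t.
have t0 : 0 < t by rewrite /t; lra.
have ti0 : 0 <= t^-1 by rewrite invr_ge0 ltW.
have B0 : 0 <= B by rewrite /B; apply: divr_ge0; [apply: mulr_ge0 => //; lra|exact: ltW].
exists B; apply: half_ind => [|k k1 [LY EY]].
  split; first exact: L2_cst.
  apply: le_trans B0; rewrite -[leRHS](Ex_cst P 0).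
  by rewrite le_eqVlt; apply/orP; left; apply/eqP/eq_Ex => w; rewrite expr0n.
have h1 : (1 <= k./2)%N by lia.
have YE w : Y0 k w = Y0 k./2 w * csel (odd k) (N k./2 w) + innov w k.
  by rewrite /Y0 arS// mulrC.
have [i E] := indep_Ex mN indN h1 (F := fun w => Y0 k./2 w ^+ 2)
  (q := fun s => csel (odd k) s ^+ 2)
  (measurable_funX _ (past_meas_Y0 h1))
  (measurable_funX _ (measurable_csel (odd k)))
  LY.2 (L2c _ h1).2.
have mYk : measurable_fun setT (Y0 k).
  by apply: (past_meas_meas mN); apply: past_meas_Y0; exact: ltnW.
pose G w := (1 + t) * (Y0 k./2 w ^+ 2 * csel (odd k) (N k./2 w) ^+ 2) +
    (1 + t^-1) * (esel (odd k) (N k./2 w) ^+ 2).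
have YG w : Y0 k w ^+ 2 <= G w.
  rewrite YE /G /innov; set u := Y0 _ _ * _; set v := esel _ _.
  rewrite -exprMn -/u -subr_ge0.
  have -> : (1 + t) * u ^+ 2 + (1 + t^-1) * v ^+ 2 - (u + v) ^+ 2 =
    t * (u - t^-1 * v) ^+ 2 by field; rewrite gt_eqF.
  by rewrite mulr_ge0 ?sqr_ge0// ltW.
have ie := (L2e (odd k) h1).2.
have iG : integ P G by apply: integD; exact: integZ.
have iY : integ P (fun w => Y0 k w ^+ 2).
  apply: (le_integ _ _ iG); first exact: measurable_funX.
  by move=> w; rewrite ger0_norm ?sqr_ge0.
split; first by split.
apply: le_trans (le_Ex iY iG YG) _.
rewrite ExD ?ExZ//; [|exact: integZ|exact: integZ].
rewrite E; set EYY := Ex P _ in EY *; set Ecc := Ex P (fun w => csel _ _ ^+ 2).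
have h2 : EYY * Ecc <= B * rho.
  by apply: ler_pM; rewrite ?EA ?EY ?Ec//; apply: Ex_ge0 => w; exact: sqr_ge0.
have h3 := Ee (odd k) h1.
have Bt : (1 + t^-1) * ce = B * t by rewrite /B mulfVK// gt_eqF.
apply: (@le_trans _ _ ((1 + t) * (B * rho) + (1 + t^-1) * ce)).
  by apply: lerD; apply: ler_wpM2l => //; lra.
rewrite Bt -subr_ge0.
have -> : B - ((1 + t) * (B * rho) + B * t) = B * t * (1 - rho).
  by rewrite /t; field.
by apply: mulr_ge0; [apply: mulr_ge0 => //; exact: ltW|lra].
Qed.

End process.

(** * Weighted sums of the noise *)

Section bounded_lipschitz.
Context {R : realType}.
Implicit Types f g : R -> R.

(** Boundedness gives the second moments of the martingale differences, the Lipschitz property the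
    comparison of two initial states. A single constant serves both purposes, which keeps closure
    under products and sums short. *)
Definition BL f (c : R) : Prop :=
  (forall x, `|f x| <= c) /\ (forall x y, `|f x - f y| <= c * `|x - y|).

Lemma BL_ge0 f c : BL f c -> 0 <= c.
Proof. by move=> [/(_ 0) fc _]; exact: le_trans fc. Qed.

Lemma BL_continuous f c : BL f c -> continuous f.
Proof.
move=> bf x; have c0 := BL_ge0 bf; have [_ lf] := bf.
apply/cvgrPdist_lt => e e0; near=> y.
apply: le_lt_trans (lf x y) _.
apply: (@le_lt_trans _ _ ((c + 1) * `|x - y|)).
  by rewrite ler_wpM2r// lerDl.
rewrite mulrC -ltr_pdivlMr; last by lra.
near: y; apply: cvgr_dist_lt => //; first by apply: divr_gt0 => //; lra.
Unshelve. all: by end_near. Qed.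

Lemma BL_measurable f c : BL f c -> measurable_fun setT f.
Proof. by move=> bf; apply: continuous_measurable_fun; exact: BL_continuous bf. Qed.

Lemma BLM f g c c' : BL f c -> BL g c' -> BL (fun x => f x * g x) (2 * (c * c') + c * c').
Proof.
move=> bf bg; have c0 := BL_ge0 bf; have c0' := BL_ge0 bg.
have [fc lf] := bf; have [gc lg] := bg; have cc := mulr_ge0 c0 c0'.
split=> [x|x y].
  rewrite normrM (@le_trans _ _ (c * c'))//; last by lra.
  exact: ler_pM.
rewrite (_ : _ - _ = (f x - f y) * g x + f y * (g x - g y)); last by ring.
apply: le_trans (ler_normD _ _) _; rewrite !normrM.
apply: (@le_trans _ _ (c * `|x - y| * c' + c * (c' * `|x - y|))).
  by apply: lerD; apply: ler_pM.
have := mulr_ge0 cc (normr_ge0 (x - y)); nra.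
Qed.

Lemma BLD f g c c' : BL f c -> BL g c' -> BL (fun x => f x + g x) (c + c').
Proof.
move=> [fc lf] [gc lg]; split=> [x|x y].
  by rewrite (le_trans (ler_normD _ _))// lerD.
rewrite (_ : _ - _ = (f x - f y) + (g x - g y)); last by ring.
by rewrite (le_trans (ler_normD _ _))// mulrDl lerD.
Qed.

End bounded_lipschitz.

Section tree_sums.
Context {R : realType}.

Lemma sum_generations (F : nat -> R) n :
  \sum_(1 <= k < 2 ^ n) F k = \sum_(j < n) \sum_(k <- GG j) F k.
Proof.
elim: n => [|n IH]; first by rewrite big_geq// big_ord0.
rewrite big_ord_recr/= -IH -big_cat_nat//= ?expn_gt0//.
by rewrite leq_exp2l.
Qed.

Lemma sum_TT (F : nat -> R) n :
  \sum_(k <- TT n) F k = \sum_(j < n.+1) \sum_(k <- GG j) F k.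
Proof. exact: sum_generations. Qed.

Lemma sumr_GG_const (c : R) n : \sum_(k <- GG n) c = c * 2 ^+ n.
Proof.
rewrite /GG sumr_const_nat expnS mul2n -addnn addnK.
by rewrite -[LHS]mulr_natr natrX.
Qed.

Lemma ler_sum_GG (F G : nat -> R) n : (forall k, (1 <= k)%N -> k \in GG n ->
  F k <= G k) -> \sum_(k <- GG n) F k <= \sum_(k <- GG n) G k.
Proof.
move=> FG; rewrite big_seq [leRHS]big_seq; apply: ler_sum => k kn.
apply: FG => //; move: kn; rewrite mem_index_iota => /andP[+ _].
by apply: leq_trans; rewrite expn_gt0.
Qed.

Lemma sum_square_telescope (v : nat -> R) a m : (a <= m)%N ->
  \sum_(a <= k < m) (2 * (\sum_(a <= i < k) v i) * v k + v k ^+ 2) =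
  (\sum_(a <= k < m) v k) ^+ 2.
Proof.
elim: m => [|m IH]; first by rewrite leqn0 => /eqP ->; rewrite !big_geq// expr0n.
rewrite leq_eqVlt => /predU1P[<-|]; first by rewrite !big_geq// expr0n.
rewrite ltnS => am; rewrite !big_nat_recr//= IH//; ring.
Qed.

Lemma sqr_sum_le (v : nat -> R) n :
  (\sum_(i < n) v i) ^+ 2 <= n%:R * \sum_(i < n) v i ^+ 2.
Proof.
elim: n => [|n IH]; first by rewrite !big_ord0 expr0n mul0r.
rewrite !big_ord_recr/=.
set S := \sum_(i < n) v i in IH *; set Q := \sum_(i < n) v i ^+ 2 in IH *.
have Q0 : 0 <= Q by apply: sumr_ge0 => i _; exact: sqr_ge0.
have n0 : (0 : R) <= n%:R by [].
have nv0 : 0 <= n%:R * v n ^+ 2 by rewrite mulr_ge0 ?sqr_ge0.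
suff : 2 * (S * v n) <= Q + n%:R * v n ^+ 2.
  by rewrite -natr1; nra.
apply: le_trans (ler_norm _) _.
rewrite -ler_sqr ?nnegrE ?addr_ge0//.
rewrite -normrX ger0_norm ?sqr_ge0//.
apply: (@le_trans _ _ (4 * (Q * (n%:R * v n ^+ 2)))); last first.
  by have := sqr_ge0 (Q - n%:R * v n ^+ 2); nra.
rewrite !exprMn -natrX ler_wpM2l// mulrA.
by rewrite [Q * _]mulrC ler_wpM2r ?sqr_ge0.
Qed.

End tree_sums.

(** * Squares of weighted noise sums, summed over generations *)

Section weighted_noise.
Context {disp} {T : measurableType disp} {R : realType} (P : probability T R).
Variable N : nat -> T -> ((R * R) * (R * R))%type.
Hypothesis mN : forall k, measurable_fun setT (N k).
Hypothesis indN : noise_indep P N.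
Variable q : ((R * R) * (R * R))%type -> R.
Hypothesis mq : measurable_fun setT q.
Variables s2 m4 : R.
Hypothesis Lq : forall k, (1 <= k)%N -> L2 P (fun w => q (N k w)).
Hypothesis q0 : forall k, (1 <= k)%N -> Ex P (fun w => q (N k w)) = 0.
Hypothesis Eq2 : forall k, (1 <= k)%N -> Ex P (fun w => q (N k w) ^+ 2) = s2.
Hypothesis Lq2 : forall k, (1 <= k)%N -> L2 P (fun w => q (N k w) ^+ 2).
Hypothesis Eq4 : forall k, (1 <= k)%N ->
  Ex P (fun w => (q (N k w) ^+ 2 - s2) ^+ 2) <= m4.
Variables (g : nat -> T -> R) (c : R).
Hypothesis pg : forall k, (1 <= k)%N -> past_meas N k (g k).
Hypothesis gc : forall k w, (1 <= k)%N -> `|g k w| <= c.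

Let c0 : 0 <= c.
Proof.
have [w _] := ae_event (P := P) (A := setT) (aeW _ (fun=> I)).
exact: le_trans (gc w (leqnn 1)).
Qed.

Let s20 : 0 <= s2.
Proof. by rewrite -(Eq2 (leqnn 1)); apply: Ex_ge0 => w; exact: sqr_ge0. Qed.

Let m40 : 0 <= m4.
Proof. by apply: le_trans (Eq4 (leqnn 1)); apply: Ex_ge0 => w; exact: sqr_ge0. Qed.

Let Lg k : (1 <= k)%N -> L2 P (g k).
Proof.
move=> k1; apply: (@L2_bounded _ _ _ _ _ c); last by move=> w; exact: gc.
exact: (past_meas_meas mN (pg k1)).
Qed.

Let v k w := g k w * q (N k w).
Let S k w := \sum_(2 ^ trunc_log 2 k <= i < k) v i w.
Let z k : R := (2 ^+ trunc_log 2 k)^-1.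
(* With [v k] the weighted noise and [S k] its partial sum inside the generation,
   the sum of [delta] over G_j is (U_j^2 - E[U_j^2 | past]) / 2^j. *)
Let delta k w := z k * (2 * (S k w * g k w) * q (N k w)) +
  z k * (g k w ^+ 2 * (q (N k w) ^+ 2 - s2)).

Let z0 k : 0 <= z k. Proof. by rewrite invr_ge0 exprn_ge0. Qed.

Let mdv k : (1 <= k)%N -> mdiff P N k (v k).
Proof. by move=> k1; have [] := mdiffM mN indN k1 (pg k1) (Lg k1) mq (Lq k1) (q0 k1). Qed.

Let Ev k : (1 <= k)%N -> Ex P (fun w => v k w ^+ 2) <= c ^+ 2 * s2.
Proof.
move=> k1; have [_ ->] := mdiffM mN indN k1 (pg k1) (Lg k1) mq (Lq k1) (q0 k1).
rewrite Eq2// ler_wpM2r// -(Ex_cst P (c ^+ 2)); apply: le_Ex => [||w].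
- exact: (Lg k1).2.
- exact: integ_cst.
- by rewrite -real_normK ?num_real// lerXn2r ?nnegrE// gc.
Qed.

Let S_prop k : (1 <= k)%N -> [/\ past_meas N k (S k), L2 P (S k)
  & Ex P (fun w => S k w ^+ 2) <= 2 ^+ trunc_log 2 k * (c ^+ 2 * s2)].
Proof.
move=> k1; have h0 : (1 <= 2 ^ trunc_log 2 k)%N by rewrite expn_gt0.
have /andP[h1 h2] := trunc_log_bounds (ltnSn 1) k1.
have [LS pS] := mdiff_sum_L2 k mdv h0.
split => //; rewrite (mdiff_sum_sqr mdv); last by rewrite h0.
apply: (@le_trans _ _ (\sum_(2 ^ trunc_log 2 k <= i < k) c ^+ 2 * s2)).
  by apply: ler_sum_nat => i /andP[i1 _]; apply: Ev; exact: leq_trans i1.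
rewrite sumr_const_nat -[leLHS]mulr_natl ler_wpM2r ?mulr_ge0 ?sqr_ge0//.
by rewrite -natrX ler_nat; rewrite expnS in h2; lia.
Qed.

(** The 2 outside comes from (A + B)^2 <= 2 (A^2 + B^2) for the two terms of [delta]. In the first
    one E [S k]^2 is at most 2^l c^2 s2 in generation l, and this 2^l cancels one of the two factors
    [z k]; the other factor remains in the bound [C * z k]. *)
Let C := 2 * (4 * (c ^+ 2 * (c ^+ 2 * s2)) * s2 + c ^+ 4 * m4).

Let delta_prop k : (1 <= k)%N -> mdiff P N k (delta k) /\
  Ex P (fun w => delta k w ^+ 2) <= C * z k.
Proof.
move=> k1; have [pS LS ES] := S_prop k1.
have pSg : past_meas N k (fun w => 2 * (S k w * g k w)).
  by apply: measurable_funM => //; apply: measurable_funM => //; exact: pg.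
have Sgc w : `|2 * (S k w * g k w)| <= `|2 * c * S k w|.
  rewrite !normrM (ger0_norm c0) -mulrA ler_wpM2l// mulrC ler_wpM2r//.
  exact: gc.
have LSg : L2 P (fun w => 2 * (S k w * g k w)).
  apply: le_L2 Sgc (L2Z _ LS); exact: (past_meas_meas mN pSg).
have [m1 E1] := mdiffM mN indN k1 pSg LSg mq (Lq k1) (q0 k1).
have pg2 : past_meas N k (fun w => g k w ^+ 2) by apply: measurable_funX; exact: pg.
have gc2 w : `|g k w ^+ 2| <= c ^+ 2.
  by rewrite normrX lerXn2r ?nnegrE// gc.
have Lg2 : L2 P (fun w => g k w ^+ 2).
  by apply: L2_bounded gc2; exact: (past_meas_meas mN pg2).
have LV : L2 P (fun w => q (N k w) ^+ 2 - s2).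
  by apply: L2B; [exact: Lq2|exact: L2_cst].
have V0 : Ex P (fun w => q (N k w) ^+ 2 - s2) = 0.
  by rewrite ExB ?Ex_cst ?Eq2 ?subrr//; [exact: (Lq k1).2|exact: integ_cst].
have [m2 E2] := mdiffM (q := fun s => q s ^+ 2 - s2) mN indN k1 pg2 Lg2
  (measurable_funB (measurable_funX _ mq) (measurable_cst s2)) LV V0.
have m12 := mdiffD (mdiffZ (z k) m1) (mdiffZ (z k) m2).
split => //.
pose D w := 2 * z k ^+ 2 * ((2 * (S k w * g k w) * q (N k w)) ^+ 2 +
  (g k w ^+ 2 * (q (N k w) ^+ 2 - s2)) ^+ 2).
have [[_ i1] _ _] := m1; have [[_ i2] _ _] := m2.
have iD : integ P D by apply: integZ; exact: integD.
apply: (@le_trans _ _ (Ex P D)).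
  apply: le_Ex => // [|w]; first by case: m12 => -[].
  rewrite /delta /D; set A := _ * q _; set B := _ ^+ 2 * (_ - _).
  by have := sqr_ge0 (z k * A - z k * B); nra.
rewrite ExZ; last exact: integD.
rewrite ExD// E1 E2 Eq2//.
have e1 : Ex P (fun w => (2 * (S k w * g k w)) ^+ 2) <= 4 * (c ^+ 2 * (2 ^+ trunc_log 2 k * (c ^+ 2 * s2))).
  apply: (@le_trans _ _ (Ex P (fun w => (4 * c ^+ 2) * S k w ^+ 2))).
    apply: le_Ex => [||w]; [exact: LSg.2|exact: integZ LS.2|].
    have := Sgc w; rewrite -ler_sqr ?nnegrE// !real_normK ?num_real// => h.
    apply: le_trans h _; rewrite !exprMn -natrX; exact: lexx.
  rewrite ExZ; last exact: LS.2.
  by rewrite -mulrA ler_wpM2l// ler_wpM2l ?sqr_ge0.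
have e2 : Ex P (fun w => (g k w ^+ 2) ^+ 2) <= c ^+ 4.
  rewrite -(Ex_cst P (c ^+ 4)); apply: le_Ex => [||w].
  - exact: Lg2.2.
  - exact: integ_cst.
  - rewrite -real_normK ?num_real// (_ : c ^+ 4 = (c ^+ 2) ^+ 2); last by ring.
    by rewrite lerXn2r ?nnegrE ?sqr_ge0.
have e3 := Eq4 k1.
set z1 := 2 ^+ trunc_log 2 k in e1 *.
have z1p : 1 <= z1 by apply: exprn_ege1; lra.
have zE : z k = z1^-1 by [].
have zz : z k * z1 = 1 by rewrite zE mulVf// gt_eqF// (lt_le_trans _ z1p).
have zk1 : z k <= 1 by rewrite zE invf_le1// (lt_le_trans _ z1p).
set E4 := Ex P _ in e1 *; set E5 := Ex P _ in e2 *; set E6 := Ex P _ in e3 *.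
apply: (@le_trans _ _ (2 * z k ^+ 2 * (4 * (c ^+ 2 * (z1 * (c ^+ 2 * s2))) * s2 + c ^+ 4 * m4))).
  apply: ler_wpM2l; first by rewrite mulr_ge0 ?sqr_ge0.
  apply: lerD; first exact: ler_wpM2r.
  by apply: ler_pM => //; apply: Ex_ge0 => w; exact: sqr_ge0.
have -> : 2 * z k ^+ 2 * (4 * (c ^+ 2 * (z1 * (c ^+ 2 * s2))) * s2 + c ^+ 4 * m4) =
  2 * z k * ((z k * z1) * (4 * (c ^+ 2 * (c ^+ 2 * s2)) * s2) + z k * (c ^+ 4 * m4)) by ring.
rewrite zz mul1r /C mulrAC ler_wpM2r// ler_wpM2l// lerD2l.
have c40 : 0 <= c ^+ 4 * m4 by rewrite mulr_ge0// exprn_ge0.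
by rewrite -[leRHS]mul1r ler_wpM2r.
Qed.

Let U j w := \sum_(k <- GG j) v k w.

Let delta_sum j w : \sum_(k <- GG j) delta k w =
  U j w ^+ 2 / 2 ^+ j - s2 * ((\sum_(k <- GG j) g k w ^+ 2) / 2 ^+ j).
Proof.
have GGle : (2 ^ j <= 2 ^ j.+1)%N by rewrite leq_exp2l.
rewrite /U /GG -(sum_square_telescope (v^~ w) GGle) !mulr_suml mulr_sumr -sumrB.
rewrite big_seq [RHS]big_seq; apply: eq_bigr => k kj.
rewrite /delta /S /z (trunc_log_GG kj) /v; ring.
Qed.

Let Z n w := \sum_(1 <= k < 2 ^ n) delta k w.

Let Z_sqr n : L2 P (Z n) /\ Ex P (fun w => Z n w ^+ 2) <= C * n%:R.
Proof.
have md k (k1 : (1 <= k)%N) := (delta_prop k1).1.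
have [LZ _] := mdiff_sum_L2 (2 ^ n) md (leqnn 1).
split => //; rewrite (mdiff_sum_sqr md) ?expn_gt0// sum_generations.
apply: (@le_trans _ _ (\sum_(j < n) C)).
  apply: ler_sum => j _.
  apply: (@le_trans _ _ (\sum_(k <- GG j) C / 2 ^+ j)).
    apply: ler_sum_GG => k k1 kj; apply: le_trans (delta_prop k1).2 _.
    by rewrite /z (trunc_log_GG kj).
  by rewrite sumr_GG_const mulfVK// expf_neq0.
by rewrite sumr_const cardT size_enum_ord -[leLHS]mulr_natr.
Qed.

(** The partial sums of [delta] form a martingale with E [Z n]^2 <= C n. Dividing by n^2 would leave
    C / n, which is not summable, so [Z] is sampled at 2^m generations only; since the sum of
    squares [W] is nondecreasing, the dyadic times control all others. The difference between [W]
    and [Z] is compensated by at most [s2 * c ^+ 2] per generation. *)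
Lemma weighted_noise_squares : {ae P, forall w, exists M, forall n,
  \sum_(j < n) (\sum_(k <- GG j) g k w * q (N k w)) ^+ 2 / 2 ^+ j
    <= M * n.+1%:R}.
Proof.
pose F m w := (2 ^+ m)^-1 ^+ 2 * Z (2 ^ m) w ^+ 2.
have iF m : integ P (F m) by apply: integZ; exact: (Z_sqr _).1.2.
have mF m : measurable_fun setT (F m) by exact: integ_meas (iF m).
have F0 m w : 0 <= F m w by rewrite mulr_ge0 ?sqr_ge0.
have EF m : Ex P (F m) <= C * 2^-1 ^+ m.
  rewrite ExZ; last exact: (Z_sqr _).1.2.
  apply: (@le_trans _ _ ((2 ^+ m)^-1 ^+ 2 * (C * (2 ^ m)%:R))).
    by rewrite ler_wpM2l ?sqr_ge0//; exact: (Z_sqr _).2.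
  rewrite natrX [in leRHS]exprVn; set t := 2 ^+ m.
  have t0 : t != 0 by rewrite expf_neq0.
  by rewrite [leLHS](_ : _ = C * t^-1)//; field.
have := @ae_bounded_geometric _ _ _ P F C 2^-1.
have -> : 0 <= (2^-1 : R) < 1 by lra.
move=> /(_ erefl mF F0 iF EF); apply: filterS => w [M FM].
have M0 : 0 <= M by have := FM 0%N; rewrite big_ord0.
have ZM m : Z (2 ^ m) w <= (M + 1) * 2 ^+ m.
  have FmM : F m w <= M.
    have := FM m.+1; rewrite big_ord_recr/=; apply: le_trans.
    by rewrite lerDr; apply: sumr_ge0 => i _; exact: F0.
  apply: le_trans (ler_norm _) _.
  have t0 : 0 < 2 ^+ m :> R by rewrite exprn_gt0.
  rewrite -ler_pdivrMr// -ler_sqr ?nnegrE ?divr_ge0 ?addr_ge0 ?(ltW t0)//.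
  rewrite expr_div_n real_normK ?num_real// mulrC -exprVn.
  by apply: le_trans FmM _; nra.
pose W n := \sum_(j < n) U j w ^+ 2 / 2 ^+ j.
have WZ n : W n <= Z n w + s2 * c ^+ 2 * n%:R.
  rewrite /W /Z sum_generations -lerBlDl -sumrB.
  apply: (@le_trans _ _ (\sum_(j < n) s2 * c ^+ 2)); last first.
    by rewrite sumr_const cardT size_enum_ord -[leLHS]mulr_natr.
  apply: ler_sum => j _; rewrite delta_sum opprB addrC subrK.
  rewrite ler_wpM2l// ler_pdivrMr ?exprn_gt0// -sumr_GG_const.
  by apply: ler_sum_GG => k k1 _; rewrite -real_normK ?num_real// lerXn2r ?nnegrE// gc.
have Wmono n m : (n <= m)%N -> W n <= W m.
  move=> /subnKC <-; elim: (m - n)%N => [|k IH]; first by rewrite addn0.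
  rewrite addnS /W big_ord_recr/=; apply: le_trans IH _; rewrite lerDl.
  by rewrite divr_ge0 ?sqr_ge0// exprn_ge0.
pose M' := M + 1 + s2 * c ^+ 2.
have M'0 : 0 <= M' by rewrite /M' !addr_ge0// mulr_ge0 ?sqr_ge0.
exists (2 * M') => n.
have /andP[h1 h2] := trunc_log_bounds (ltnSn 1) (ltn0Sn n).
(* The next power of two above n + 1 is at most 2 (n + 1), whence the factor 2 in the witness. *)
apply: (le_trans (Wmono _ _ (ltnW (leq_trans (ltnSn n) (ltnW h2))))).
apply: le_trans (WZ _) _.
apply: (@le_trans _ _ (M' * (2 ^ (trunc_log 2 n.+1).+1)%:R)).
  by rewrite [leRHS]mulrDl lerD// natrX ZM.
rewrite -mulrA mulrCA ler_wpM2l// expnS natrM ler_wpM2l// ler_nat.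
exact: h1.
Qed.

End weighted_noise.

(** * Arbitrary initial states *)

Lemma eq_ler (R : numDomainType) (x y : R) : x = y -> x <= y.
Proof. by move=> ->. Qed.

Section initial_state.
Context {disp} {T : measurableType disp} {R : realType} (P : probability T R).
Variable N : nat -> T -> ((R * R) * (R * R))%type.
Hypothesis mN : forall k, measurable_fun setT (N k).
Hypothesis indN : noise_indep P N.
Variables rho : R.
Hypothesis rho1 : 0 <= rho < 1.
Hypothesis L2c : forall b k, (1 <= k)%N -> L2 P (fun w => csel b (N k w)).
Hypothesis Ec : forall b k, (1 <= k)%N ->
  Ex P (fun w => csel b (N k w) ^+ 2) <= rho.
Hypothesis Eabsc : forall b k, (1 <= k)%N ->
  Ex P (fun w => `|csel b (N k w)|) <= rho.
Variable q : ((R * R) * (R * R))%type -> R.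
Hypothesis mq : measurable_fun setT q.
Variable s2 : R.
Hypothesis Lq : forall k, (1 <= k)%N -> L2 P (fun w => q (N k w)).
Hypothesis q0 : forall k, (1 <= k)%N -> Ex P (fun w => q (N k w)) = 0.
Hypothesis Eq2 : forall k, (1 <= k)%N -> Ex P (fun w => q (N k w) ^+ 2) = s2.

Let s20 : 0 <= s2.
Proof. by rewrite -(Eq2 (leqnn 1)); apply: Ex_ge0 => w; exact: sqr_ge0. Qed.

(** Up to the factor [c], this bounds the Lipschitz constant in [x] of [wsum n x / 2^n]. Its
    expectation decays like rho^n, because [Apath k] lies in the past of [N k]. *)
Definition remainder (n : nat) (w : T) : R :=
  (\sum_(k <- GG n) `|Apath N k w| * `|q (N k w)|) / 2 ^+ n.

Lemma remainder_ge0 n w : 0 <= remainder n w.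
Proof.
rewrite divr_ge0 ?exprn_ge0//; apply: sumr_ge0 => k _.
by rewrite mulr_ge0.
Qed.

Lemma remainder_summable :
  {ae P, forall w, exists M, forall n, \sum_(i < n) remainder i w <= M}.
Proof.
have prop k : (1 <= k)%N -> integ P (fun w => `|Apath N k w| * `|q (N k w)|) /\
    Ex P (fun w => `|Apath N k w| * `|q (N k w)|) <= rho ^+ trunc_log 2 k * (1 + s2).
  move=> k1; have [iA EA] := Apath_abs mN indN rho1 L2c Eabsc k1.
  have pA : past_meas N k (fun w => `|Apath N k w|).
    by apply: measurableT_comp => //; exact: past_meas_Apath.
  have mq' : measurable_fun setT (fun s => `|q s|) by exact: measurableT_comp.
  have iq := integ_norm (L2_integ (Lq k1)).
  have [i ->] := indep_Ex (q := fun s => `|q s|) mN indN k1 pA mq' (integ_norm iA) iq.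
  split => //; apply: ler_pM => //; [exact: Ex_ge0|exact: Ex_ge0|].
  apply: (@le_trans _ _ (Ex P (fun w => 1 + q (N k w) ^+ 2))).
    apply: le_Ex => // [|w]; first by apply: integD; [exact: integ_cst|exact: (Lq k1).2].
    rewrite -[_ ^+ 2]real_normK ?num_real//.
    by have := sqr_ge0 (`|q (N k w)| - 1); have := normr_ge0 (q (N k w)); nra.
  by rewrite ExD ?Ex_cst ?Eq2//; [exact: integ_cst|exact: (Lq k1).2].
have GG1 n k : k \in GG n -> (1 <= k)%N.
  by rewrite mem_index_iota => /andP[+ _]; apply: leq_trans; rewrite expn_gt0.
have iS n : integ P (fun w => \sum_(k <- GG n) `|Apath N k w| * `|q (N k w)|).
  apply: (@eq_integ _ _ _ _ (fun w => \sum_(k <- GG n | k \in GG n)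
    `|Apath N k w| * `|q (N k w)|)); first by move=> w; rewrite [RHS]big_seq.
  by apply: integ_sum => k /GG1/prop[].
have iF n : integ P (remainder n).
  by apply: (eq_integ _ (integZ (2 ^+ n)^-1 (iS n))) => w; rewrite mulrC.
apply: (@ae_bounded_geometric _ _ _ P remainder (1 + s2) rho) => //.
- by move=> n; exact: integ_meas (iF n).
- exact: remainder_ge0.
move=> n.
have -> : Ex P (remainder n) = (2 ^+ n)^-1 * Ex P (fun w =>
    \sum_(k <- GG n | k \in GG n) `|Apath N k w| * `|q (N k w)|).
  rewrite -ExZ; last by apply: integ_sum => k /GG1/prop[].
  by apply: eq_Ex => w; rewrite /remainder mulrC big_seq.
rewrite Ex_sum; last by move=> k /GG1/prop[].
rewrite -big_seq ler_pdivrMl ?exprn_gt0//.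
rewrite mulrC -sumr_GG_const; apply: ler_sum_GG => k k1 kn.
by have [_] := prop k k1; rewrite (trunc_log_GG kn) mulrC.
Qed.

Variables (f : R -> R) (c : R).
Hypothesis bf : BL f c.

Let c0 : 0 <= c. Proof. exact: BL_ge0 bf. Qed.

Definition wsum (j : nat) (x : R) (w : T) : R :=
  \sum_(k <- GG j) f (Y0 N k w + x * Apath N k w) * q (N k w).

Let g x k w := f (Y0 N k w + x * Apath N k w).

Let pg x k : (1 <= k)%N -> past_meas N k (g x k).
Proof.
move=> k1; apply: (measurableT_comp (BL_measurable bf)).
apply: measurable_funD; first exact: past_meas_Y0.
by apply: measurable_funM => //; exact: past_meas_Apath.
Qed.

Lemma wsum_lipschitz j x y w :
  `|wsum j x w - wsum j y w| <= c * `|x - y| * (2 ^+ j * remainder j w).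
Proof.
rewrite /remainder mulrC [2 ^+ j * _]mulrC mulfVK ?expf_neq0//.
rewrite /wsum -sumrB; apply: le_trans (ler_norm_sum _ _ _) _.
rewrite mulr_suml; apply: ler_sum => k _.
rewrite -mulrBl normrM; have := bf.2 (Y0 N k w + x * Apath N k w) (Y0 N k w + y * Apath N k w).
have -> : Y0 N k w + x * Apath N k w - (Y0 N k w + y * Apath N k w) =
  (x - y) * Apath N k w by ring.
rewrite normrM => h; rewrite mulrAC [X in _ <= X](_ : _ =
  c * (`|x - y| * `|Apath N k w|) * `|q (N k w)|); last by ring.
exact: ler_wpM2r.
Qed.

(** The null set is fixed before [x], so that a random initial state can be substituted later. At
    [x = 0] this is [mdiff_lln]; for other [x] the average moves by at most [c * |x|] times
    [remainder n], which tends to 0. *)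
Lemma weighted_noise_lln : {ae P, forall w, forall x,
  wsum n x w / 2 ^+ n @[n --> \oo] --> 0}.
Proof.
have gc k w : (1 <= k)%N -> `|g 0 k w| <= c by move=> _; exact: bf.1.
have Lg k : (1 <= k)%N -> L2 P (g 0 k).
  move=> k1; apply: (@L2_bounded _ _ _ _ _ c); last by move=> w; exact: gc.
  exact: (past_meas_meas mN (pg 0 k1)).
have md k (k1 : (1 <= k)%N) := mdiffM mN indN k1 (pg 0 k1) (Lg k k1) mq (Lq k1) (q0 k1).
have := mdiff_lln (B := c ^+ 2 * s2) (fun k k1 => (md k k1).1).
have h k : (1 <= k)%N -> Ex P (fun w => (g 0 k w * q (N k w)) ^+ 2) <= c ^+ 2 * s2.
  move=> k1; rewrite (md k k1).2 Eq2// ler_wpM2r// -(Ex_cst P (c ^+ 2)).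
  apply: le_Ex => [||w]; [exact: (Lg k k1).2|exact: integ_cst|].
  by rewrite -real_normK ?num_real// lerXn2r ?nnegrE// gc.
move=> /(_ h) lln0.
apply: filterS2 lln0 remainder_summable => w l0 [M rM] x.
have r0 := bounded_series_cvg0 (remainder_ge0^~ w) rM.
have d0 : (wsum n x w - wsum n 0 w) / 2 ^+ n @[n --> \oo] --> 0.
  apply/cvgr0Pnorm_lt => e e0.
  have cx : 0 < c * `|x| + 1 by rewrite ltr_wpDl// mulr_ge0.
  have /cvgr0Pnorm_lt/(_ (e / (c * `|x| + 1))) := r0.
  move=> /(_ (divr_gt0 e0 cx)); apply: filterS => n.
  rewrite (ger0_norm (remainder_ge0 _ _)) ltr_pdivlMr// => rn.
  have := wsum_lipschitz n x 0 w; rewrite subr0 => h1.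
  have t0 : 0 < 2 ^+ n :> R by rewrite exprn_gt0.
  rewrite normrM normfV (ger0_norm (ltW t0)) ltr_pdivrMr//.
  apply: le_lt_trans h1 _; rewrite mulrCA mulrC ltr_pM2r//.
  by apply: le_lt_trans rn; rewrite mulrC ler_wpM2l ?remainder_ge0// lerDl.
have -> : (fun n => wsum n x w / 2 ^+ n) = (fun n =>
    (wsum n x w - wsum n 0 w) / 2 ^+ n + wsum n 0 w / 2 ^+ n).
  by apply/funext => n; rewrite -mulrDl subrK.
by rewrite -[X in _ --> X]addr0; exact: cvgD.
Qed.

(** The difference is again a sum of martingale differences, whose weights are at most
    [c * |x - y| * |Apath k|]. The factor rho^j is the second moment of [Apath], and 2^j counts the
    nodes. *)
Let wsum_inc j x y : L2 P (fun w => wsum j x w - wsum j y w) /\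
  Ex P (fun w => (wsum j x w - wsum j y w) ^+ 2) <=
    c ^+ 2 * s2 * (x - y) ^+ 2 * (rho ^+ j * 2 ^+ j).
Proof.
pose F k w := g x k w - g y k w.
have pF k : (1 <= k)%N -> past_meas N k (F k).
  by move=> k1; apply: measurable_funB; exact: pg.
have FA k w : `|F k w| <= `|c * (x - y) * Apath N k w|.
  have := bf.2 (Y0 N k w + x * Apath N k w) (Y0 N k w + y * Apath N k w).
  have -> : Y0 N k w + x * Apath N k w - (Y0 N k w + y * Apath N k w) =
    (x - y) * Apath N k w by ring.
  by rewrite -mulrA !normrM (ger0_norm c0).
have LF k : (1 <= k)%N -> L2 P (F k).
  move=> k1; have [LA _] := Apath_sqr mN indN rho1 L2c Ec k1.
  apply: le_L2 (FA k) (L2Z _ LA); exact: (past_meas_meas mN (pF k k1)).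
have md k (k1 : (1 <= k)%N) := mdiffM mN indN k1 (pF k k1) (LF k k1) mq (Lq k1) (q0 k1).
have md1 k (k1 : (1 <= k)%N) := (md k k1).1.
have j1 : (1 <= 2 ^ j)%N by rewrite expn_gt0.
have jj : (1 <= 2 ^ j <= 2 ^ j.+1)%N by rewrite j1 leq_exp2l/=.
have FE : (fun w => \sum_(k <- GG j) F k w * q (N k w)) =
    (fun w => wsum j x w - wsum j y w).
  by apply/funext => w; rewrite /wsum -sumrB; apply: eq_bigr => k _; rewrite mulrBl.
have [LS _] := mdiff_sum_L2 (2 ^ j.+1) md1 j1.
have ES := mdiff_sum_sqr md1 jj.
rewrite -/(GG j) FE in LS; split => //.
have -> : (fun w => (wsum j x w - wsum j y w) ^+ 2) =
    (fun w => (\sum_(k <- GG j) F k w * q (N k w)) ^+ 2).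
  by apply/funext => w; rewrite -[wsum j x w - _]/((fun w => wsum j x w - wsum j y w) w) -FE.
rewrite ES mulrA -sumr_GG_const; apply: ler_sum_GG => k k1 kj.
rewrite (md k k1).2 Eq2// [leRHS](_ : _ = ((c * (x - y)) ^+ 2 * rho ^+ j) * s2); last by ring.
rewrite ler_wpM2r//.
have [LA EA] := Apath_sqr mN indN rho1 L2c Ec k1.
rewrite (trunc_log_GG kj) in EA.
apply: (@le_trans _ _ (Ex P (fun w => (c * (x - y)) ^+ 2 * Apath N k w ^+ 2))).
  apply: le_Ex => [||w]; [exact: (LF k k1).2|exact: integZ LA.2|].
  rewrite -exprMn -[leLHS]real_normK ?num_real// -[leRHS]real_normK ?num_real//.
  by rewrite lerXn2r ?nnegrE// FA.
by rewrite ExZ ?ler_wpM2l ?sqr_ge0//; exact: LA.2.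
Qed.

Let gridpt (sg : bool) j i : R := (-1) ^+ sg * (i%:R / 2 ^+ j).

Let gridinc sg (K : nat) j w := \sum_(i < K * 2 ^ j)
  (wsum j (gridpt sg j i.+1) w - wsum j (gridpt sg j i) w) ^+ 2.

(* A discrete Sobolev inequality: on a grid of mesh [2^-j] the squared increments
   of [x |-> wsum j x] have a summable total expectation, which controls the
   supremum over the whole grid, and hence any random initial state. *)
Let gridinc_summable sg K :
  {ae P, forall w, exists M, forall n, \sum_(i < n) gridinc sg K i w <= M}.
Proof.
have iF j : integ P (gridinc sg K j).
  by apply: integ_sum => i _; exact: (wsum_inc _ _ _).1.2.
apply: (@ae_bounded_geometric _ _ _ P (gridinc sg K) (K%:R * (c ^+ 2 * s2)) rho) => //.
- by move=> n; exact: integ_meas (iF n).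
- by move=> n w; apply: sumr_ge0 => i _; exact: sqr_ge0.
move=> j; rewrite Ex_sum; last by move=> i _; exact: (wsum_inc _ _ _).1.2.
apply: (@le_trans _ _ (\sum_(i < K * 2 ^ j)
    (c ^+ 2 * s2 * rho ^+ j * (2 ^+ j)^-1))).
  apply: ler_sum => i _; apply: le_trans (wsum_inc _ _ _).2 _.
  have t0 : (2 : R) ^+ j != 0 by rewrite expf_neq0.
  have -> : (gridpt sg j i.+1 - gridpt sg j i) ^+ 2 = (2 ^+ j)^-1 ^+ 2.
    rewrite /gridpt -mulrBr exprMn -exprM mulnC exprM sqrrN expr1n expr1n mul1r.
    by rewrite -mulrBl -natrB// subSnn mul1r.
  by apply: eq_ler; field.
rewrite sumr_const cardT size_enum_ord -[leLHS]mulr_natl natrM natrX.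
have t0 : (2 : R) ^+ j != 0 by rewrite expf_neq0.
by apply: eq_ler; field.
Qed.

(** The value at a grid point is reached from 0 by telescoping at most [K * 2^j] increments.
    Cauchy-Schwarz costs that number as a factor, and the division by 2^j leaves only [K]. *)
Let gridsup sg K j w i : (i <= K * 2 ^ j)%N ->
  (wsum j (gridpt sg j i) w - wsum j 0 w) ^+ 2 / 2 ^+ j <= K%:R * gridinc sg K j w.
Proof.
move=> iK; have g0 : gridpt sg j 0 = 0 by rewrite /gridpt mul0r mulr0.
have t0 : 0 < 2 ^+ j :> R by rewrite exprn_gt0.
have -> : wsum j (gridpt sg j i) w - wsum j 0 w = \sum_(l < i)
    (wsum j (gridpt sg j l.+1) w - wsum j (gridpt sg j l) w).
  transitivity (\sum_(0 <= l < i)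
      (wsum j (gridpt sg j l.+1) w - wsum j (gridpt sg j l) w)).
    by rewrite (telescope_sumr (fun l => wsum j (gridpt sg j l) w))// g0.
  by rewrite big_mkord.
rewrite ler_pdivrMr//; apply: le_trans (sqr_sum_le (fun l =>
  wsum j (gridpt sg j l.+1) w - wsum j (gridpt sg j l) w) i) _.
rewrite mulrAC; apply: ler_pM => //.
- by apply: sumr_ge0 => l _; exact: sqr_ge0.
- by rewrite -natrX -natrM ler_nat.
pose G l := (wsum j (gridpt sg j l.+1) w - wsum j (gridpt sg j l) w) ^+ 2.
have -> : gridinc sg K j w = \sum_(0 <= l < K * 2 ^ j) G l by rewrite big_mkord.
rewrite (_ : \sum_(l < i) _ = \sum_(0 <= l < i) G l); last by rewrite big_mkord.
rewrite [leRHS](big_cat_nat (n := i))//= lerDl.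
by apply: sumr_ge0 => l _; exact: sqr_ge0.
Qed.

Variable m4 : R.
Hypothesis Lq2 : forall k, (1 <= k)%N -> L2 P (fun w => q (N k w) ^+ 2).
Hypothesis Eq4 : forall k, (1 <= k)%N ->
  Ex P (fun w => (q (N k w) ^+ 2 - s2) ^+ 2) <= m4.

(** The Lipschitz bound alone would give 2^j [remainder j]^2 in generation j, and the decay of
    [remainder] need not beat 2^j. So [x] is joined to 0 through the grid: [gridsup] handles the
    passage from 0 to the grid point, and the Lipschitz bound only the last distance 2^-j, where it
    costs [c * remainder j]. *)
Lemma wsum_squares : {ae P, forall w, forall x, exists M, forall n,
  \sum_(j < n) wsum j x w ^+ 2 / 2 ^+ j <= M * n.+1%:R}.
Proof.
have gc k w : (1 <= k)%N -> `|g 0 k w| <= c by move=> _; exact: bf.1.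
have sq0 := weighted_noise_squares mN indN mq Lq q0 Eq2 Lq2 Eq4 (pg 0) gc.
have grids : {ae P, forall w, forall K sg, exists M, forall n,
    \sum_(i < n) gridinc sg K i w <= M}.
  apply/ae_foralln => K.
  apply: filterS2 (gridinc_summable true K) (gridinc_summable false K).
  by move=> w ht hf [].
apply: filterS3 sq0 grids remainder_summable => w [M0 h0] hg [Mr hr] x.
(* The grid runs over [0, K] or [-K, 0] according to the sign [sg] of [x]; [i j] is the index of the
   grid point of mesh 2^-j next to [x] on the side of 0. *)
pose sg := x < 0; pose K := (Num.truncn `|x|).+1.
have [Mg hg'] := hg K sg.
pose i j := Num.truncn (`|x| * 2 ^+ j).
have t0 j : 0 < 2 ^+ j :> R by rewrite exprn_gt0.
have xj0 j : 0 <= `|x| * 2 ^+ j by rewrite mulr_ge0// ltW.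
have iK j : (i j <= K * 2 ^ j)%N.
  rewrite -(ler_nat R) natrM natrX.
  apply: (@le_trans _ _ (`|x| * 2 ^+ j)); first by rewrite truncn_le.
  by rewrite ler_wpM2r ?(ltW (t0 _))// ltW// truncnS_gt.
have xg j : `|x - gridpt sg j (i j)| <= (2 ^+ j)^-1.
  have xE : x = (-1) ^+ sg * `|x|.
    rewrite /sg; case: ltrP => h; first by rewrite expr1 mulN1r ltr0_norm// opprK.
    by rewrite expr0 mul1r ger0_norm.
  rewrite {1}xE /gridpt -mulrBr normrM normrX normrN1 expr1n mul1r.
  have a1 : (i j)%:R <= `|x| * 2 ^+ j by rewrite truncn_le.
  have a2 : `|x| * 2 ^+ j < (i j).+1%:R by exact: truncnS_gt.
  have -> : `|x| - (i j)%:R / 2 ^+ j = (`|x| * 2 ^+ j - (i j)%:R) / 2 ^+ j.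
    by rewrite mulrBl mulfK// gt_eqF.
  rewrite normrM normfV (ger0_norm (ltW (t0 j))) ger0_norm ?subr_ge0//.
  rewrite -[leRHS]mul1r ler_wpM2r ?invr_ge0 ?(ltW (t0 _))//.
  by rewrite lerBlDl natr1 ltW.
have Mr0 : 0 <= Mr by have := hr 0%N; rewrite big_ord0.
have Mg0 : 0 <= Mg by have := hg' 0%N; rewrite big_ord0.
have rMr j : remainder j w <= Mr.
  have := hr j.+1; rewrite big_ord_recr/=; apply: le_trans.
  by rewrite lerDr; apply: sumr_ge0 => k _; exact: remainder_ge0.
(* The factor 3 is that of (p + q + r)^2 <= 3 (p^2 + q^2 + r^2), for the value at 0, the move along
   the grid and the last mesh. *)
have step j : wsum j x w ^+ 2 / 2 ^+ j <= 3 * (wsum j 0 w ^+ 2 / 2 ^+ j +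
    (K%:R * gridinc sg K j w + c ^+ 2 * Mr * remainder j w)).
  have e1 := gridsup sg w (iK j).
  have e2 : (wsum j x w - wsum j (gridpt sg j (i j)) w) ^+ 2 / 2 ^+ j <=
      c ^+ 2 * Mr * remainder j w.
    have l1 : `|wsum j x w - wsum j (gridpt sg j (i j)) w| <= c * remainder j w.
      apply: le_trans (wsum_lipschitz _ _ _ _) _.
      rewrite -mulrA ler_wpM2l// mulrA -[leRHS]mul1r ler_wpM2r ?remainder_ge0//.
      by rewrite -ler_pdivlMr// div1r.
    rewrite ler_pdivrMr// -real_normK ?num_real//.
    apply: (@le_trans _ _ ((c * remainder j w) ^+ 2)).
      have cr0 : 0 <= c * remainder j w.
        by apply: mulr_ge0 => //; exact: remainder_ge0.
      by rewrite lerXn2r ?nnegrE.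
    rewrite [leRHS](_ : _ = c ^+ 2 * ((Mr * remainder j w) * 2 ^+ j)); last by ring.
    rewrite exprMn; apply: ler_wpM2l; first exact: sqr_ge0.
    apply: (@le_trans _ _ (Mr * remainder j w)).
      by rewrite expr2; apply: ler_wpM2r => //; exact: remainder_ge0.
    have Mrr : 0 <= Mr * remainder j w by apply: mulr_ge0 => //; exact: remainder_ge0.
    by apply: ler_peMr => //; apply: exprn_ege1; lra.
  have := lerD e1 e2; rewrite -mulrDl.
  set a := wsum j x w; set b := wsum j _ w; set d := wsum j 0 w => e3.
  apply: (@le_trans _ _ (3 * (d ^+ 2 / 2 ^+ j + ((b - d) ^+ 2 + (a - b) ^+ 2) / 2 ^+ j))).
    rewrite -mulrDl mulrA ler_wpM2r ?invr_ge0 ?(ltW (t0 _))//.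
    have := sqr_ge0 (d - (b - d)); have := sqr_ge0 (d - (a - b)).
    by have := sqr_ge0 ((b - d) - (a - b)); nra.
  by rewrite ler_wpM2l// lerD2l.
exists (3 * (M0 + (K%:R * Mg + c ^+ 2 * Mr * Mr))) => n.
apply: le_trans; first by apply: ler_sum => j _; exact: step.
rewrite -mulr_sumr !big_split/= -!mulr_sumr -[leRHS]mulrA ler_wpM2l// mulrDl.
apply: lerD; first exact: h0.
apply: (@le_trans _ _ (K%:R * Mg + c ^+ 2 * Mr * Mr)).
  apply: lerD; first by apply: ler_wpM2l => //; exact: hg'.
  apply: ler_wpM2l; last exact: hr.
  by apply: mulr_ge0 => //; exact: sqr_ge0.
apply: ler_peMr; last by rewrite ler1n.
by apply: addr_ge0; apply: mulr_ge0 => //; apply: mulr_ge0 => //; exact: sqr_ge0.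
Qed.

End initial_state.

(** * Non-degeneracy of the empirical law *)

Section sphere_weights.
Context {R : realType}.

(** The pair ([hw], [vw]) is the inverse stereographic projection of the line onto a circle: [vw]^2
    = [hw] (1 - [hw]). With [vw x * x = 1 - hw x] and [hw x * x = vw x], all weights of the
    estimators become polynomials in these two functions, hence bounded and Lipschitz. *)
Definition hw (x : R) : R := (1 + x ^+ 2)^-1.
Definition vw (x : R) : R := x / (1 + x ^+ 2).

Lemma hw_gt0 x : 0 < hw x.
Proof. by rewrite invr_gt0 ltr_pwDl// sqr_ge0. Qed.

Lemma hw_le1 x : hw x <= 1.
Proof. by rewrite invf_le1 ?lerDl ?sqr_ge0// ltr_pwDl ?sqr_ge0. Qed.

Lemma hw_inj_sqr x y : hw x = hw y -> x ^+ 2 = y ^+ 2.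
Proof. by move/invr_inj/addrI. Qed.

Lemma BL_hw : BL hw 1.
Proof.
split=> [x|x y]; first by rewrite gtr0_norm ?hw_gt0// hw_le1.
have hx : 0 < 1 + x ^+ 2 by rewrite ltr_pwDl ?sqr_ge0.
have hy : 0 < 1 + y ^+ 2 by rewrite ltr_pwDl ?sqr_ge0.
rewrite (_ : hw x - hw y = - ((x - y) * ((x + y) / ((1 + x ^+ 2) * (1 + y ^+ 2))))); last first.
  by rewrite /hw; field; rewrite !gt_eqF.
rewrite normrN normrM mulrC ler_wpM2r// normrM normfV (gtr0_norm (mulr_gt0 hx hy)).
rewrite ler_pdivrMr ?mulr_gt0// mul1r.
apply: le_trans (ler_normD _ _) _.
rewrite -[in leRHS](real_normK (num_real x)) -[in leRHS](real_normK (num_real y)).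
set a := `|x|; set b := `|y|.
have := sqr_ge0 (a - 1); have := sqr_ge0 (b - 1); have := sqr_ge0 (a * b); nra.
Qed.

Lemma BL_vw : BL vw 1.
Proof.
split=> [x|x y].
  have hx : 0 < 1 + x ^+ 2 by rewrite ltr_pwDl ?sqr_ge0.
  rewrite normrM normfV (gtr0_norm hx) ler_pdivrMr// mul1r.
  rewrite -(real_normK (num_real x)); set a := `|x|.
  by have := sqr_ge0 (a - 1); have : 0 <= a := normr_ge0 x; nra.
have hx : 0 < 1 + x ^+ 2 by rewrite ltr_pwDl ?sqr_ge0.
have hy : 0 < 1 + y ^+ 2 by rewrite ltr_pwDl ?sqr_ge0.
rewrite (_ : vw x - vw y = (x - y) * ((1 - x * y) / ((1 + x ^+ 2) * (1 + y ^+ 2)))); last first.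
  by rewrite /vw; field; rewrite !gt_eqF.
rewrite normrM mulrC ler_wpM2r// normrM normfV (gtr0_norm (mulr_gt0 hx hy)).
rewrite ler_pdivrMr ?mulr_gt0// mul1r.
apply: le_trans (ler_normB _ _) _; rewrite normr1 normrM.
rewrite -[in leRHS](real_normK (num_real x)) -[in leRHS](real_normK (num_real y)).
set a := `|x|; set b := `|y|.
have := sqr_ge0 (a - b); have := sqr_ge0 (a * b - 1); have : 0 <= a * b by rewrite mulr_ge0 ?normr_ge0.
nra.
Qed.

End sphere_weights.

Section children_sums.
Context {R : realType}.

Lemma sum_children (F : nat -> R) a b : (a <= b)%N ->
  \sum_(a.*2 <= k < b.*2) F k = \sum_(a <= p < b) (F p.*2 + F p.*2.+1).
Proof.
elim: b => [|b IH]; first by rewrite leqn0 => /eqP ->; rewrite !big_geq.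
rewrite leq_eqVlt => /predU1P[<-|]; first by rewrite !big_geq.
rewrite ltnS => ab; rewrite doubleS [in RHS]big_nat_recr//= -IH//.
by rewrite !big_nat_recr//= ?addrA// -?doubleS ?leq_double// leqW// leq_double.
Qed.

Lemma sum_GG_children (F : nat -> R) n :
  \sum_(k <- GG n.+1) F k = \sum_(p <- GG n) (F p.*2 + F p.*2.+1).
Proof. by rewrite /GG -sum_children ?leq_exp2l// -!mul2n -!expnS. Qed.

Lemma ler_sum_GG_even (F : nat -> R) n : (forall k, 0 <= F k) ->
  \sum_(p <- GG n) F p.*2 <= \sum_(k <- GG n.+1) F k.
Proof.
by move=> F0; rewrite sum_GG_children; apply: ler_sum => k _; rewrite lerDl.
Qed.

Lemma ler_sum_GG_TT (F : nat -> R) n : (forall k, 0 <= F k) ->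
  \sum_(p <- GG n) F p.*2 + \sum_(p <- GG n) F p.*2.*2 <=
  \sum_(k <- TT n.+2) F k.
Proof.
move=> F0; rewrite sum_TT big_ord_recr/= big_ord_recr/=.
have h3 : 0 <= \sum_(i < n.+1) \sum_(k <- GG i) F k.
  by apply: sumr_ge0 => i _; apply: sumr_ge0 => k _.
have h1 := ler_sum_GG_even n F0.
have h2 := ler_sum_GG_even n.+1 F0.
have h4 := ler_sum_GG_even (F := fun k => F k.*2) n (fun k => F0 _).
by lra.
Qed.

End children_sums.

(** * The chain of even children and the spread of its empirical law *)

Section transition.
Context {disp} {T : measurableType disp} {R : realType} (P : probability T R).
Variable N : nat -> T -> ((R * R) * (R * R))%type.
Hypothesis mN : forall k, measurable_fun setT (N k).
Hypothesis indN : noise_indep P N.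
Hypothesis lawN : forall k (phi : (R * R) * (R * R) -> R), (1 <= k)%N ->
  measurable_fun setT phi -> (forall s, 0 <= phi s) ->
  Ex P (fun w => phi (N k w)) = Ex P (fun w => phi (N 1%N w)).
Variables rho ce : R.
Hypothesis rho1 : 0 <= rho < 1.
Hypothesis L2c : forall b k, (1 <= k)%N -> L2 P (fun w => csel b (N k w)).
Hypothesis L2e : forall b k, (1 <= k)%N -> L2 P (fun w => esel b (N k w)).
Hypothesis Ec : forall b k, (1 <= k)%N ->
  Ex P (fun w => csel b (N k w) ^+ 2) <= rho.
Hypothesis Eabsc : forall b k, (1 <= k)%N ->
  Ex P (fun w => `|csel b (N k w)|) <= rho.
Hypothesis Ee : forall b k, (1 <= k)%N ->
  Ex P (fun w => esel b (N k w) ^+ 2) <= ce.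

Let step k w x := csel false (N k w) * x + esel false (N k w).

(* Transition operator from a node to its even child. *)
Definition Top (f : R -> R) (x : R) : R := Ex P (fun w => f (step 1 w x)).

Let mstep k x : measurable_fun setT (fun w => step k w x).
Proof.
apply: measurable_funD; last by apply: measurableT_comp => //; exact: measurable_esel.
by apply: measurable_funM => //; apply: measurableT_comp => //; exact: measurable_csel.
Qed.

Let i_step f c k x : BL f c -> integ P (fun w => f (step k w x)).
Proof.
move=> bf; apply: (@integ_bounded _ _ _ _ _ c); last by move=> w; exact: bf.1.
by apply: measurableT_comp => //; exact: BL_measurable bf.
Qed.

Lemma Top_ge0 f x : (forall y, 0 <= f y) -> 0 <= Top f x.
Proof. by move=> f0; apply: Ex_ge0. Qed.

Lemma BL_Top f c : BL f c -> BL (Top f) c.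
Proof.
move=> bf; have c0 := BL_ge0 bf; split=> [x|x y].
  apply: le_trans (ler_norm_Ex (i_step 1 x bf)) _.
  rewrite -(Ex_cst P c); apply: le_Ex => [||w]; [exact: integ_norm (i_step 1 x bf)|exact: integ_cst|exact: bf.1].
have iB := integB (i_step 1 x bf) (i_step 1 y bf).
rewrite /Top -ExB; [|exact: i_step bf|exact: i_step bf].
apply: le_trans (ler_norm_Ex iB) _.
have ia := integ_norm (L2_integ (L2c false (leqnn 1))).
apply: (@le_trans _ _ (Ex P (fun w => c * `|x - y| * `|csel false (N 1%N w)|))).
  apply: le_Ex => [||w]; [exact: integ_norm|exact: integZ|].
  apply: le_trans (bf.2 _ _) _; rewrite -mulrA ler_wpM2l//.
  by rewrite /step opprD addrACA subrr addr0 -mulrBr normrM mulrC.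
rewrite ExZ// ler_piMr ?mulr_ge0//.
by apply: le_trans (Eabsc false (leqnn 1)) _; case/andP: rho1 => _ /ltW.
Qed.

Let Y0_even k w : (1 <= k)%N -> Y0 N k.*2 w = step k w (Y0 N k w).
Proof.
move=> k1; rewrite /Y0 arS; last by lia.
by rewrite doubleK /coef /innov odd_double doubleK.
Qed.

(** The value of the even child is a function of [Y0 k] and of [N k]; freezing the pair ([Z],
    [Y0 k]), which belongs to the past, and integrating over [N k] turns [f] at the child into
    [Top f] at the mother. *)
Let kernel_mdiff f c k : BL f c -> (1 <= k)%N ->
  mdiff P N k (fun w => f (Y0 N k.*2 w) - Top f (Y0 N k w)) /\
  forall w, `|f (Y0 N k.*2 w) - Top f (Y0 N k w)| <= 2 * c.
Proof.
move=> bf k1; have bT := BL_Top bf.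
have pY : past_meas N k (Y0 N k) by exact: past_meas_Y0.
have bnd w : `|f (Y0 N k.*2 w) - Top f (Y0 N k w)| <= 2 * c.
  apply: le_trans (ler_normB _ _) _.
  by rewrite mulr2n mulrDl mul1r lerD//; [exact: bf.1|exact: bT.1].
have p1 : past_meas N k.+1 (fun w => f (Y0 N k.*2 w) - Top f (Y0 N k w)).
  apply: measurable_funB; last first.
    apply: (measurableT_comp (BL_measurable bT)).
    exact: past_meas_le (leqnSn k) pY.
  apply: (measurableT_comp (BL_measurable bf)).
  rewrite (_ : Y0 N k.*2 = fun w => step k w (Y0 N k w)); last first.
    by apply/funext => w; exact: Y0_even.
  have kk : (1 <= k < k.+1)%N by rewrite k1 ltnSn.
  apply: measurable_funD; last by apply: past_meas_fnoise kk; exact: measurable_esel.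
  apply: measurable_funM; last exact: past_meas_le (leqnSn k) pY.
  by apply: past_meas_fnoise kk; exact: measurable_csel.
have mf := past_meas_meas mN p1.
have LD : L2 P (fun w => f (Y0 N k.*2 w) - Top f (Y0 N k w)) by exact: L2_bounded bnd.
split => //; split => // Z pZ LZ.
pose U w := (Z w, Y0 N k w).
have pU : past_meas N k U by exact: measurable_fun_pair.
have mU := past_meas_meas mN pU.
have ind A B : measurable A -> measurable B ->
    P (U @^-1` A `&` N k @^-1` B) = (P (U @^-1` A) * P (N k @^-1` B))%E.
  move=> mA mB; apply: indN => //.
  by have := pU measurableT A mA; rewrite setTI.
pose Psi (z : (R * R) * ((R * R) * (R * R))) : R :=
  z.1.1 * (f (csel false z.2 * z.1.2 + esel false z.2) - Top f z.1.2).
have mPsi : measurable_fun setT Psi.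
  apply: measurable_funM; first by apply: measurableT_comp => //.
  apply: measurable_funB; last first.
    by apply: (measurableT_comp (BL_measurable bT)); apply: measurableT_comp.
  apply: (measurableT_comp (BL_measurable bf)).
  apply: measurable_funD.
    apply: measurable_funM; last by apply: measurableT_comp.
    by apply: measurableT_comp => //; exact: measurable_csel.
  by apply: measurableT_comp => //; exact: measurable_esel.
have PsiE w : Psi (U w, N k w) = Z w * (f (Y0 N k.*2 w) - Top f (Y0 N k w)).
  by rewrite Y0_even.
have iPsi : integ P (fun w => Psi (U w, N k w)).
  by apply: (eq_integ (fun w => esym (PsiE w))); exact: integM.
have iV x : integ P (fun w => Psi (x, N k w)).
  exact: integZ (integB (i_step k x.2 bf) (integ_cst P (Top f x.2))).
apply: EFin_inj; rewrite -EFin_Ex; last exact: integM.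
under eq_integral => w _ do rewrite -PsiE.
rewrite (freezing mU (mN k) ind mPsi iPsi iV).
under eq_integral => w _.
  rewrite EFin_Ex//.
  have -> : Ex P (fun w' => Psi (U w, N k w')) = 0.
    rewrite /Psi /= ExZ; last by apply: integB; [exact: i_step bf|exact: integ_cst].
    rewrite ExB; [|exact: i_step bf|exact: integ_cst].
    rewrite Ex_cst (_ : Ex P _ = Top f (Y0 N k w)) ?subrr ?mulr0//.
    have mfx : measurable_fun setT (fun s => f (csel false s * Y0 N k w + esel false s)).
      apply: (measurableT_comp (BL_measurable bf)).
      apply: measurable_funD; last exact: measurable_esel.
      by apply: measurable_funM => //; exact: measurable_csel.
    (* [lawN] compares laws on nonnegative functions only; [f] is shifted by its bound [c], and the
       shift is cancelled on both sides. *)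
    have := lawN (phi := fun s => f (csel false s * Y0 N k w + esel false s) + c) k1
      (measurable_funD mfx (measurable_cst c)).
    rewrite !ExD; [|exact: i_step bf|exact: integ_cst|exact: i_step bf|exact: integ_cst].
    move=> h; apply: (addIr (Ex P (fun=> c))); apply: h => s.
    by have := bf.1 (csel false s * Y0 N k w + esel false s); rewrite ler_norml; lra.
  over.
by rewrite integral0.
Qed.

(** The deterministic weights [wt] are there to restrict the sum to the even nodes, which gives the
    passage from even children to even grandchildren. *)
Lemma kernel_lln f c (wt : nat -> R) : BL f c -> (forall k, `|wt k| <= 1) ->
  {ae P, forall w, (\sum_(k <- GG n) wt k *
    (f (Y0 N k.*2 w) - Top f (Y0 N k w))) / 2 ^+ n @[n --> \oo] --> 0}.
Proof.
move=> bf wt1; apply: (@mdiff_lln _ _ _ _ _ _ N _ ((2 * c) ^+ 2)) => k k1.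
  by apply: mdiffZ; have [] := kernel_mdiff bf k1.
have [md bd] := kernel_mdiff bf k1.
have [L _ _] := mdiffZ (wt k) md.
rewrite -(Ex_cst P ((2 * c) ^+ 2)); apply: le_Ex => [||w]; [exact: L.2|exact: integ_cst|].
rewrite -real_normK ?num_real// lerXn2r ?nnegrE//.
  by rewrite mulr_ge0//; exact: BL_ge0 bf.
by rewrite normrM -[leRHS]mul1r; apply: ler_pM.
Qed.

Lemma kernel_lln_all f c : BL f c ->
  {ae P, forall w, (\sum_(p <- GG n)
    (f (Y0 N p.*2 w) - Top f (Y0 N p w))) / 2 ^+ n @[n --> \oo] --> 0}.
Proof.
move=> bf; apply: filterS (kernel_lln (wt := fun=> 1) bf (fun=> eq_ler (normr1 _))).
move=> w; rewrite (_ : (fun n => _) = (fun n => (\sum_(p <- GG n)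
    (f (Y0 N p.*2 w) - Top f (Y0 N p w))) / 2 ^+ n))//.
by apply/funext => n; congr (_ / _); apply: eq_bigr => p _; rewrite mul1r.
Qed.

Lemma kernel_lln_even f c : BL f c ->
  {ae P, forall w, (\sum_(p <- GG n)
    (f (Y0 N p.*2.*2 w) - Top f (Y0 N p.*2 w))) / 2 ^+ n @[n --> \oo] --> 0}.
Proof.
move=> bf; have wt1 (k : nat) : `|(~~ odd k)%:R : R| <= 1 by case: odd; rewrite ?normr0 ?normr1.
apply: filterS (kernel_lln bf wt1) => w l0.
have l1 : (\sum_(k <- GG n.+1) (~~ odd k)%:R *
    (f (Y0 N k.*2 w) - Top f (Y0 N k w))) / 2 ^+ n.+1 @[n --> \oo] --> 0.
  by move: l0; rewrite -cvg_shiftS.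
(* The mothers are the even nodes of generation n + 1, normalized by 2^n instead of 2^(n+1): hence
   the factor 2. *)
rewrite -[X in _ --> X](mulr0 2) (_ : (fun n => _) = (fun n => 2 * ((\sum_(k <- GG n.+1)
    (~~ odd k)%:R * (f (Y0 N k.*2 w) - Top f (Y0 N k w))) / 2 ^+ n.+1))).
  by apply: cvgM l1; exact: cvg_cst.
apply/funext => n; rewrite sum_GG_children exprS invfM.
rewrite [in RHS](eq_bigr (fun p =>
    f (Y0 N p.*2.*2 w) - Top f (Y0 N p.*2 w))) => [|p _].
  by field; rewrite expf_neq0.
by rewrite /= odd_double /= mul0r addr0 mul1r.
Qed.

Let centered_norm (F : T -> R) (r : R) : 0 <= r -> L2 P F ->
  Ex P (fun w => F w ^+ 2) <= r ->
  let m := Ex P (fun w => `|F w|) in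
  [/\ L2 P (fun w => `|F w| - m), Ex P (fun w => `|F w| - m) = 0
    & Ex P (fun w => (`|F w| - m) ^+ 2) <= r].
Proof.
move=> r0 LF EF m.
have LaF : L2 P (fun w => `|F w|).
  have mF : measurable_fun setT (fun w => `|F w|).
    by apply: measurableT_comp => //; exact: L2_meas LF.
  by apply: le_L2 LF => // w; rewrite normr_id.
have iaF := L2_integ LaF.
have L : L2 P (fun w => `|F w| - m) by apply: L2B => //; exact: L2_cst.
have E0 : Ex P (fun w => `|F w| - m) = 0.
  by rewrite ExB ?Ex_cst ?subrr//; exact: integ_cst.
split => //.
have -> : Ex P (fun w => (`|F w| - m) ^+ 2) = Ex P (fun w => F w ^+ 2) - m ^+ 2.
  transitivity (Ex P (fun w => F w ^+ 2 - (2 * m * (`|F w| - m) + m ^+ 2))).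
    by apply: eq_Ex => w; rewrite -[F w ^+ 2]real_normK ?num_real//; ring.
  have i1 : integ P (fun w => 2 * m * (`|F w| - m)) by apply: integZ; exact: L2_integ.
  have i2 := integ_cst P (m ^+ 2).
  rewrite ExB; [|exact: LF.2|exact: integD].
  by rewrite ExD// Ex_cst ExZ ?E0 ?mulr0 ?add0r//; exact: L2_integ.
by rewrite lerBlDr; apply: le_trans EF _; rewrite lerDl sqr_ge0.
Qed.

Let ce0 : 0 <= ce.
Proof. by apply: le_trans (Ee false (leqnn 1)); apply: Ex_ge0 => w; exact: sqr_ge0. Qed.

(** The average [L n] of |Y| over generation n satisfies [L n.+1 <= rho * L n + D]: by the triangle
    inequality the two children of p contribute in mean at most 2 rho |Y_p| plus a constant, and the
    centered fluctuations of |coefficients| and |innovations| have averages that tend to 0, hence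
    are bounded. *)
Lemma tightness : {ae P, forall w, exists M, forall n,
  \sum_(k <- GG n) `|Y0 N k w| <= M * 2 ^+ n}.
Proof.
have /andP[r0 r1] := rho1.
have [B YB] := Y0_sqr_bounded mN indN rho1 L2c L2e Ec Ee.
have mc b : measurable_fun setT (fun s => `|@csel R b s|).
  by apply: measurableT_comp => //; exact: measurable_csel.
have me b : measurable_fun setT (fun s => `|@esel R b s|).
  by apply: measurableT_comp => //; exact: measurable_esel.
pose mC b k := Ex P (fun w => `|csel b (N k w)|).
pose mE b k := Ex P (fun w => `|esel b (N k w)|).
have llnC b : {ae P, forall w, (\sum_(k <- GG n) `|Y0 N k w| *
    (`|csel b (N k w)| - mC b k)) / 2 ^+ n @[n --> \oo] --> 0}.
  have md k (k1 : (1 <= k)%N) :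
      mdiff P N k (fun w => `|Y0 N k w| * (`|csel b (N k w)| - mC b k)) /\
      Ex P (fun w => (`|Y0 N k w| * (`|csel b (N k w)| - mC b k)) ^+ 2) <= B * rho.
    have [LY EY] := YB k k1.
    have [L E0 E2] := centered_norm r0 (L2c b k1) (Ec b k1).
    have pY : past_meas N k (fun w => `|Y0 N k w|).
      by apply: measurableT_comp => //; exact: past_meas_Y0.
    have LaY : L2 P (fun w => `|Y0 N k w|).
      apply: le_L2 LY => [|w]; [exact: (past_meas_meas mN pY)|by rewrite normr_id].
    have [md ->] := mdiffM (q := fun s => `|csel b s| - mC b k) mN indN k1 pY LaY
      (measurable_funB (mc b) (measurable_cst _)) L E0.
    split => //; apply: ler_pM => //; [apply: Ex_ge0|apply: Ex_ge0|] => *; rewrite ?sqr_ge0//.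
    by apply: le_trans EY; apply: eq_ler; apply: eq_Ex => w; rewrite real_normK ?num_real.
  exact: (mdiff_lln (fun k k1 => (md k k1).1) (fun k k1 => (md k k1).2)).
have llnE b : {ae P, forall w, (\sum_(k <- GG n) 1 *
    (`|esel b (N k w)| - mE b k)) / 2 ^+ n @[n --> \oo] --> 0}.
  have md k (k1 : (1 <= k)%N) :
      mdiff P N k (fun w => 1 * (`|esel b (N k w)| - mE b k)) /\
      Ex P (fun w => (1 * (`|esel b (N k w)| - mE b k)) ^+ 2) <= ce.
    have [L E0 E2] := centered_norm ce0 (L2e b k1) (Ee b k1).
    have p1 : past_meas N k (fun=> 1 : R) by exact: measurable_cst.
    have [md ->] := mdiffM (q := fun s => `|esel b s| - mE b k) mN indN k1 p1 (L2_cst P 1)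
      (measurable_funB (me b) (measurable_cst _)) L E0.
    split => //; rewrite (_ : (fun=> 1 ^+ 2) = (fun=> 1)) ?Ex_cst ?mul1r//.
    by apply/funext => w; rewrite expr1n.
  exact: (mdiff_lln (fun k k1 => (md k k1).1) (fun k k1 => (md k k1).2)).
have mEb b k : (1 <= k)%N -> mE b k <= 1 + ce.
  move=> k1; apply: (@le_trans _ _ (Ex P (fun w => 1 + esel b (N k w) ^+ 2))).
    apply: le_Ex => [||w]; first by apply: integ_norm; exact: L2_integ (L2e b k1).
      by apply: integD; [exact: integ_cst|exact: (L2e b k1).2].
    rewrite -[_ ^+ 2]real_normK ?num_real//.
    by have := sqr_ge0 (`|esel b (N k w)| - 1); have := normr_ge0 (esel b (N k w)); nra.
  rewrite ExD ?Ex_cst ?lerD2l; [exact: Ee|exact: integ_cst|exact: (L2e b k1).2].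
have cvg_bounded (u : nat -> R) : u n @[n --> \oo] --> 0 -> exists D, forall n, u n <= D.
  move=> u0; have /cvg_seq_bounded := cvgP _ u0.
  move=> [D [_ uD]]; exists (D + 1) => n.
  by apply: le_trans (ler_norm _) _; apply: uD => //; rewrite ltrDl.
apply: filterS2 (filterI (llnC true) (llnC false)) (filterI (llnE true) (llnE false)).
move=> w [/cvg_bounded[D1 h1] /cvg_bounded[D2 h2]] [/cvg_bounded[D3 h3] /cvg_bounded[D4 h4]].
pose L n := (\sum_(k <- GG n) `|Y0 N k w|) / 2 ^+ n.
have t0 n : 0 < 2 ^+ n :> R by rewrite exprn_gt0.
have L0 n : 0 <= L n by rewrite divr_ge0 ?(ltW (t0 _))//; exact: sumr_ge0.
(* [D1] to [D4] bound the four averaged fluctuations, and [1 + ce] bounds the mean of each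
   |innovation|. *)
pose D := `|D1 + D2 + D3 + D4 + 2 * (1 + ce)|.
have rec n : L n.+1 <= rho * L n + D.
  rewrite /L sum_GG_children.
  apply: (@le_trans _ _ ((\sum_(p <- GG n)
      (`|Y0 N p w| * (`|csel true (N p w)| - mC true p) +
       `|Y0 N p w| * (`|csel false (N p w)| - mC false p) +
       1 * (`|esel true (N p w)| - mE true p) +
       1 * (`|esel false (N p w)| - mE false p) +
       2 * rho * `|Y0 N p w| + 2 * (1 + ce))) / 2 ^+ n.+1)).
    rewrite ler_wpM2r ?invr_ge0 ?(ltW (t0 _))//.
    apply: ler_sum_GG => p p1 _.
    have -> : Y0 N p.*2 w = csel false (N p w) * Y0 N p w + esel false (N p w).
      exact: Y0_even.
    have -> : Y0 N p.*2.+1 w = csel true (N p w) * Y0 N p w + esel true (N p w).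
      rewrite /Y0 arS; last by lia.
      by rewrite /coef /innov /= odd_double uphalf_double.
    have n1 := ler_normD (csel false (N p w) * Y0 N p w) (esel false (N p w)).
    have n2 := ler_normD (csel true (N p w) * Y0 N p w) (esel true (N p w)).
    rewrite normrM in n1; rewrite normrM in n2.
    have := mEb true p p1; have := mEb false p p1.
    have := ler_wpM2r (normr_ge0 (Y0 N p w)) (Eabsc true p1).
    have := ler_wpM2r (normr_ge0 (Y0 N p w)) (Eabsc false p1).
    by rewrite -/(mC true p) -/(mC false p); lra.
  rewrite !big_split/= sumr_GG_const exprS.
  have -> : \sum_(p <- GG n) 2 * rho * `|Y0 N p w| =
    2 * rho * \sum_(p <- GG n) `|Y0 N p w| by rewrite mulr_sumr.
  have := h1 n; have := h2 n; have := h3 n; have := h4 n.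
  have tn := t0 n; set t := 2 ^+ n in tn *.
  set S1 := \sum_(k <- GG n) _; set S2 := \sum_(k <- GG n) _.
  set S3 := \sum_(k <- GG n) _; set S4 := \sum_(k <- GG n) _.
  set S := \sum_(k <- GG n) `|Y0 N k w|.
  move=> e1 e2 e3 e4.
  have e5 := ler_norm (D1 + D2 + D3 + D4 + 2 * (1 + ce)); rewrite -/D in e5.
  have D0 : 0 <= D by exact: normr_ge0.
  rewrite [leLHS](_ : _ = (S4 / t + S3 / t + S2 / t + S1 / t + 2 * (1 + ce)) / 2
    + rho * (S / t)); last by field; rewrite gt_eqF.
  by lra.
have Lb n : L n <= D / (1 - rho).
  have r1' : 0 < 1 - rho by lra.
  elim: n => [|n IH].
    rewrite /L (_ : \sum_(k <- GG 0) _ = 0) ?mul0r.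
      by apply: divr_ge0; [exact: normr_ge0|exact: ltW].
    by rewrite /GG expn0 expn1 big_nat1 /Y0 ar1 normr0.
  apply: le_trans (rec n) _.
  apply: (@le_trans _ _ (rho * (D / (1 - rho)) + D)).
    by rewrite lerD2r ler_wpM2l.
  by apply: eq_ler; field; rewrite gt_eqF.
by exists (D / (1 - rho)) => n; rewrite -ler_pdivrMr// Lb.
Qed.

(* The law of the even child is not degenerate, and it is not carried by {r, -r}
   whatever the sign of a mother at distance |r| from 0. *)
Hypothesis Hne : forall x r, ~ {ae P, forall w,
  csel false (N 1%N w) * x + esel false (N 1%N w) = r}.
Hypothesis Hsq : forall r, r != 0 -> ~ {ae P, forall w,
  (csel false (N 1%N w) * r + esel false (N 1%N w)) ^+ 2 = r ^+ 2 /\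
  (csel false (N 1%N w) * - r + esel false (N 1%N w)) ^+ 2 = r ^+ 2}.

Let hw2 (x : R) := hw x * hw x.
Let psi1 (y : R) := hw y + Top hw y.
Let psi2 (y : R) := hw2 y + Top hw2 y.
(** This is the minimum over m of E[(u_1 - m)^2 + (u_2 - m)^2], where u_1 and u_2 are the values of
    [hw] at the even child and even grandchild of a node in state x: the expression is Top psi2 - 2
    m Top psi1 + 2 m^2, minimal at m = Top psi1 / 2. *)
Let spread (x : R) := Top psi2 x - Top psi1 x ^+ 2 / 2.

Let BL1 : BL (@hw R) 1 := BL_hw.
Let BL2 := BLM BL1 BL1.
Let BLp1 := BLD BL1 (BL_Top BL1).
Let BLp2 : BL psi2 _ := BLD BL2 (BL_Top BL2).

Let Top_sqr_dist m x : Top (fun y => (hw y - m) ^+ 2) x =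
  Top hw2 x - 2 * m * Top hw x + m ^+ 2.
Proof.
rewrite /Top.
have i1 := i_step 1 x BL1; have i2 := i_step 1 x BL2.
rewrite -ExZ// -ExB//; last exact: integZ.
rewrite -[m ^+ 2](Ex_cst P) -ExD//; last first.
- exact: integ_cst.
- by apply: integB => //; exact: integZ.
by apply: eq_Ex => w; rewrite /hw2; ring.
Qed.

Let spreadE x m : Top psi1 x = 2 * m ->
  spread x = Top (fun y => (hw y - m) ^+ 2 + Top (fun z => (hw z - m) ^+ 2) y) x.
Proof.
move=> mE; rewrite /spread mE.
transitivity (Top psi2 x - 2 * m * Top psi1 x + 2 * m ^+ 2); first by rewrite mE; field.
rewrite /Top; have i1 := i_step 1 x BLp1; have i2 := i_step 1 x BLp2.
rewrite -ExZ// -ExB//; last exact: integZ.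
rewrite -[2 * m ^+ 2](Ex_cst P) -ExD//; last first.
- exact: integ_cst.
- by apply: integB => //; exact: integZ.
apply: eq_Ex => w; rewrite -/(Top (fun z => (hw z - m) ^+ 2) _) Top_sqr_dist.
rewrite /psi1 /psi2 /hw2; ring.
Qed.

(** If the spread vanished, [hw] would be equal to m almost surely at the child and again at the
    grandchild. By [Hne] the child takes two distinct admissible values; they have the same square,
    hence are y and -y with y nonzero. From both of them the next child has square y^2 almost
    surely, which [Hsq] forbids. *)
Let spread_gt0 x : 0 < spread x.
Proof.
rewrite ltNge; apply/negP => s0.
pose m := Top psi1 x / 2.
have mE : Top psi1 x = 2 * m by rewrite /m; field.
pose phi y := (hw y - m) ^+ 2 + Top (fun z => (hw z - m) ^+ 2) y.
have sq0 (y : R) : 0 <= (hw y - m) ^+ 2 by exact: sqr_ge0.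
have phi0 y : 0 <= phi y by rewrite addr_ge0//; exact: Top_ge0.
have T0 (F : R -> R) y c : BL F c -> (forall z, 0 <= F z) -> Top F y <= 0 ->
    {ae P, forall w, F (step 1 w y) = 0}.
  move=> bF F0 TF; apply: Ex_eq0 => //; first exact: i_step bF.
  by apply/eqP; rewrite eq_le TF Ex_ge0.
have bm : BL (fun=> - m) `|m|.
  by split=> [y|y z]; rewrite ?normrN// subrr normr0 mulr_ge0.
have bhm := BLD BL1 bm.
have bsq : BL (fun y => (hw y - m) ^+ 2) _ := BLM bhm bhm.
have bphi : BL phi _ := BLD bsq (BL_Top bsq).
have good : {ae P, forall w, phi (step 1 w x) = 0}.
  by apply: T0 bphi phi0 _; rewrite -/(spread x) -(spreadE mE).
have split0 y : phi y = 0 -> hw y = m /\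
    {ae P, forall w, hw (step 1 w y) = m}.
  move=> /eqP; rewrite paddr_eq0//; last exact: Top_ge0.
  rewrite sqrf_eq0 subr_eq0 => /andP[/eqP-> /eqP TF]; split => //.
  have := T0 _ y _ bsq sq0; rewrite TF => /(_ (lexx _)).
  by apply: filterS => w /eqP; rewrite sqrf_eq0 subr_eq0 => /eqP.
have [w1 /split0[hm1 ae1]] := ae_event good.
pose y1 := step 1 w1 x.
(* Otherwise the child would be equal to [y1] almost surely, against [Hne]. *)
have [w2 [/split0[hm2 ae2] yy]] : exists w2, phi (step 1 w2 x) = 0 /\ step 1 w2 x <> y1.
  apply: contrapT => /forallNP h; apply: (Hne (x := x) (r := y1)).
  apply: filterS good => w gw; apply: contrapT => ny.
  by apply: (h w); split.
have sq12 : step 1 w2 x ^+ 2 = y1 ^+ 2 by apply: hw_inj_sqr; rewrite hm2 -hm1.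
have y2E : step 1 w2 x = - y1.
  by move/eqP : sq12; rewrite eqf_sqr => /orP[/eqP|/eqP].
rewrite y2E in ae2.
apply: (Hsq (r := y1)).
  by apply/eqP => y10; apply: yy; rewrite y2E y10 oppr0.
apply: filterS2 ae1 ae2 => w a1 a2.
by split; apply: hw_inj_sqr; rewrite -/(step 1 w _) -?/(step 1 w (- y1)) ?a1 ?a2 -hm1.
Qed.

Let spread_min (K : R) : 0 <= K ->
  exists2 kappa, 0 < kappa & forall x, `|x| <= K -> kappa <= spread x.
Proof.
move=> K0; have KK : - K <= K by lra.
have cs : continuous spread.
  move=> x; apply: cvgB; first exact: (BL_continuous (BL_Top BLp2)).
  apply: cvgM; last exact: cvg_cst.
  by apply: cvgM; exact: (BL_continuous (BL_Top BLp1)).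
have [|c _ hc] := @EVT_min R spread (- K) K KK.
  by apply: continuous_subspaceT.
exists (spread c); first exact: spread_gt0.
move=> x xK; apply: hc.
by rewrite in_itv/= -ler_norml.
Qed.

(** The bound is uniform in m because m will later be the empirical mean of u, which depends on n
    and on the trajectory. The sum of squares is replaced by its conditional expectation given the
    mothers, up to four fluctuations that are negligible by the kernel laws of large numbers. *)
Lemma spread_lower_bound : {ae P, forall w, exists2 kappa, 0 < kappa &
  \forall n \near \oo, forall m, 0 <= m <= 1 -> kappa * 2 ^+ n <=
    \sum_(p <- GG n) ((hw (Y0 N p.*2 w) - m) ^+ 2 + (hw (Y0 N p.*2.*2 w) - m) ^+ 2)}.
Proof.
have l1 := kernel_lln_even BL2.
have l2 := kernel_lln_all BLp2.
have l3 := kernel_lln_even BL1.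
have l4 := kernel_lln_all BLp1.
apply: filterS2 tightness (filterI (filterI l1 l2) (filterI l3 l4)).
move=> w [M tM] [[c1 c2] [c3 c4]].
have M0 : 0 <= M.
  by have := tM 0%N; rewrite expr0 mulr1; apply: le_trans; exact: sumr_ge0.
(* With an average of |Y| at most [M], the affine minorant of the spread built below loses less than
   half of [kappa] on average, since M / K < 1 / 2. *)
pose K := 2 * M + 1.
have K0 : 0 < K by rewrite /K; lra.
have [kappa k0 kK] := spread_min (ltW K0).
exists (kappa / 4); first by rewrite divr_gt0.
(* The four fluctuations enter with coefficients 1, 1, 2 m and 2 m, at most 6 in total; they cost at
   most 6 kappa / 24 = kappa / 4 out of kappa / 2. *)
pose de := kappa / 24.
have de0 : 0 < de by rewrite divr_gt0.
have small (u : nat -> R) : u n / 2 ^+ n @[n --> \oo] --> 0 ->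
    \forall n \near \oo, `|u n| <= de * 2 ^+ n.
  move=> /cvgr0Pnorm_lt /(_ _ de0); apply: filterS => n.
  have t0 : 0 < 2 ^+ n :> R by rewrite exprn_gt0.
  by rewrite normrM normfV (gtr0_norm t0) ltr_pdivrMr// => /ltW.
have n1 := small _ c1; have n2 := small _ c2.
have n3 := small _ c3; have n4 := small _ c4.
apply: filterS3 n1 n2 (filterI n3 n4) => n s1 s2 [s3 s4] m /andP[m0 m1].
(* An affine version of Markov's inequality: the left side is at most [kappa] where |Y| <= K and
   nonpositive beyond [K], so no count of the nodes inside [-K, K] is required. *)
have low p : kappa - kappa / K * `|Y0 N p w| <=
    Top psi2 (Y0 N p w) - 2 * m * Top psi1 (Y0 N p w) + 2 * m ^+ 2.
  apply: (@le_trans _ _ (spread (Y0 N p w))); last first.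
    rewrite /spread; set A := Top psi2 _; set B := Top psi1 _.
    by have := sqr_ge0 (B - 2 * m); nra.
  case: (lerP `|Y0 N p w| K) => hK.
    by apply: le_trans (kK _ hK); rewrite gerBl mulr_ge0// divr_ge0// ltW.
  apply: (@le_trans _ _ 0); last exact: ltW (spread_gt0 _).
  by rewrite subr_le0 mulrAC ler_pdivlMr// ler_wpM2l ?ltW.
have slow : kappa / 2 * 2 ^+ n <= \sum_(p <- GG n)
    (Top psi2 (Y0 N p w) - 2 * m * Top psi1 (Y0 N p w) + 2 * m ^+ 2).
  apply: (@le_trans _ _ (\sum_(p <- GG n) (kappa - kappa / K * `|Y0 N p w|))).
    rewrite sumrB sumr_GG_const -mulr_sumr lerBrDr.
    apply: (@le_trans _ _ (kappa / 2 * 2 ^+ n + kappa / K * (M * 2 ^+ n))).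
      by rewrite lerD2l ler_wpM2l// divr_ge0// ltW.
    rewrite mulrA -mulrDl ler_wpM2r ?exprn_ge0//.
    rewrite -subr_ge0 (_ : _ - _ = kappa / (2 * K)) ?divr_ge0 ?mulr_ge0 ?ltW//.
    by rewrite /K; field; rewrite gt_eqF// -/K.
  by apply: ler_sum => p _; exact: low.
have -> : \sum_(p <- GG n) ((hw (Y0 N p.*2 w) - m) ^+ 2 + (hw (Y0 N p.*2.*2 w) - m) ^+ 2) =
  \sum_(p <- GG n) (Top psi2 (Y0 N p w) - 2 * m * Top psi1 (Y0 N p w) + 2 * m ^+ 2) +
  \sum_(p <- GG n) (hw2 (Y0 N p.*2.*2 w) - Top hw2 (Y0 N p.*2 w)) +
  \sum_(p <- GG n) (psi2 (Y0 N p.*2 w) - Top psi2 (Y0 N p w)) -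
  2 * m * \sum_(p <- GG n) (hw (Y0 N p.*2.*2 w) - Top hw (Y0 N p.*2 w)) -
  2 * m * \sum_(p <- GG n) (psi1 (Y0 N p.*2 w) - Top psi1 (Y0 N p w)).
  rewrite !mulr_sumr -!sumrN -!big_split/=; apply: eq_bigr => p _.
  rewrite /psi1 /psi2 /hw2; ring.
move: s1 s2 s3 s4; rewrite /de.
set S1 := \sum_(p <- _) _; set S2 := \sum_(p <- _) _.
set S3 := \sum_(p <- _) _; set S4 := \sum_(p <- _) _.
set S0 := \sum_(p <- _) _ in slow *.
have t0 : 0 < 2 ^+ n :> R by rewrite exprn_gt0.
set t := 2 ^+ n in slow t0 *.
rewrite !ler_norml => /andP[a1 _] /andP[a2 _] /andP[_ a3] /andP[_ a4].
have kt : 0 < kappa * t by rewrite mulr_gt0.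
have b3 : 2 * m * S3 <= 2 * (kappa / 24 * t).
  apply: (@le_trans _ _ (2 * m * (kappa / 24 * t))); first by rewrite ler_wpM2l ?mulr_ge0.
  by nra.
have b4 : 2 * m * S4 <= 2 * (kappa / 24 * t).
  apply: (@le_trans _ _ (2 * m * (kappa / 24 * t))); first by rewrite ler_wpM2l ?mulr_ge0.
  by nra.
by lra.
Qed.

(** As [hw] is 1-Lipschitz, replacing [Y0 k] by [Y0 k + x * Apath k] changes a squared distance by
    at most 2 |x| |Apath k|. The average of |Apath| tends to 0: it is [remainder] for the constant
    noise function 1. *)
Lemma empirical_spread : {ae P, forall w, forall x, exists2 kappa, 0 < kappa &
  \forall n \near \oo, forall m, 0 <= m <= 1 -> kappa * 2 ^+ n <=
    \sum_(k <- TT n) (hw (Y0 N k w + x * Apath N k w) - m) ^+ 2}.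
Proof.
have L1 k : (1 <= k)%N -> L2 P (fun w => (fun=> 1 : R) (N k w)) by move=> _; exact: L2_cst.
have E1 k : (1 <= k)%N -> Ex P (fun w => (fun=> 1 : R) (N k w) ^+ 2) = 1.
  by move=> _; rewrite -[RHS](Ex_cst P); apply: eq_Ex => w; rewrite expr1n.
have rem := remainder_summable mN indN rho1 L2c Eabsc (measurable_cst (1 : R)) L1 E1.
apply: filterS2 spread_lower_bound rem => w [kappa k0 hk] [M rM] x.
have r0 := bounded_series_cvg0 (remainder_ge0 N (fun=> 1) ^~ w) rM.
exists (kappa / 8); first by rewrite divr_gt0.
pose A n := \sum_(k <- GG n) `|Apath N k w|.
have rA n : remainder N (fun=> 1) n w = A n / 2 ^+ n.
  by rewrite /remainder; congr (_ / _); apply: eq_bigr => k _; rewrite normr1 mulr1.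
(* This makes 2 |x| de at most kappa / 12. Generations n + 1 and n + 2 then lose (2 + 4) kappa / 12
   = kappa / 2 times 2^n, and the remaining kappa / 2 times 2^n is kappa / 8 times 2^(n+2). *)
pose de := kappa / (24 * (1 + `|x|)).
have x1 : 0 < 1 + `|x| by rewrite ltr_pwDl.
have de0 : 0 < de by rewrite divr_gt0// mulr_gt0.
have smallA : \forall n \near \oo, A n <= de * 2 ^+ n.
  move/cvgr0Pnorm_lt : r0 => /(_ _ de0); apply: filterS => n.
  have t0 : 0 < 2 ^+ n :> R by rewrite exprn_gt0.
  by rewrite ger0_norm ?remainder_ge0// rA ltr_pdivrMr// => /ltW.
suff : \forall n \near \oo, forall m, 0 <= m <= 1 -> kappa / 8 * 2 ^+ n.+2 <=
    \sum_(k <- TT n.+2) (hw (Y0 N k w + x * Apath N k w) - m) ^+ 2.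
  move=> [n0 _ h]; exists n0.+2 => // n /= nn0.
  have e : n = n.-2.+2 by lia.
  by rewrite e; apply: h => /=; lia.
have sA1 : \forall n \near \oo, A n.+1 <= de * 2 ^+ n.+1.
  by case: smallA => n0 _ h; exists n0 => // n /= n0n; apply: h => /=; lia.
have sA2 : \forall n \near \oo, A n.+2 <= de * 2 ^+ n.+2.
  by case: smallA => n0 _ h; exists n0 => // n /= n0n; apply: h => /=; lia.
apply: filterS3 hk sA1 sA2 => n h h1 h2 m m01; have h0 := h m m01.
pose F k := (hw (Y0 N k w + x * Apath N k w) - m) ^+ 2.
have F0 k : 0 <= F k by exact: sqr_ge0.
apply: le_trans (ler_sum_GG_TT n F0).
have dist k : (hw (Y0 N k w) - m) ^+ 2 <= F k + 2 * `|x| * `|Apath N k w|.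
  have := BL_hw.2 (Y0 N k w) (Y0 N k w + x * Apath N k w).
  rewrite mul1r opprD addNKr normrN normrM /F.
  have := hw_gt0 (Y0 N k w); have := hw_le1 (Y0 N k w).
  have := hw_gt0 (Y0 N k w + x * Apath N k w).
  have := hw_le1 (Y0 N k w + x * Apath N k w).
  set u := hw _; set v := hw _; case/andP: m01 => m0 m1 u1 u0 v1 v0 uv.
  rewrite -lerBlDl (_ : _ - _ = (v - u) * ((v - m) + (u - m))); last by ring.
  apply: le_trans (ler_norm _) _; rewrite normrM mulrC -mulrA.
  apply: ler_pM => //; rewrite ler_norml; apply/andP; split; lra.
have sum1 : \sum_(p <- GG n) (hw (Y0 N p.*2 w) - m) ^+ 2 <=
    \sum_(p <- GG n) F p.*2 + 2 * `|x| * A n.+1.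
  apply: le_trans; first by apply: ler_sum => p _; exact: (dist p.*2).
  rewrite big_split/= -mulr_sumr lerD2l ler_wpM2l ?mulr_ge0//.
  exact: ler_sum_GG_even.
have sum2 : \sum_(p <- GG n) (hw (Y0 N p.*2.*2 w) - m) ^+ 2 <=
    \sum_(p <- GG n) F p.*2.*2 + 2 * `|x| * A n.+2.
  apply: le_trans; first by apply: ler_sum => p _; exact: (dist p.*2.*2).
  rewrite big_split/= -mulr_sumr lerD2l ler_wpM2l ?mulr_ge0//.
  apply: (@le_trans _ _ (\sum_(q <- GG n.+1) `|Apath N q.*2 w|)).
    exact: (ler_sum_GG_even (F := fun q => `|Apath N q.*2 w|)).
  exact: ler_sum_GG_even.
rewrite big_split/= in h0.
have xd : 2 * `|x| * de <= kappa / 12.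
  rewrite /de mulrA ler_pdivrMr ?mulr_gt0//.
  by have := normr_ge0 x; nra.
have t0 : 0 < 2 ^+ n :> R by rewrite exprn_gt0.
have x2 : 0 <= 2 * `|x| by rewrite mulr_ge0.
have b1 := ler_wpM2l x2 h1; have b2 := ler_wpM2l x2 h2.
rewrite !exprS in b1 b2 *.
set t := 2 ^+ n in t0 h0 b1 b2 *.
have := ler_wpM2r (ltW t0) xd.
rewrite !mulrA in b1 b2 *.
by nra.
Qed.

End transition.

(** * Gram matrices *)

Section two_by_two.
Context {R : realType}.

Lemma sum2 (F : 'I_2 -> R) : \sum_i F i = F 0 + F 1.
Proof. by rewrite !big_ord_recl big_ord0 addr0; congr (F _ + F _); apply/val_inj. Qed.

Lemma ord2_ind (Q : 'I_2 -> Prop) : Q 0 -> Q 1 -> forall i, Q i.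
Proof.
move=> Q0 Q1 [[|[|//]] h].
- by rewrite (_ : Ordinal h = 0)//; apply/val_inj.
- by rewrite (_ : Ordinal h = 1)//; apply/val_inj.
Qed.

Definition det2 (Q : 'M[R]_2) : R := Q 0 0 * Q 1 1 - Q 0 1 * Q 1 0.

Lemma det2_unit (Q : 'M[R]_2) : det2 Q != 0 -> Q \in unitmx.
Proof.
move=> d0; pose W : 'M[R]_2 := \matrix_(i, j)
  ((if i == 0 then (if j == 0 then Q 1 1 else - Q 0 1)
    else (if j == 0 then - Q 1 0 else Q 0 0)) / det2 Q).
suff /mulmx1_unit[] : Q *m W = 1%:M by [].
have dE : det2 Q = Q 0 0 * Q 1 1 - Q 0 1 * Q 1 0 by [].
apply/matrixP; apply: ord2_ind; apply: ord2_ind; rewrite !mxE sum2 !mxE /=.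
all: by rewrite -?dE ?mulr1n ?mulr0n; rewrite dE; field; rewrite -dE.
Qed.

(** Cramer's rule: in dimension two the cofactors are entries of [Q] up to sign, hence bounded by
    [B]. *)
Lemma solve2_bound (Q : 'M[R]_2) (y : 'cV[R]_2) (B de : R) : 0 < de ->
  de <= det2 Q -> (forall i j, `|Q i j| <= B) -> forall i,
  `|(invmx Q *m y) i 0| <= B / de * (`|y 0 0| + `|y 1 0|).
Proof.
move=> de0 dQ QB.
have d0 : 0 < det2 Q by exact: lt_le_trans dQ.
have Qu : Q \in unitmx by apply: det2_unit; rewrite gt_eqF.
have B0 : 0 <= B by exact: le_trans (QB 0 0).
set v := invmx Q *m y.
have Qv : Q *m v = y by rewrite mulKVmx.
have y0 : y 0 0 = Q 0 0 * v 0 0 + Q 0 1 * v 1 0 by rewrite -Qv mxE sum2.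
have y1 : y 1 0 = Q 1 0 * v 0 0 + Q 1 1 * v 1 0 by rewrite -Qv mxE sum2.
have bound z p q : det2 Q * z = p * y 0 0 - q * y 1 0 -> `|p| <= B -> `|q| <= B ->
    `|z| <= B / de * (`|y 0 0| + `|y 1 0|).
  move=> zE pB qB; rewrite mulrAC ler_pdivlMr//.
  apply: (@le_trans _ _ (`|z| * det2 Q)); first exact: ler_wpM2l.
  rewrite -[det2 Q]gtr0_norm// -normrM mulrC zE mulrDr.
  apply: le_trans (ler_normB _ _) _; rewrite !normrM.
  by apply: lerD; exact: ler_wpM2r.
apply: ord2_ind.
- by apply: (bound _ (Q 1 1) (Q 0 1)) => //; rewrite /det2 y0 y1; ring.
- apply: (bound _ (- Q 1 0) (- Q 0 0)); rewrite ?normrN//.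
  by rewrite /det2 y0 y1; ring.
Qed.

Lemma col2E (u v : R) : (col2 u v 0 0 = u) * (col2 u v 1 0 = v).
Proof. by split; rewrite mxE. Qed.

End two_by_two.

Section recursions.
Context {R : realType}.

(* (A + U)^2 / 2^(l+1) <= (3/4) A^2 / 2^l + (3/2) U^2 / 2^l *)
Lemma prefix_squares (U : nat -> R) (M : R) :
  (forall n, \sum_(j < n) U j ^+ 2 / 2 ^+ j <= M * n.+1%:R) ->
  forall n, \sum_(l < n) (\sum_(j < l) U j) ^+ 2 / 2 ^+ l <= 6 * M * n.+1%:R.
Proof.
move=> UM n.
pose z l := (\sum_(j < l) U j) ^+ 2 / 2 ^+ l.
have z0 l : 0 <= z l by rewrite divr_ge0 ?sqr_ge0// exprn_ge0.
have step l : z l.+1 <= 3 / 4 * z l + 3 / 2 * (U l ^+ 2 / 2 ^+ l).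
  rewrite /z big_ord_recr/=; set a := \sum_(j < l) _; set b := U l.
  rewrite (exprS 2); set t := 2 ^+ l.
  have t0 : 0 < t by rewrite exprn_gt0.
  rewrite -subr_ge0 (_ : _ - _ = (a - 2 * b) ^+ 2 / (4 * t)); last first.
    by field; rewrite gt_eqF.
  by rewrite divr_ge0 ?sqr_ge0// mulr_ge0// ltW.
(* Summing the recursion reproduces the same sum with factor 3/4 < 1; absorbing it leaves a quarter
   of the sum on the left, and 4 * 3/2 = 6. *)
have W : \sum_(l < n.+1) z l <= 3 / 4 * \sum_(l < n) z l + 3 / 2 * (M * n.+1%:R).
  rewrite big_ord_recl {1}/z big_ord0 expr0n mul0r add0r.
  apply: (@le_trans _ _ (\sum_(l < n) (3 / 4 * z l + 3 / 2 * (U l ^+ 2 / 2 ^+ l)))).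
    by apply: ler_sum => l _; exact: step.
  rewrite big_split/= -!mulr_sumr lerD2l; by apply: ler_wpM2l => //; exact: UM.
have W2 : \sum_(l < n) z l <= \sum_(l < n.+1) z l by rewrite big_ord_recr/= lerDl.
rewrite -/(\sum_(l < n) z l); lra.
Qed.

(** The estimators are controlled only once the normalizing matrices are known to be well
    conditioned; the finitely many earlier terms go into the constant. *)
Lemma eventually_sum_le (f g : nat -> R) (C : R) n0 :
  (forall n, 0 <= f n) -> (forall n, 0 <= g n) ->
  (forall n, (n0 <= n)%N -> f n <= g n) ->
  (forall n, \sum_(l < n) g l <= C * n.+1%:R) ->
  exists C', forall n, \sum_(l < n) f l <= C' * n.+1%:R.
Proof.
move=> f0 g0 fg gC; exists (C + \sum_(l < n0) f l) => n.
have S0 : 0 <= \sum_(l < n0) f l by exact: sumr_ge0.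
rewrite mulrDl; apply: (@le_trans _ _ (C * n.+1%:R + \sum_(l < n0) f l)); last first.
  by rewrite lerD2l ler_peMr// ler1n.
apply: (@le_trans _ _ (\sum_(l < n) g l + \sum_(l < n0) f l)); last by rewrite lerD2r.
elim: n => [|n IH]; first by rewrite !big_ord0 add0r.
case: (leqP n0 n) => h; first by rewrite !big_ord_recr/= addrAC lerD// fg.
apply: (@le_trans _ _ (\sum_(l < n0) f l)); last by rewrite lerDr sumr_ge0.
rewrite -(subnKC h) big_split_ord/= lerDl; exact: sumr_ge0.
Qed.

End recursions.

Section gram_matrices.
Context {R : realType}.
Variable x : nat -> R.

Lemma size_TT n : (size (TT n) = 2 ^ n.+1 - 1)%N.
Proof. by rewrite size_iota. Qed.

Lemma size_TT_bounds n : 2 ^+ n <= (size (TT n))%:R :> R /\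
  (size (TT n))%:R <= 2 ^+ n.+1 :> R.
Proof.
have h : (1 <= 2 ^ n)%N by rewrite expn_gt0.
rewrite size_TT -!natrX !ler_nat expnS; lia.
Qed.

Lemma ler_sum_TT_const (F : nat -> R) n : (forall k, `|F k| <= 1) ->
  `|\sum_(k <- TT n) F k| <= 2 ^+ n.+1.
Proof.
move=> F1; apply: le_trans (ler_norm_sum _ _ _) _.
apply: le_trans (size_TT_bounds n).2.
apply: le_trans (ler_sum _ (fun k _ => F1 k)) _.
by rewrite big_const_seq count_predT iter_addr_0.
Qed.

Lemma S_mxE n i j : S_mx x n i j = \sum_(k <- TT n) hw (x k) * (Phi x k i 0 * Phi x k j 0).
Proof.
by rewrite summxE; apply: eq_bigr => k _; rewrite !mxE big_ord1 !mxE.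
Qed.

Lemma Q_mxE n i j : Q_mx x n i j = \sum_(k <- TT n) hw (x k) ^+ 2 * (psi x k i 0 * psi x k j 0).
Proof.
by rewrite summxE; apply: eq_bigr => k _; rewrite !mxE big_ord1 !mxE exprVn.
Qed.

Let u k := hw (x k).
Let xu k : x k ^+ 2 * u k = 1 - u k.
Proof. by rewrite /u /hw; field; rewrite gt_eqF// ltr_pwDl ?sqr_ge0. Qed.

(** The normalized vectors [hw * psi] are (1 - u, u), so [Q_mx] is the Gram matrix of 1 - u and u,
    with the same determinant as that of the constant 1 and u. *)
Lemma det2_Q n : det2 (Q_mx x n) =
  (size (TT n))%:R * (\sum_(k <- TT n) u k ^+ 2) - (\sum_(k <- TT n) u k) ^+ 2.
Proof.
rewrite /det2 !Q_mxE.
have -> : \sum_(k <- TT n) hw (x k) ^+ 2 * (psi x k 0 0 * psi x k 0 0) =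
    (size (TT n))%:R - 2 * (\sum_(k <- TT n) u k) + \sum_(k <- TT n) u k ^+ 2.
  have -> : (size (TT n))%:R = \sum_(k <- TT n) (1 : R).
    by rewrite big_const_seq count_predT iter_addr_0.
  rewrite mulr_sumr -sumrB -big_split/=; apply: eq_bigr => k _.
  have := xu k; rewrite !mxE/= -/(u k) => h.
  rewrite (_ : _ * _ = (x k ^+ 2 * u k) ^+ 2); last by ring.
  by rewrite h; ring.
have e01 : \sum_(k <- TT n) hw (x k) ^+ 2 * (psi x k 0 0 * psi x k 1 0) =
    \sum_(k <- TT n) u k - \sum_(k <- TT n) u k ^+ 2.
  rewrite -sumrB; apply: eq_bigr => k _.
  have := xu k; rewrite !mxE/= -/(u k) => h.
  rewrite (_ : _ * _ = (x k ^+ 2 * u k) * u k); last by ring.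
  by rewrite h; ring.
have e10 : \sum_(k <- TT n) hw (x k) ^+ 2 * (psi x k 1 0 * psi x k 0 0) =
    \sum_(k <- TT n) u k - \sum_(k <- TT n) u k ^+ 2.
  by rewrite -e01; apply: eq_bigr => k _; congr (_ * _); rewrite mulrC.
rewrite e01 e10.
have -> : \sum_(k <- TT n) hw (x k) ^+ 2 * (psi x k 1 0 * psi x k 1 0) =
    \sum_(k <- TT n) u k ^+ 2.
  by apply: eq_bigr => k _; rewrite !mxE/= !mulr1.
ring.
Qed.

(** For m the empirical mean of u, which lies in [0, 1], the sum of squares is the determinant
    divided by the size of [TT n]; that size supplies the second factor 2^n. *)
Lemma det2_Q_lower (kappa : R) n :
  (forall m, 0 <= m <= 1 -> kappa * 2 ^+ n <= \sum_(k <- TT n) (u k - m) ^+ 2) ->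
  0 < kappa -> kappa * (2 ^+ n) ^+ 2 <= det2 (Q_mx x n).
Proof.
move=> hk k0; rewrite det2_Q.
have [s1 s2] := size_TT_bounds n.
set s := (size (TT n))%:R in s1 s2 *.
set A := \sum_(k <- TT n) u k; set B := \sum_(k <- TT n) u k ^+ 2.
have t0 : 0 < 2 ^+ n :> R by rewrite exprn_gt0.
have s0 : 0 < s by exact: lt_le_trans s1.
have A0 : 0 <= A by apply: sumr_ge0 => k _; exact: ltW (hw_gt0 _).
have As : A <= s.
  have -> : s = \sum_(k <- TT n) (1 : R).
    by rewrite /s big_const_seq count_predT iter_addr_0.
  by apply: ler_sum => k _; exact: hw_le1.
have m01 : 0 <= A / s <= 1.
  by rewrite divr_ge0 ?(ltW s0)//= ler_pdivrMr// mul1r.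
have := hk _ m01.
have -> : \sum_(k <- TT n) (u k - A / s) ^+ 2 = B - 2 * (A / s) * A + s * (A / s) ^+ 2.
  have -> : s * (A / s) ^+ 2 = \sum_(k <- TT n) (A / s) ^+ 2.
    by rewrite big_const_seq count_predT iter_addr_0 mulr_natl.
  rewrite mulr_sumr -sumrB -big_split/=; apply: eq_bigr => k _; ring.
have -> : B - 2 * (A / s) * A + s * (A / s) ^+ 2 = (s * B - A ^+ 2) / s.
  by field; rewrite gt_eqF.
rewrite ler_pdivlMr// => h; apply: le_trans h.
by rewrite expr2 mulrA ler_wpM2l// mulr_ge0// ltW.
Qed.

Let pair_sum (s : seq nat) (p q r : nat -> R) :
  \sum_(k <- s) \sum_(l <- s) (p k * r l - 2 * (q k * q l) + r k * p l) =
  2 * ((\sum_(k <- s) p k) * (\sum_(k <- s) r k) - (\sum_(k <- s) q k) ^+ 2).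
Proof.
set A := \sum_(k <- s) p k; set B := \sum_(k <- s) r k; set C := \sum_(k <- s) q k.
transitivity (\sum_(k <- s) (p k * B - 2 * q k * C + r k * A)).
  apply: eq_bigr => k _; rewrite /A /B /C !mulr_sumr -sumrB -big_split/=.
  by apply: eq_bigr => l _; ring.
rewrite big_split sumrB/= -!mulr_suml -mulr_sumr -/A -/B -/C; ring.
Qed.

(** By Lagrange's identity [pair_sum], both determinants are half a double sum over pairs k, l, with
    terms (u_k - u_l)^2 for [Q_mx] and (x_k - x_l)^2 u_k u_l for [S_mx]. The first is the second
    times (x_k + x_l)^2 u_k u_l, and this factor is at most 2 because x^2 u = 1 - u. *)
Lemma det2_S n : det2 (Q_mx x n) <= 2 * det2 (S_mx x n).
Proof.
rewrite det2_Q /det2 !S_mxE.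
have e10 : \sum_(k <- TT n) hw (x k) * (Phi x k 1 0 * Phi x k 0 0) =
    \sum_(k <- TT n) hw (x k) * (Phi x k 0 0 * Phi x k 1 0).
  by apply: eq_bigr => k _; congr (_ * _); rewrite mulrC.
rewrite e10 -expr2.
have -> : \sum_(k <- TT n) hw (x k) * (Phi x k 0 0 * Phi x k 0 0) =
  \sum_(k <- TT n) x k ^+ 2 * u k by apply: eq_bigr => k _; rewrite !mxE/= -/(u k); ring.
have -> : \sum_(k <- TT n) hw (x k) * (Phi x k 0 0 * Phi x k 1 0) =
  \sum_(k <- TT n) x k * u k by apply: eq_bigr => k _; rewrite !mxE/= -/(u k); ring.
have -> : \sum_(k <- TT n) hw (x k) * (Phi x k 1 0 * Phi x k 1 0) =
  \sum_(k <- TT n) u k by apply: eq_bigr => k _; rewrite !mxE/= -/(u k); ring.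
have -> : (size (TT n))%:R = \sum_(k <- TT n) (1 : R).
  by rewrite big_const_seq count_predT iter_addr_0.
have := pair_sum (TT n) (fun=> 1) u (fun k => u k ^+ 2).
have := pair_sum (TT n) (fun k => x k ^+ 2 * u k) (fun k => x k * u k) u.
set E1 := \sum_(k <- _) \sum_(l <- _) _; set E2 := \sum_(k <- _) \sum_(l <- _) _.
move=> h1 h2.
suff : E2 <= 2 * E1 by rewrite h1 h2; lra.
rewrite /E1 mulr_sumr; apply: ler_sum => k _; rewrite mulr_sumr; apply: ler_sum => l _.
have uk : 0 < u k := hw_gt0 _; have ul : 0 < u l := hw_gt0 _.
have hk := xu k; have hl := xu l.
have e : u k - u l = (x l - x k) * (x l + x k) * (u k * u l).
  transitivity (u k * (x l ^+ 2 * u l + u l) - u l * (x k ^+ 2 * u k + u k)).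
    by rewrite hk hl; ring.
  ring.
rewrite (_ : 1 * u l ^+ 2 - _ + _ = (u k - u l) ^+ 2); last by ring.
rewrite (_ : _ - _ + _ = (x l - x k) ^+ 2 * (u k * u l)); last by ring.
have key : (x l + x k) ^+ 2 * (u k * u l) <= 2.
  have : (x l + x k) ^+ 2 <= 2 * (x l ^+ 2 + x k ^+ 2).
    by have := sqr_ge0 (x l - x k); nra.
  move=> /(ler_wpM2r (ltW (mulr_gt0 uk ul))) h; apply: le_trans h _.
  rewrite (_ : 2 * _ * _ = 2 * (u k * (x l ^+ 2 * u l) + u l * (x k ^+ 2 * u k))); last by ring.
  by rewrite hk hl; have := hw_le1 (x k); have := hw_le1 (x l); rewrite -/(u k) -/(u l); nra.
rewrite e (_ : _ ^+ 2 = ((x l - x k) ^+ 2 * (u k * u l)) * ((x l + x k) ^+ 2 * (u k * u l))); last by ring.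
rewrite [leRHS]mulrC; apply: ler_wpM2l key.
by rewrite mulr_ge0 ?sqr_ge0// mulr_ge0// ltW.
Qed.

Lemma S_mx_bound n i j : `|S_mx x n i j| <= 2 ^+ n.+1.
Proof.
rewrite S_mxE; apply: ler_sum_TT_const => k.
have uk : 0 < u k := hw_gt0 _; have u1 : u k <= 1 := hw_le1 _; have h := xu k.
move: i j; apply: ord2_ind; apply: ord2_ind; rewrite !mxE/= -/(u k).
- by rewrite mulrC -expr2 h ler_norml; apply/andP; split; lra.
- have := BL_vw.1 (x k); rewrite /vw -/(hw (x k)) -/(u k) mulr1 mulrC; exact.
- have := BL_vw.1 (x k); rewrite /vw -/(hw (x k)) -/(u k) mul1r mulrC; exact.
- by rewrite !mulr1 ler_norml; apply/andP; split; lra.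
Qed.

Lemma Q_mx_bound n i j : `|Q_mx x n i j| <= 2 ^+ n.+1.
Proof.
rewrite Q_mxE; apply: ler_sum_TT_const => k.
have uk : 0 < u k := hw_gt0 _; have u1 : u k <= 1 := hw_le1 _; have h := xu k.
have h01 : `|u k ^+ 2 * x k ^+ 2| <= 1.
  rewrite (_ : _ * _ = u k * (x k ^+ 2 * u k)); last by ring.
  by rewrite h ler_norml; apply/andP; split; nra.
move: i j; apply: ord2_ind; apply: ord2_ind; rewrite !mxE/= -/(u k) ?mulr1 ?mul1r//.
- rewrite (_ : _ * _ = (x k ^+ 2 * u k) ^+ 2); last by ring.
  by rewrite h ler_norml; apply/andP; split; nra.
- by rewrite ler_norml; apply/andP; split; nra.
Qed.

End gram_matrices.

(** * Pathwise analysis of the estimators *)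

Section limits.
Context {R : realType}.

Lemma cvg_col (v : nat -> 'cV[R]_2) (w : 'cV[R]_2) :
  (forall i, v n i 0 @[n --> \oo] --> w i 0) -> v n @[n --> \oo] --> w.
Proof.
move=> vw; apply/cvgrPdist_lt => e e0.
have /cvgrPdist_lt/(_ _ e0) h0 := vw 0; have /cvgrPdist_lt/(_ _ e0) h1 := vw 1.
apply: filterS2 h0 h1 => n a0 a1.
have [->|] := eqVneq (w - v n) 0; first by rewrite normr0.
move=> /eqP ne; have /mx_norm_neq0 : mx_norm (w - v n) != 0.
  by apply/eqP => /mx_norm_eq0.
move=> [[i j] /= E]; have -> : `|w - v n| = mx_norm (w - v n) by [].
rewrite E (ord1 j) !mxE; move: {E} i; exact: ord2_ind.
Qed.

Lemma enorm_le (v : 'cV[R]_2) : enorm v <= `|v 0 0| + `|v 1 0|.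
Proof.
rewrite /enorm sum2 -[leRHS]ger0_norm ?addr_ge0// -sqrtr_sqr ler_wsqrtr//.
rewrite -[v 0 0 ^+ 2]real_normK ?num_real// -[v 1 0 ^+ 2]real_normK ?num_real//.
by have := mulr_ge0 (normr_ge0 (v 0 0)) (normr_ge0 (v 1 0)); nra.
Qed.

Lemma cvg_nat_div_geo : n%:R / 2 ^+ n @[n --> \oo] --> (0 : R).
Proof.
have h n : (n.+1 ^ 2 <= 4 * 2 ^ n)%N.
  elim: n => // -[//|[//|n]] IH; rewrite [in leqRHS]expnS; nia.
have u0 : 4 * (n.+1%:R^-1 : R) @[n --> \oo] --> 0.
  rewrite -[X in _ --> X](mulr0 4); apply: cvgM; first exact: cvg_cst.
  exact: cvg_harmonic.
apply: (squeeze_cvgr _ (cvg_cst 0) u0); apply: nearW => n /=.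
rewrite divr_ge0 ?exprn_ge0//= ler_pdivrMr ?exprn_gt0// mulrAC ler_pdivlMr//.
rewrite -!natrX -!natrM ler_nat; have := h n; rewrite expnS expn1; nia.
Qed.

(** Passage from generations to the whole tree: the weights 2^(j-n) for j <= n have total less than
    2, and a fixed initial block is killed by 2^-n. *)
Lemma geometric_prefix_cvg0 (s : nat -> R) : s n / 2 ^+ n @[n --> \oo] --> 0 ->
  (\sum_(j < n.+1) s j) / 2 ^+ n @[n --> \oo] --> 0.
Proof.
move=> s0; apply/cvgr0Pnorm_lt => e e0.
have e4 : 0 < e / 4 by rewrite divr_gt0.
have /cvgr0Pnorm_lt/(_ _ e4) [n0 _ hs] := s0.
pose C := `|\sum_(j < n0) s j|.
have C0 : 0 <= C by exact: normr_ge0.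
have bound n : `|\sum_(j < n0 + n) s j| <= C + e / 4 * 2 ^+ (n0 + n).
  elim: n => [|n IH]; first by rewrite addn0 lerDl mulr_ge0 ?exprn_ge0// ltW.
  rewrite addnS big_ord_recr/= exprS.
  apply: le_trans (ler_normD _ _) _.
  have := hs (n0 + n)%N (leq_addr _ _).
  have t0 : 0 < 2 ^+ (n0 + n) :> R by rewrite exprn_gt0.
  by rewrite normrM normfV (gtr0_norm t0) ltr_pdivrMr// => /ltW; lra.
have geo : (2^-1 : R) ^+ n @[n --> \oo] --> 0.
  by apply: cvg_expr; rewrite gtr0_norm ?invf_lt1// ?ltr1n.
have eC : 0 < e / (4 * (C + 1)) by rewrite divr_gt0// mulr_gt0// ltr_wpDl.
have /cvgr0Pnorm_lt/(_ _ eC) [n1 _ hg] := geo.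
exists (n0 + n1)%N => // n /= nn.
have t0 : 0 < 2 ^+ n :> R by rewrite exprn_gt0.
rewrite normrM normfV (gtr0_norm t0) ltr_pdivrMr//.
have h1 : n.+1 = (n0 + (n.+1 - n0))%N by lia.
have := bound (n.+1 - n0)%N; rewrite -h1 => b; apply: le_lt_trans b _.
have := hg n; rewrite /= => /(_ ltac:(lia)).
rewrite ger0_norm ?exprn_ge0 ?invr_ge0// exprVn -div1r ltr_pdivrMr//.
rewrite mulrAC ltr_pdivlMr ?mulr_gt0 ?ltr_wpDl// mul1r exprS.
by have := mulr_gt0 e0 t0; nra.
Qed.

End limits.

(** * A fixed trajectory: from squares, spread and law of large numbers to the estimators *)

Section trajectory.
Context {R : realType}.
Variables (x : nat -> R) (theta0 : 'M[R]_2) (a b c d : R).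

(** The two components of [psi k] divided by d_k = (1 + x_k^2)^2: [false] is x^2 / d_k and [true] is
    1 / d_k. *)
Definition phi (i : bool) (y : R) : R := if i then hw y ^+ 2 else vw y ^+ 2.

(** Indices 0 and 1 are the components of [Phi k] divided by c_k, which drive the error of
    [theta_hat]. Indices 2 to 5 are the factors of the slope error and of the intercept error in the
    cross terms, for each value of [phi]. The default [hw] makes statements over all natural indices
    harmless. *)
Definition weight (i : nat) : R -> R :=
  nth hw [:: hw; vw; (fun y => phi false y * y); phi false;
            (fun y => phi true y * y); phi true] i.

Definition slope (e : bool) : R := if e then b else a.
Definition icept (e : bool) : R := if e then d else c.
Definition Vres (e : bool) (k : nat) : R :=
  if e then V_odd x b d k else V_even x a c k.
Definition Vhat (e : bool) (k : nat) : R :=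
  if e then Vhat_odd x theta0 k else Vhat_even x theta0 k.

Hypothesis squares : forall i e, exists M, forall n,
  \sum_(j < n) (\sum_(k <- GG j) weight i (x k) * Vres e k) ^+ 2 / 2 ^+ j
    <= M * n.+1%:R.
Variable kappa : R.
Hypothesis kappa0 : 0 < kappa.
Hypothesis lower : \forall n \near \oo, forall m, 0 <= m <= 1 ->
  kappa * 2 ^+ n <= \sum_(k <- TT n) (hw (x k) - m) ^+ 2.

Let lowQ : \forall n \near \oo, kappa * (2 ^+ n) ^+ 2 <= det2 (Q_mx x n).
Proof. by apply: filterS lower => n h; exact: det2_Q_lower. Qed.

Let lowS : \forall n \near \oo, kappa / 2 * (2 ^+ n) ^+ 2 <= det2 (S_mx x n).
Proof. by apply: filterS lowQ => n h; have := det2_S x n; lra. Qed.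

Let regularizeE (Q : 'M[R]_2) (de : R) : 0 < de -> de <= det2 Q -> regularize Q = Q.
Proof.
by move=> de0 h; rewrite /regularize det2_unit// gt_eqF// (lt_le_trans de0).
Qed.

Lemma quad_vecE (g : nat -> R) n i :
  (\sum_(k <- TT n) (((1 + x k ^+ 2) ^+ 2)^-1 * g k) *: psi x k) i 0 =
  \sum_(k <- TT n) phi (i != 0) (x k) * g k.
Proof.
rewrite summxE; apply: eq_bigr => k _; rewrite !mxE.
have h : 1 + x k ^+ 2 != 0 by rewrite gt_eqF// ltr_pwDl ?sqr_ge0.
by case: eqP => _ /=; rewrite /phi /= /hw /vw; field.
Qed.

Lemma quad_est_bound : \forall n \near \oo, forall g i,
  `|quad_est x g n.+1 i 0| <= 2 / kappa *
    (`|\sum_(k <- TT n) phi false (x k) * g k| +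
     `|\sum_(k <- TT n) phi true (x k) * g k|) / 2 ^+ n.
Proof.
apply: filterS lowQ => n h g i.
have t0 : 0 < 2 ^+ n :> R by rewrite exprn_gt0.
have d0 : 0 < kappa * (2 ^+ n) ^+ 2 by rewrite mulr_gt0// exprn_gt0.
rewrite /quad_est /= (regularizeE d0 h).
have := solve2_bound (\sum_(k <- TT n) (((1 + x k ^+ 2) ^+ 2)^-1 * g k) *: psi x k)
  d0 h (Q_mx_bound x n) i.
rewrite !quad_vecE /= => hh; apply: le_trans hh _; apply: eq_ler.
by rewrite exprS; field; rewrite !gt_eqF.
Qed.

Lemma quad_estB g g' n :
  quad_est x g n - quad_est x g' n = quad_est x (fun k => g k - g' k) n.
Proof.
rewrite /quad_est -mulmxBr -sumrB; congr (_ *m _); apply: eq_bigr => k _.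
by rewrite -scalerBl -mulrBr.
Qed.

Let colidx (e : bool) : 'I_2 := if e then 1 else 0.
Let al e l := theta_hat x theta0 l 0 (colidx e) - slope e.
Let ga e l := theta_hat x theta0 l 1 (colidx e) - icept e.
Let Err e l := al e l ^+ 2 + ga e l ^+ 2.

Let VhatE e k : Vhat e k = Vres e k -
  (al e (trunc_log 2 k) * x k + ga e (trunc_log 2 k)).
Proof.
by case: e; rewrite /Vhat /Vres /Vhat_odd /Vhat_even /V_odd /V_even /al /ga
  /slope /icept /=; ring.
Qed.

(** Normal equations: [S_mx] applied to the estimation error is the sum of the true residuals
    weighted by [Phi k] / c_k. The constant is the quotient of the entry bound 2^(m+1) by the
    determinant bound (kappa / 2) 4^m. *)
Let theta_err : \forall m \near \oo, forall e,
  let r := 4 / kappa * (`|\sum_(k <- TT m) vw (x k) * Vres e k| +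
     `|\sum_(k <- TT m) hw (x k) * Vres e k|) / 2 ^+ m in
  `|al e m.+1| <= r /\ `|ga e m.+1| <= r.
Proof.
apply: filterS lowS => m h e r.
have t0 : 0 < 2 ^+ m :> R by rewrite exprn_gt0.
have d0 : 0 < kappa / 2 * (2 ^+ m) ^+ 2 by rewrite mulr_gt0 ?divr_gt0// exprn_gt0.
have Su : S_mx x m \in unitmx by apply: det2_unit; rewrite gt_eqF// (lt_le_trans d0).
pose G := \sum_(k <- TT m) (1 + x k ^+ 2)^-1 *: (Phi x k *m (chi x k)^T).
pose y := col2 (\sum_(k <- TT m) vw (x k) * Vres e k) (\sum_(k <- TT m) hw (x k) * Vres e k).
have thE i : theta_hat x theta0 m.+1 i (colidx e) - col2 (slope e) (icept e) i 0 =
    (invmx (S_mx x m) *m y) i 0.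
  rewrite /theta_hat (regularizeE d0 h) -/G.
  have -> : (invmx (S_mx x m) *m G) i (colidx e) =
    (invmx (S_mx x m) *m col (colidx e) G) i 0.
    by rewrite !mxE; apply: eq_bigr => l _; rewrite !mxE.
  have -> : y = col (colidx e) G - S_mx x m *m col2 (slope e) (icept e).
    apply/matrixP => l j; rewrite (ord1 j) !mxE sum2 !col2E !S_mxE summxE.
    rewrite !mulr_suml opprD -!sumrN -!big_split/=.
    have GE k : ((1 + x k ^+ 2)^-1 *: (Phi x k *m (chi x k)^T)) l (colidx e) =
        hw (x k) * (Phi x k l 0 * (if e then x k.*2.+1 else x k.*2)).
      by rewrite !mxE big_ord1 !mxE; case: (e).
    move: l GE; apply: ord2_ind => GE /=; apply: eq_bigr => k _; rewrite GE !mxE/=;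
      by rewrite /vw -/(hw (x k)) /Vres /slope /icept /V_odd /V_even; case: (e); ring.
  by rewrite mulmxBr mulKmx// !mxE.
have rE : 2 ^+ m.+1 / (kappa / 2 * (2 ^+ m) ^+ 2) * (`|y 0 0| + `|y 1 0|) = r.
  by rewrite /r !col2E exprS; field; rewrite !gt_eqF.
have bnd := solve2_bound y d0 h (S_mx_bound x m); rewrite rE in bnd.
split.
- by have := bnd 0; rewrite -thE col2E.
- by have := bnd 1; rewrite -thE col2E.
Qed.

Let Err0 e l : 0 <= Err e l. Proof. by rewrite addr_ge0 ?sqr_ge0. Qed.

Let err_sum e : exists C, forall n, \sum_(l < n) 2 ^+ l * Err e l <= C * n.+1%:R.
Proof.
have [M1 h1] := squares 0 e; have [M2 h2] := squares 1 e.
pose U1 j := \sum_(k <- GG j) hw (x k) * Vres e k.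
pose U2 j := \sum_(k <- GG j) vw (x k) * Vres e k.
have {}h1 := prefix_squares (U := U1) h1.
have {}h2 := prefix_squares (U := U2) h2.
(* For l = m + 1 the error uses [TT m], that is, the generations j < l. The constant is 2 * 32 * 4:
   the two components, the bound on r^2 below, and the change from 4^m to 4^l. *)
pose g l := 256 / kappa ^+ 2 * ((\sum_(j < l) U1 j) ^+ 2 / 2 ^+ l +
  (\sum_(j < l) U2 j) ^+ 2 / 2 ^+ l).
have [n0 _ hn] := theta_err.
have k2 : 0 <= 256 / kappa ^+ 2 by apply: divr_ge0 => //; exact: sqr_ge0.
have U20 (S : R) l : 0 <= S ^+ 2 / 2 ^+ l.
  by apply: divr_ge0; [exact: sqr_ge0|exact: exprn_ge0].
apply: (@eventually_sum_le R (fun l => 2 ^+ l * Err e l) g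
  (256 / kappa ^+ 2 * (6 * M1 + 6 * M2)) n0.+1).
- by move=> l; apply: mulr_ge0; [exact: exprn_ge0|exact: Err0].
- by move=> l; apply: mulr_ge0 => //; exact: addr_ge0.
- move=> [//|m] nm; have [ea eg] := hn m nm e.
  pose S1 := \sum_(j < m.+1) U1 j; pose S2 := \sum_(j < m.+1) U2 j.
  pose r := 4 / kappa * (`|S2| + `|S1|) / 2 ^+ m.
  have t0 : 0 < 2 ^+ m :> R by rewrite exprn_gt0.
  move: ea eg; rewrite !sum_TT -/S1 -/S2 -/r /g => ea eg.
  have r0 : 0 <= r by exact: le_trans ea.
  have sa : al e m.+1 ^+ 2 <= r ^+ 2.
    by rewrite -[leLHS]real_normK ?num_real// lerXn2r ?nnegrE.
  have sg : ga e m.+1 ^+ 2 <= r ^+ 2.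
    by rewrite -[leLHS]real_normK ?num_real// lerXn2r ?nnegrE.
  have rr : r ^+ 2 <= 32 / kappa ^+ 2 * (S1 ^+ 2 + S2 ^+ 2) / (2 ^+ m) ^+ 2.
    rewrite /r -[S1 ^+ 2]real_normK ?num_real// -[S2 ^+ 2]real_normK ?num_real//.
    rewrite (_ : (_ / _) ^+ 2 =
      16 / kappa ^+ 2 * (`|S2| + `|S1|) ^+ 2 / (2 ^+ m) ^+ 2); last first.
      by field; rewrite !gt_eqF.
    apply: ler_wpM2r; first by rewrite invr_ge0 sqr_ge0.
    rewrite [leRHS](_ : _ = 16 / kappa ^+ 2 * (2 * (`|S1| ^+ 2 + `|S2| ^+ 2))); last first.
      by field; rewrite gt_eqF.
    apply: ler_wpM2l; first by apply: divr_ge0 => //; exact: sqr_ge0.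
    by have := sqr_ge0 (`|S1| - `|S2|); nra.
  apply: (@le_trans _ _ (2 ^+ m.+1 * (2 * r ^+ 2))).
    by rewrite ler_wpM2l ?exprn_ge0// /Err; lra.
  apply: (@le_trans _ _ (2 ^+ m.+1 * (2 * (32 / kappa ^+ 2 * (S1 ^+ 2 + S2 ^+ 2) / (2 ^+ m) ^+ 2)))).
    by rewrite ler_wpM2l ?exprn_ge0// ler_wpM2l.
  by apply: eq_ler; rewrite -/S1 -/S2 (exprS 2 m); field; rewrite !gt_eqF.
- move=> n; rewrite -mulr_sumr big_split/= -[leRHS]mulrA; apply: ler_wpM2l => //.
  by rewrite mulrDl; apply: lerD; [exact: h1|exact: h2].
Qed.

Let phi_bounds i y : [/\ 0 <= phi i y, phi i y <= 1, phi i y * y ^+ 2 <= 1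
  & `|phi i y * y| <= 1].
Proof.
have h0 := hw_gt0 y; have h1 := hw_le1 y.
have hx : y ^+ 2 * hw y = 1 - hw y.
  by rewrite /hw; field; rewrite gt_eqF// ltr_pwDl ?sqr_ge0.
have v2 : vw y ^+ 2 = (1 - hw y) * hw y by rewrite -hx /vw -/(hw y); ring.
have v1 := BL_vw.1 y.
have p0 : 0 <= phi i y by case: i; rewrite /phi sqr_ge0.
have p1 : phi i y <= 1 by case: (i); rewrite /phi ?v2; nra.
have p2 : phi i y * y ^+ 2 <= 1.
  case: (i); rewrite /phi ?v2.
    rewrite [leLHS](_ : _ = hw y * (y ^+ 2 * hw y)); last by ring.
    by rewrite hx; nra.
  rewrite [leLHS](_ : _ = (1 - hw y) * (y ^+ 2 * hw y)); last by ring.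
  by rewrite hx; nra.
split => //; rewrite normrM ger0_norm//.
have : `|y| <= (1 + y ^+ 2) / 2.
  by rewrite -[y ^+ 2]real_normK ?num_real//; have := sqr_ge0 (`|y| - 1); nra.
by move=> /(ler_wpM2l p0) h; apply: le_trans h _; lra.
Qed.

(** The estimator used in generation l is the same at all its nodes, so its errors factor out of the
    sum and leave two weighted residual sums covered by [squares]. *)
Let cross_sum e e' i : exists C, forall n, \sum_(l < n)
  `|\sum_(k <- GG l) phi i (x k) * (Vres e k * (al e' l * x k + ga e' l))|
  <= C * n.+1%:R.
Proof.
have [C1 h1] := err_sum e'.
have [M1 m1] := squares (if i then 4 else 2) e.
have [M2 m2] := squares (if i then 5 else 3) e.
have w1 y : weight (if i then 4 else 2) y = phi i y * y by case: (i).
have w2 y : weight (if i then 5 else 3) y = phi i y by case: (i).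
exists (C1 + M1 + M2) => n.
apply: le_trans (_ : _ <= \sum_(l < n) (2 ^+ l * Err e' l +
    (\sum_(k <- GG l) weight (if i then 4 else 2) (x k) * Vres e k) ^+ 2 / 2 ^+ l +
    (\sum_(k <- GG l) weight (if i then 5 else 3) (x k) * Vres e k) ^+ 2 / 2 ^+ l)) _; last first.
  by rewrite !big_split/= !mulrDl; apply: lerD; [apply: lerD; [exact: h1|exact: m1]|exact: m2].
apply: ler_sum => l _.
have t0 : 0 < 2 ^+ l :> R by rewrite exprn_gt0.
set U1 := \sum_(k <- GG l) weight (if i then 4 else 2) _ * _.
set U2 := \sum_(k <- GG l) weight (if i then 5 else 3) _ * _.
have -> : \sum_(k <- GG l) phi i (x k) * (Vres e k * (al e' l * x k + ga e' l)) =
    al e' l * U1 + ga e' l * U2.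
  rewrite /U1 /U2 !mulr_sumr -big_split/=; apply: eq_bigr => k _.
  by rewrite w1 w2; ring.
apply: le_trans (ler_normD _ _) _; rewrite !normrM /Err.
(* The weight 2^l is chosen so that one side is the summand of [err_sum] and the other the summand
   of [squares]. *)
have amgm (p q : R) : `|p| * `|q| <= 2 ^+ l * p ^+ 2 + q ^+ 2 / 2 ^+ l.
  rewrite -[p ^+ 2]real_normK ?num_real// -[q ^+ 2]real_normK ?num_real//.
  set p' := `|p|; set q' := `|q|; have p0 : 0 <= p' := normr_ge0 p.
  have q0 : 0 <= q' := normr_ge0 q.
  rewrite -subr_ge0 (_ : _ - _ = 2 ^+ l * (p' - q' / 2 ^+ l) ^+ 2 + p' * q'); last first.
    by field; rewrite gt_eqF.
  apply: addr_ge0; last exact: mulr_ge0.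
  by apply: mulr_ge0; [exact: ltW|exact: sqr_ge0].
have := amgm (al e' l) U1; have := amgm (ga e' l) U2; lra.
Qed.

(** The weight makes a state-dependent error harmless: [phi] and [phi * x^2] are at most 1, so each
    node of generation l contributes at most the sum of the two [Err] at l. *)
Let quadratic_sum e e' i : exists C, forall n, \sum_(l < n)
  `|\sum_(k <- GG l) phi i (x k) *
     ((al e l * x k + ga e l) * (al e' l * x k + ga e' l))|
  <= C * n.+1%:R.
Proof.
have [C1 h1] := err_sum e; have [C2 h2] := err_sum e'.
exists (C1 + C2) => n.
apply: le_trans (_ : _ <= \sum_(l < n) (2 ^+ l * Err e l + 2 ^+ l * Err e' l)) _; last first.
  by rewrite big_split/= mulrDl; apply: lerD; [exact: h1|exact: h2].
apply: ler_sum => l _; apply: le_trans (ler_norm_sum _ _ _) _.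
rewrite -mulrDr mulrC -sumr_GG_const; apply: ler_sum => k _.
have [p0 p1 p2 p3] := phi_bounds i (x k).
set A := al e l; set B := ga e l; set A' := al e' l; set B' := ga e' l.
rewrite normrM ger0_norm//.
have sq (u v : R) : phi i (x k) * (u * x k + v) ^+ 2 <= 2 * (u ^+ 2 + v ^+ 2).
  apply: (@le_trans _ _ (2 * (u ^+ 2 * (phi i (x k) * x k ^+ 2) + v ^+ 2 * phi i (x k)))).
    have := mulr_ge0 p0 (sqr_ge0 (u * x k - v)); nra.
  rewrite ler_wpM2l//; apply: lerD; rewrite ler_piMr ?sqr_ge0//.
have := sq A B; have := sq A' B'.
have : `|(A * x k + B) * (A' * x k + B')| <=
    ((A * x k + B) ^+ 2 + (A' * x k + B') ^+ 2) / 2.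
  rewrite normrM -[_ ^+ 2]real_normK ?num_real// -[(A' * _ + _) ^+ 2]real_normK ?num_real//.
  by have := sqr_ge0 (`|A * x k + B| - `|A' * x k + B'|); nra.
move=> /(ler_wpM2l p0) h h2' h1'; apply: le_trans h _.
by rewrite /Err -/A -/B -/A' -/B'; lra.
Qed.

Lemma residual_product_bound e e' i : exists C, forall n,
  `|\sum_(k <- TT n) phi i (x k) * (Vhat e k * Vhat e' k - Vres e k * Vres e' k)|
    <= C * n.+2%:R.
Proof.
have [C1 h1] := quadratic_sum e e' i.
have [C2 h2] := cross_sum e e' i; have [C3 h3] := cross_sum e' e i.
exists (C1 + C2 + C3) => n; rewrite sum_TT.
apply: le_trans (ler_norm_sum _ _ _) _.
(* [TT n] has n + 1 generations; the three bounds are taken at n + 1, hence the factor n + 2 in the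
   statement. *)
rewrite !mulrDl; apply: le_trans (lerD (lerD (h1 n.+1) (h2 n.+1)) (h3 n.+1)).
rewrite -!big_split/=; apply: ler_sum => l _.
rewrite (_ : \sum_(k <- GG l) phi i (x k) * (Vhat e k * Vhat e' k - Vres e k * Vres e' k) =
  \sum_(k <- GG l) phi i (x k) * ((al e l * x k + ga e l) * (al e' l * x k + ga e' l)) +
  - (\sum_(k <- GG l) phi i (x k) * (Vres e k * (al e' l * x k + ga e' l))) +
  - (\sum_(k <- GG l) phi i (x k) * (Vres e' k * (al e l * x k + ga e l)))).
  apply: le_trans (ler_normD _ _) _; rewrite normrN lerD2r.
  by apply: le_trans (ler_normD _ _) _; rewrite normrN.
rewrite -!sumrN -!big_split/= big_seq [RHS]big_seq; apply: eq_bigr => k kl.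
by rewrite !VhatE (trunc_log_GG kl); ring.
Qed.

Lemma residual_product_rate e e' : exists2 C, 0 <= C &
  \forall n \near \oo, forall i,
  `|(quad_est x (fun k => Vhat e k * Vhat e' k) n -
     quad_est x (fun k => Vres e k * Vres e' k) n) i 0| <= C * (n%:R / 2 ^+ n).
Proof.
have [C1 h1] := residual_product_bound e e' false.
have [C2 h2] := residual_product_bound e e' true.
have C10 : 0 <= C1.
  by have := le_trans (normr_ge0 _) (h1 0%N); rewrite pmulr_lge0 ?ltr0n.
have C20 : 0 <= C2.
  by have := le_trans (normr_ge0 _) (h2 0%N); rewrite pmulr_lge0 ?ltr0n.
(* At index n + 1 the bound is 2 / kappa * (C1 + C2) (n + 2) / 2^n; one factor 2 comes from n + 2 <=
   2 (n + 1), another from 2^(n+1) = 2 * 2^n. *)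
exists (8 / kappa * (C1 + C2)); first by rewrite mulr_ge0 ?addr_ge0// divr_ge0 ?ltW.
have [n0 _ hb] := quad_est_bound.
exists n0.+1 => // -[//|n] /= nn i.
rewrite quad_estB; apply: le_trans (hb n nn _ i) _.
apply: (@le_trans _ _ (2 / kappa * (C1 * n.+2%:R + C2 * n.+2%:R) / 2 ^+ n)).
  rewrite ler_wpM2r ?invr_ge0 ?exprn_ge0// ler_wpM2l ?divr_ge0 ?(ltW kappa0)//.
  exact: lerD.
have t0 : 0 < 2 ^+ n :> R by rewrite exprn_gt0.
rewrite exprS -mulrDl (_ : 8 / kappa * (C1 + C2) * (n.+1%:R / (2 * 2 ^+ n)) =
  2 / kappa * ((C1 + C2) * (2 * n.+1%:R)) / 2 ^+ n); last by field; rewrite !gt_eqF.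
rewrite ler_wpM2r ?invr_ge0 ?(ltW t0)// ler_wpM2l ?divr_ge0 ?(ltW kappa0)//.
by rewrite ler_wpM2l ?addr_ge0// -natrM ler_nat; lia.
Qed.

Lemma residual_product_bigO e e' :
  (fun n => enorm (quad_est x (fun k => Vhat e k * Vhat e' k) n -
                   quad_est x (fun k => Vres e k * Vres e' k) n))
    =O_\oo (rate R).
Proof.
have [C C0 hC] := residual_product_rate e e'.
apply/eqOP; near=> K; near=> n.
have nn : (1 <= n)%N by near: n; exists 1%N.
have h : forall i, `|(quad_est x (fun k => Vhat e k * Vhat e' k) n -
     quad_est x (fun k => Vres e k * Vres e' k) n) i 0| <= C * (n%:R / 2 ^+ n).
  by near: n.
rewrite ger0_norm ?sqrtr_ge0//; apply: le_trans (enorm_le _) _.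
apply: (@le_trans _ _ (2 * C * (n%:R / 2 ^+ n))).
  by have := lerD (h 0) (h 1); lra.
have KC : 2 * C <= K by near: K; apply: nbhs_pinfty_ge; rewrite num_real.
(* The tree up to generation n - 1 has at most 2^n nodes, so n / 2^n is at most [rate R n]. *)
have [s1 s2] := @size_TT_bounds R n.-1; rewrite prednK// in s2.
have s0 : 0 < (size (TT n.-1))%:R :> R by apply: lt_le_trans s1; rewrite exprn_gt0.
rewrite /rate ger0_norm ?divr_ge0//.
apply: ler_pM => //; first by rewrite mulr_ge0.
by rewrite ler_wpM2l// lef_pV2// posrE// exprn_gt0.
Unshelve. all: by end_near. Qed.

Variables (tau kap : R) (e e' : bool).
Hypothesis lln : forall i, (\sum_(k <- TT n) phi i (x k) *
  (Vres e k * Vres e' k - (tau * x k ^+ 2 + kap))) / 2 ^+ n @[n --> \oo] --> 0.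

(** The function tau x^2 + kap is the scalar product of [psi] with (tau, kap), so weighted least
    squares recovers (tau, kap) exactly. By linearity the error made with true residuals is
    [quad_est] of the centered products, to which [lln] applies. *)
Let quad_est_true : \forall n \near \oo,
  quad_est x (fun k => tau * x k ^+ 2 + kap) n.+1 = col2 tau kap.
Proof.
apply: filterS lowQ => n h.
have d0 : 0 < kappa * (2 ^+ n) ^+ 2 by rewrite mulr_gt0// !exprn_gt0.
have Qu : Q_mx x n \in unitmx by apply: det2_unit; rewrite gt_eqF// (lt_le_trans d0).
rewrite /quad_est /= (regularizeE d0 h).
rewrite -[RHS](mulKmx Qu); congr (_ *m _).
apply/matrixP => l j; rewrite (ord1 j) quad_vecE mxE sum2 !col2E !Q_mxE.
rewrite !mulr_suml -big_split/=; apply: eq_bigr => k _.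
by move: l; apply: ord2_ind; rewrite !mxE/= /phi /vw -/(hw (x k)); ring.
Qed.

Lemma residual_product_cvg :
  quad_est x (fun k => Vhat e k * Vhat e' k) n @[n --> \oo] --> col2 tau kap.
Proof.
apply: cvg_col => i.
have [C C0 hC] := residual_product_rate e e'.
have geo : n%:R / 2 ^+ n @[n --> \oo] --> (0 : R) by exact: cvg_nat_div_geo.
apply/cvgrPdist_lt => eps eps0.
have eps1 : 0 < eps / (2 * (C + 1)) by rewrite divr_gt0// mulr_gt0// ltr_wpDl.
(* Two components, each below this threshold, are multiplied by 2 / kappa in [quad_est_bound]: the
   total is eps / 2. *)
have eps2 : 0 < eps * kappa / 8 by rewrite divr_gt0// mulr_gt0.
have /cvgr0Pnorm_lt/(_ _ eps1) g1 := geo.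
have /cvgr0Pnorm_lt/(_ _ eps2) [n1 _ l1] := lln false.
have /cvgr0Pnorm_lt/(_ _ eps2) [n2 _ l2] := lln true.
have [n3 _ hb] := quad_est_bound; have [n4 _ ht] := quad_est_true.
apply: filterS3 hC g1 (_ : \forall n \near \oo, (n1 + n2 + n3 + n4 < n)%N) => [|]; last first.
  by exists (n1 + n2 + n3 + n4).+1.
move=> n hn gn nn; case: n nn hn gn => // n nn hn gn.
have t0 : 0 < 2 ^+ n :> R by rewrite exprn_gt0.
have a1 := hn i.
have a2 : C * (n.+1%:R / 2 ^+ n.+1) <= eps / 2.
  rewrite ger0_norm ?divr_ge0 ?exprn_ge0// in gn.
  apply: (@le_trans _ _ (C * (eps / (2 * (C + 1))))).
    by rewrite ler_wpM2l// ltW.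
  rewrite mulrA ler_pdivrMr ?mulr_gt0 ?ltr_wpDl//; nra.
have a3 : `|(quad_est x (fun k => Vres e k * Vres e' k) n.+1 - col2 tau kap) i 0| < eps / 2.
  rewrite -(ht n) /=; last by lia.
  rewrite quad_estB; apply: le_lt_trans (hb n _ _ i) _ => /=; first lia.
  have := l1 n; rewrite /= => /(_ ltac:(lia)); have := l2 n; rewrite /= => /(_ ltac:(lia)).
  rewrite !normrM !normfV (gtr0_norm t0).
  set S1 := `|\sum_(k <- _) _|; set S2 := `|\sum_(k <- _) _|.
  move=> b2 b1; rewrite (_ : _ / _ = 2 / kappa * (S2 / 2 ^+ n + S1 / 2 ^+ n)); last by ring.
  rewrite -ltr_pdivlMl ?divr_gt0//.
  rewrite (_ : (2 / kappa)^-1 * (eps / 2) = eps * kappa / 4); last by field; rewrite gt_eqF.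
  by lra.
have subE (A B : 'cV[R]_2) : (A - B) i 0 = A i 0 - B i 0 by rewrite !mxE.
rewrite subE in a1; rewrite subE in a3; rewrite distrC.
apply: le_lt_trans (ler_distD (quad_est x (fun k => Vres e k * Vres e' k) n.+1 i 0) _ _) _.
by lra.
Qed.

End trajectory.

(** * The noise of the model *)

Section noise.
Context {disp} {T : measurableType disp} {R : realType} (P : probability T R).
Variables (ab ee : nat -> T -> (R * R)%type).
Hypotheses (mab : forall k, measurable_fun setT (ab k))
  (mee : forall k, measurable_fun setT (ee k)).
Let pos := [set n | (1 <= n)%N].
Hypotheses (iid_ab : iid P pos ab) (iid_ee : iid P pos ee).
Hypothesis ind_abee : indep_sigma P (sigma_gen pos ab) (sigma_gen pos ee).

Definition noise (k : nat) (w : T) : (R * R) * (R * R) := (ab k w, ee k w).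

Lemma measurable_noise k : measurable_fun setT (noise k).
Proof. exact: measurable_fun_pair. Qed.

Let cyl_set (s : seq nat) (B C : nat -> set (R * R)%type) : set T :=
  \bigcap_(i in [set` s]) (ab i @^-1` B i `&` ee i @^-1` C i).

(** These boxes constrain coefficients and innovations separately, which is where the model gives
    product formulas; they form a pi-system that makes the blocks [noise j], for j in [s],
    measurable. *)
Let cyl (s : seq nat) : set (set T) := [set A | exists B C,
  [/\ forall i, measurable (B i), forall i, measurable (C i) & A = cyl_set s B C]].

Let cyl_prob s B C : uniq s -> (forall i, i \in s -> (1 <= i)%N) ->
  (forall i, measurable (B i)) -> (forall i, measurable (C i)) ->
  fine (P (cyl_set s B C)) =
  \prod_(i <- s) (fine (P (ab i @^-1` B i)) * fine (P (ee i @^-1` C i))).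
Proof.
move=> us s1 mB mC.
have gen (Y : nat -> T -> (R * R)%type) D : (forall i, measurable (D i)) ->
    sigma_gen pos Y (\bigcap_(i in [set` s]) (Y i @^-1` D i)).
  move=> mD; rewrite /sigma_gen.
  have := @fin_bigcap_measurable _ (g_sigma_algebraType (\bigcup_(k in pos)
    g_sigma_algebra_preimage (Y k))) _ [set` s] (fun i => Y i @^-1` D i).
  apply; first exact: finite_seq.
  move=> i /s1 i1; apply: sub_sigma_algebra; exists i => //.
  by exists (D i) => //; rewrite setTI.
rewrite /cyl_set bigcapI (ind_abee (gen _ _ mB) (gen _ _ mC)) fineM ?fin_num_measure//.
- by rewrite iid_ab.2// iid_ee.2// big_split.
- apply: fin_bigcap_measurable; first exact: finite_seq.
  by move=> i _; rewrite -[X in measurable X]setTI; exact: mab.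
- apply: fin_bigcap_measurable; first exact: finite_seq.
  by move=> i _; rewrite -[X in measurable X]setTI; exact: mee.
Qed.

Let cyl_measurable s : cyl s `<=` measurable.
Proof.
move=> _ [B [C [mB mC ->]]].
apply: fin_bigcap_measurable; first exact: finite_seq.
move=> i _; apply: measurableI.
- by rewrite -[X in measurable X]setTI; exact: mab.
- by rewrite -[X in measurable X]setTI; exact: mee.
Qed.

Let cylI s : setI_closed (cyl s).
Proof.
move=> _ _ [B [C [mB mC ->]]] [B' [C' [mB' mC' ->]]].
exists (fun i => B i `&` B' i), (fun i => C i `&` C' i); split.
- by move=> i; exact: measurableI.
- by move=> i; exact: measurableI.
rewrite /cyl_set -bigcapI; apply: eq_bigcapr => i _.
by rewrite !preimage_setI setIACA.
Qed.

Let cylT s : cyl s setT.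
Proof.
exists (fun=> setT), (fun=> setT); split => //.
by apply/seteqP; split => // w _ i _.
Qed.

Let noise_cyl s j : j \in s ->
  measurable_fun (setT : set (g_sigma_algebraType (cyl s))) (noise j).
Proof.
move=> js; apply: measurable_fun_pair => _ D mD; apply: sub_sigma_algebra.
- exists (fun i => if i == j then D else setT), (fun=> setT); split => //.
    by move=> i; case: ifP.
  rewrite setTI; apply/seteqP; split => w /=.
    by move=> Dw i _; split => //=; case: eqP => // ->.
  by move=> /(_ j js) [+ _] /=; rewrite eqxx.
- exists (fun=> setT), (fun i => if i == j then D else setT); split => //.
    by move=> i; case: ifP.
  rewrite setTI; apply/seteqP; split => w /=.
    by move=> Dw i _; split => //=; case: eqP => // ->.
  by move=> /(_ j js) [_ +] /=; rewrite eqxx.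
Qed.

(** The past of k is generated by cylinders over 1, ..., k - 1 and the present by cylinders over k
    alone, so by [indep_generated] it suffices to factor the probability of an intersection of two
    boxes. *)
Lemma noise_indep_noise : noise_indep P noise.
Proof.
move=> k A B k1 sA mB.
pose s := index_iota 1 k.
have sA' : <<s cyl s >> A.
  move: sA; apply: smallest_sub; first exact: smallest_sigma_algebra.
  move=> _ [j /= jk [D mD <-]].
  by apply: (noise_cyl (s := s)) => //; rewrite mem_index_iota.
have sB : <<s cyl [:: k] >> (noise k @^-1` B).
  rewrite -[noise k @^-1` B]setTI.
  by apply: (noise_cyl (s := [:: k])) => //; rewrite mem_head.
apply: (indep_generated (D := cyl s) (D' := cyl [:: k])) => //; try exact: cyl_measurable.
move=> _ _ [B1 [C1 [mB1 mC1 ->]]] [B2 [C2 [mB2 mC2 ->]]].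
(* The index k does not occur in [s], so the two boxes merge into a single one over [rcons s k],
   whose probability is the full product. *)
pose B3 i := if i == k then B2 i else B1 i.
pose C3 i := if i == k then C2 i else C1 i.
have mB3 i : measurable (B3 i) by rewrite /B3; case: ifP.
have mC3 i : measurable (C3 i) by rewrite /C3; case: ifP.
have ks : k \notin s by rewrite mem_index_iota ltnn andbF.
have sk i : i \in s -> (i == k) = false.
  by move=> si; apply/negP => /eqP ik; move: ks; rewrite -ik si.
have E : cyl_set s B1 C1 `&` cyl_set [:: k] B2 C2 = cyl_set (rcons s k) B3 C3.
  apply/seteqP; split => w /=.
    move=> [h1 h2] i /=; rewrite mem_rcons inE => /orP[/eqP ->|si].
      by have := h2 k; rewrite /B3 /C3 eqxx /=; apply; rewrite mem_head.
    by have := h1 i si; rewrite /B3 /C3 sk.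
  move=> h; split => i /=.
    by move=> si; have := h i; rewrite /= mem_rcons inE si orbT /B3 /C3 sk//; apply.
  rewrite inE => /eqP ->.
  by have := h k; rewrite /= mem_rcons mem_head /B3 /C3 eqxx; apply.
have us : uniq (rcons s k) by rewrite rcons_uniq ks iota_uniq.
have s1 i : i \in s -> (1 <= i)%N by rewrite mem_index_iota => /andP[].
have sk1 i : i \in rcons s k -> (1 <= i)%N.
  by rewrite mem_rcons inE => /orP[/eqP ->//|/s1].
have fin s' B' C' : (forall i, measurable (B' i)) -> (forall i, measurable (C' i)) ->
    P (cyl_set s' B' C') \is a fin_num.
  by move=> mB' mC'; apply: fin_num_measure; apply: (@cyl_measurable s'); exists B', C'.
rewrite E -[LHS]fineK ?fin// -[P (cyl_set s _ _)]fineK ?fin//.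
rewrite -[P (cyl_set [:: k] _ _)]fineK ?fin// -EFinM; congr EFin.
have us1 : uniq s by exact: iota_uniq.
have kk i : i \in [:: k] -> (1 <= i)%N by rewrite inE => /eqP ->.
rewrite !cyl_prob//.
rewrite -cats1 big_cat/= !big_seq1 /B3 /C3 eqxx; congr (_ * _).
by rewrite big_seq [RHS]big_seq; apply: eq_bigr => i si; rewrite sk.
Qed.

Lemma indep_ab_ee k : (1 <= k)%N -> forall A B, measurable A -> measurable B ->
  P (ab k @^-1` A `&` ee k @^-1` B) = (P (ab k @^-1` A) * P (ee k @^-1` B))%E.
Proof.
move=> k1 A B mA mB; apply: ind_abee; apply: sub_sigma_algebra.
- by exists k => //; exists A => //; rewrite setTI.
- by exists k => //; exists B => //; rewrite setTI.
Qed.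

(** The law of a block is the product of the laws of its two halves, and each of these is the same
    at every node. *)
Lemma law_noise k (phi : (R * R) * (R * R) -> R) : (1 <= k)%N ->
  measurable_fun setT phi -> (forall s, 0 <= phi s) ->
  Ex P (fun w => phi (noise k w)) = Ex P (fun w => phi (noise 1%N w)).
Proof.
move=> k1 mphi phi0.
pose AB := mfun_Sub (mem_set (mab 1)); pose EE := mfun_Sub (mem_set (mee 1)).
pose L j := mfun_Sub (mem_set (measurable_noise j)).
have law j D : (1 <= j)%N -> measurable D -> (distribution P AB \x distribution P EE)%E D =
    distribution P (L j) D.
  move=> j1 mD; apply: product_measure_unique => // A B mA mB.
  rewrite /distribution /pushforward /=.
  transitivity (P (ab j @^-1` A `&` ee j @^-1` B)) => //.
  rewrite indep_ab_ee//.
  by congr (_ * _)%E; [exact: iid_ab.1|exact: iid_ee.1].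
have E j : (1 <= j)%N -> Ex P (fun w => phi (noise j w)) =
    fine (\int[(distribution P AB \x distribution P EE)%E]_z (phi z)%:E)%E.
  move=> j1; congr fine.
  transitivity (\int[distribution P (L j)]_z (phi z)%:E)%E.
    rewrite (@ge0_integral_distribution _ _ _ _ _ P (L j) (EFin \o phi))//.
    exact/measurable_EFinP.
  by apply: eq_measure_integral => D mD _; exact/esym/law.
by rewrite !E.
Qed.

Lemma Ex_ab_ee k (f g : R * R -> R) : (1 <= k)%N ->
  measurable_fun setT f -> measurable_fun setT g ->
  L2 P (fun w => f (ab k w)) -> L2 P (fun w => g (ee k w)) ->
  Ex P (fun w => f (ab k w) * g (ee k w)) =
  Ex P (fun w => f (ab k w)) * Ex P (fun w => g (ee k w)).
Proof.
move=> k1 mf mg Lf Lg.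
have mPsi : measurable_fun setT (fun z : (R * R) * (R * R) => f z.1 * g z.2).
  by apply: measurable_funM; apply: measurableT_comp.
apply: EFin_inj; rewrite -EFin_Ex; last exact: integM.
rewrite (freezing (mab k) (mee k) (indep_ab_ee k1) mPsi); last 2 first.
- exact: integM.
- by move=> z; exact: (integZ (f z) (L2_integ Lg)).
have ig := L2_integ Lg; have iff := L2_integ Lf.
under eq_integral => w _.
  rewrite /= EFin_Ex; last exact: integZ.
  rewrite ExZ// mulrC.
  over.
by rewrite EFin_Ex ?ExZ 1?mulrC//; exact: integZ.
Qed.

End noise.

(** * From conditional to total expectations *)

Section conditional_expectation.
Context {disp} {T : measurableType disp} {R : realType} (P : probability T R).

Lemma condexp_Ex (G : set (set T)) X Y : G setT -> is_condexp P G X Y ->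
  integ P X /\ Ex P X = Ex P Y.
Proof. by move=> GT [iX iY _ /(_ _ GT) E]; split => //; congr fine. Qed.

Lemma condexp_cst_Ex (G : set (set T)) X (m : R) : G setT ->
  is_condexp P G X (cst m) -> integ P X /\ Ex P X = m.
Proof. by move=> GT /(condexp_Ex GT)[iX ->]; rewrite Ex_cst. Qed.

(** [is_condvar] is centered at some version [Y] of the conditional expectation, so uniqueness of
    versions is needed to return to the constant m. The events where [Y] lies above or below m
    belong to [G]; on each of them [Y - m] has constant sign and zero integral. *)
Lemma condexp_cst_ae (G : set (set T)) X Y (m : R) :
  is_condexp P G X Y -> is_condexp P G X (cst m) -> {ae P, forall w, Y w = m}.
Proof.
move=> [iX iY YG EY] [_ ic _ Em].
have mY := integ_meas iY.
have half (D : set R) : measurable D -> (forall y, D y -> m <= y) \/ (forall y, D y -> y <= m) ->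
    {ae P, forall w, D (Y w) -> Y w = m}.
  move=> mD sgD; pose A := Y @^-1` D.
  have mA : measurable A by rewrite -[A]setTI; exact: mY.
  have GA : G A by apply: YG; exists D => //; rewrite setTI.
  have iYA : P.-integrable A (EFin \o Y) by apply: integrableS iY.
  have icA : P.-integrable A (EFin \o cst m) by apply: integrableS ic.
  have fX : (\int[P]_(w in A) (X w)%:E)%E \is a fin_num.
    have iXA : P.-integrable A (EFin \o X) by apply: integrableS iX.
    exact: integrable_fin_num iXA.
  have E0 : (\int[P]_(w in A) (Y w - m)%:E = 0)%E.
    under eq_integral do rewrite EFinB.
    by rewrite (integralB_EFin mA iYA icA) (EY _ GA) (Em _ GA) subee.
  have E0' : (\int[P]_(w in A) (m - Y w)%:E = 0)%E.
    under eq_integral do rewrite EFinB.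
    by rewrite (integralB_EFin mA icA iYA) (EY _ GA) (Em _ GA) subee.
  have mYm : measurable_fun A (fun w => (Y w - m)%:E).
    apply/measurable_EFinP; apply: measurable_funTS.
    exact: measurable_funB.
  have [+ _] := ae_eq_integral_abs P mA mYm.
  have -> : (\int[P]_(w in A) `|(Y w - m)%:E| = 0)%E.
    case: sgD => sgD.
      rewrite -E0; apply: eq_integral => w; rewrite inE => /sgD h.
      by rewrite /= ger0_norm// subr_ge0.
    rewrite -E0'; apply: eq_integral => w; rewrite inE => /sgD h.
    by rewrite /= distrC ger0_norm// subr_ge0.
  move=> /(_ erefl); apply: filterS => w h Dw.
  by have := h Dw => -[] /eqP; rewrite subr_eq0 => /eqP.
have ge_m : forall y, `[m, +oo[%classic y -> m <= y.
  by move=> y /=; rewrite in_itv/= andbT.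
have le_m : forall y, `]-oo, m]%classic y -> y <= m by move=> y /=; rewrite in_itv.
have h1 := half _ (measurable_itv `[m, +oo[) (or_introl ge_m).
have h2 := half _ (measurable_itv `]-oo, m]) (or_intror le_m).
apply: filterS2 h1 h2 => w; rewrite /= !in_itv/= andbT => a1 a2.
by case: (leP m (Y w)) => [/a1//|/ltW/a2].
Qed.

(** The fourth moment supplies the integrability of the square centered at m; the hypothesis on the
    variance speaks of the square centered at [Y]. *)
Lemma condvar_Ex (G : set (set T)) X (m v : R) : G setT ->
  is_condexp P G X (cst m) -> is_condvar P G X (cst v) ->
  integ P (fun w => (X w - m) ^+ 4) ->
  Ex P (fun w => (X w - m) ^+ 2) = v.
Proof.
move=> GT cm [Y cY cv] i4.
have Ym := condexp_cst_ae cY cm.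
have [i2 E2] := condexp_Ex GT cv; rewrite Ex_cst in E2; rewrite -E2.
have mX : measurable_fun setT X by case: cm => iX _ _ _; exact: integ_meas iX.
apply: ae_Ex_eq => //; last by apply: filterS Ym => w ->.
apply: (@le_integ _ _ _ _ _ (fun w => 1 + (X w - m) ^+ 4)).
- by apply: measurable_funX; exact: measurable_funB.
- move=> w; rewrite ger0_norm ?sqr_ge0//.
  by have := sqr_ge0 ((X w - m) ^+ 2 - 1); rewrite (_ : (X w - m) ^+ 4 = ((X w - m) ^+ 2) ^+ 2); [nra|ring].
- by apply: integD => //; exact: integ_cst.
Qed.

End conditional_expectation.

(** * The RCBAR process *)

Section fourth_moments.
Context {disp} {T : measurableType disp} {R : realType} (P : probability T R).
Implicit Types F G : T -> R.

Definition L4 F : Prop := measurable_fun setT F /\ integ P (fun w => F w ^+ 4).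

Lemma L4_sqr F : L4 F -> L2 P (fun w => F w ^+ 2).
Proof.
move=> [mF i4]; split; first exact: measurable_funX.
by apply: eq_integ i4 => w; rewrite -exprM.
Qed.

Lemma L4_L2 F : L4 F -> L2 P F.
Proof. by move=> LF; split; [case: LF|exact: L2_integ (L4_sqr LF)]. Qed.

Lemma L4M F G : L4 F -> L4 G -> L2 P (fun w => F w * G w).
Proof.
move=> LF LG; have L := L2D (L4_sqr LF) (L4_sqr LG).
apply: le_L2 L; first by apply: measurable_funM; [case: LF|case: LG].
move=> w; rewrite (@ger0_norm _ (_ + _)) ?addr_ge0 ?sqr_ge0//.
rewrite normrM -[F w ^+ 2]real_normK ?num_real// -[G w ^+ 2]real_normK ?num_real//.
by have := normr_ge0 (F w); have := normr_ge0 (G w); nra.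
Qed.

Lemma L4D_cst F (m : R) : L4 F -> L4 (fun w => F w + m).
Proof.
move=> [mF i4]; have mFm : measurable_fun setT (fun w => F w + m) by exact: measurable_funD.
split => //; apply: (@le_integ _ _ _ _ _ (fun w => 8 * (F w ^+ 4 + m ^+ 4))).
- exact: measurable_funX.
- move=> w; rewrite (_ : (F w + m) ^+ 4 = ((F w + m) ^+ 2) ^+ 2); last by ring.
  rewrite ger0_norm ?sqr_ge0//.
  have h : (F w + m) ^+ 2 <= 2 * (F w ^+ 2 + m ^+ 2) by have := sqr_ge0 (F w - m); nra.
  have h0 := sqr_ge0 (F w + m).
  apply: (@le_trans _ _ ((2 * (F w ^+ 2 + m ^+ 2)) ^+ 2)).
    by rewrite lerXn2r ?nnegrE// (le_trans h0).
  rewrite (_ : F w ^+ 4 = (F w ^+ 2) ^+ 2); last by ring.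
  rewrite (_ : m ^+ 4 = (m ^+ 2) ^+ 2); last by ring.
  by have := sqr_ge0 (F w ^+ 2 - m ^+ 2); nra.
- by apply: integZ; apply: integD => //; exact: integ_cst.
Qed.

Lemma expectation_Ex F : integ P F -> ('E_P[F] = (Ex P F)%:E)%E.
Proof. by move=> iF; rewrite unlock; exact: EFin_Ex. Qed.

End fourth_moments.

Section weights_BL.
Context {R : realType}.

Lemma eq_BL (f g : R -> R) c : f =1 g -> BL f c -> BL g c.
Proof. by move=> /funext ->. Qed.

Lemma vwM (y : R) : vw y * y = 1 - hw y.
Proof. by rewrite /vw /hw; field; rewrite gt_eqF// ltr_pwDl ?sqr_ge0. Qed.

Lemma hwM (y : R) : hw y * y = vw y.
Proof. by rewrite mulrC. Qed.

Lemma BL_onem_hw : BL (fun y : R => 1 - hw y) 1.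
Proof.
split=> [y|y z].
  by have := hw_gt0 y; have := hw_le1 y; rewrite ler_norml => *; apply/andP; split; lra.
rewrite (_ : _ - _ = - (hw y - hw z)); last by ring.
by rewrite normrN; exact: BL_hw.2.
Qed.

(** A residual is q1 times the state plus q2, with centered noise q1 and q2; a weight is thus used
    both alone, in front of q2, and multiplied by the state, in front of q1. *)
Lemma BL_weight i : exists c1 c2,
  BL (@weight R i) c1 /\ BL (fun y => @weight R i y * y) c2.
Proof.
have b1 := @BL_hw R; have b2 := @BL_vw R; have b3 := BL_onem_hw.
case: i => [|[|[|[|[|[|i]]]]]].
- by exists 1, 1; split => //; apply: eq_BL b2 => y; rewrite /weight/= hwM.
- by exists 1, 1; split => //; apply: eq_BL b3 => y; rewrite /weight/= vwM.
- eexists; eexists; split.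
    by apply: eq_BL (BLM b2 b3) => y; rewrite /weight/= /phi -vwM; ring.
  by apply: eq_BL (BLM b3 b3) => y; rewrite /weight/= /phi -vwM; ring.
- eexists; eexists; split.
    by apply: eq_BL (BLM b2 b2) => y; rewrite /weight/= /phi; ring.
  by apply: eq_BL (BLM b2 b3) => y; rewrite /weight/= /phi -vwM; ring.
- eexists; eexists; split.
    by apply: eq_BL (BLM b1 b2) => y; rewrite /weight/= /phi -hwM; ring.
  by apply: eq_BL (BLM b2 b2) => y; rewrite /weight/= /phi -hwM; ring.
- eexists; eexists; split.
    by apply: eq_BL (BLM b1 b1) => y; rewrite /weight/= /phi; ring.
  by apply: eq_BL (BLM b1 b2) => y; rewrite /weight/= /phi -hwM; ring.
- exists 1, 1; split; first by apply: eq_BL b1 => y; rewrite /weight/= nth_nil.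
  by apply: eq_BL b2 => y; rewrite /weight/= nth_nil hwM.
Qed.

Lemma BL_phi i : exists c0 c1 c2, [/\ BL (@phi R i) c0,
  BL (fun y => @phi R i y * y) c1 & BL (fun y => @phi R i y * y ^+ 2) c2].
Proof.
have b1 := @BL_hw R; have b2 := @BL_vw R; have b3 := BL_onem_hw.
case: i; eexists; eexists; eexists; split.
- by apply: eq_BL (BLM b1 b1) => y; rewrite /phi; ring.
- by apply: eq_BL (BLM b1 b2) => y; rewrite /phi -hwM; ring.
- by apply: eq_BL (BLM b2 b2) => y; rewrite /phi -hwM; ring.
- by apply: eq_BL (BLM b2 b2) => y; rewrite /phi; ring.
- by apply: eq_BL (BLM b2 b3) => y; rewrite /phi -vwM; ring.
- by apply: eq_BL (BLM b3 b3) => y; rewrite /phi -vwM; ring.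
Qed.

End weights_BL.

Section rcbar_process.
Context {disp} {T : measurableType disp} {R : realType} (P : probability T R).
Variables (X_ a_ b_ eps_ : nat -> {RV P >-> R}).
Variables (a b c d sigma_a sigma_b sigma_c sigma_d rho_ab rho_cd : R).
Hypotheses (model : rcbar P X_ a_ b_ eps_ a b c d) (h1 : H1 P a_ b_)
  (h2 : H2 P X_ a_ b_ eps_ sigma_a sigma_b sigma_c sigma_d)
  (h3 : H3 P X_ a_ b_ eps_ a b c d
     sigma_a sigma_b sigma_c sigma_d rho_ab rho_cd)
  (h4 : H4 P X_ a_ b_ eps_ a b c d
     sigma_a sigma_b sigma_c sigma_d rho_ab rho_cd).

Let ab k w := (a_ k w, b_ k w).
Let ee k w := (eps_ k.*2 w, eps_ k.*2.+1 w).
Let N := noise ab ee.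

Let mab k : measurable_fun setT (ab k).
Proof. exact: measurable_fun_pair. Qed.
Let mee k : measurable_fun setT (ee k).
Proof. exact: measurable_fun_pair. Qed.
Let mN : forall k, measurable_fun setT (N k).
Proof. exact: measurable_noise mab mee. Qed.

Let indN : noise_indep P N.
Proof. by case: model => _ _ [i1 i2 i3] _; exact: noise_indep_noise. Qed.

Let lawN k (phi : (R * R) * (R * R) -> R) : (1 <= k)%N ->
  measurable_fun setT phi -> (forall s, 0 <= phi s) ->
  Ex P (fun w => phi (N k w)) = Ex P (fun w => phi (N 1%N w)).
Proof. by case: model => _ _ [i1 i2 i3] _; exact: law_noise. Qed.

Let Ex_abee k (f g : R * R -> R) : (1 <= k)%N ->
  measurable_fun setT f -> measurable_fun setT g ->
  L2 P (fun w => f (ab k w)) -> L2 P (fun w => g (ee k w)) ->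
  Ex P (fun w => f (ab k w) * g (ee k w)) =
  Ex P (fun w => f (ab k w)) * Ex P (fun w => g (ee k w)).
Proof. by case: model => _ _ [i1 i2 i3] _; exact: Ex_ab_ee. Qed.

Let FFT n : FF P X_ n setT.
Proof. exact: (@measurableT _ (g_sigma_algebraType _)). Qed.

Let q1 e (s : (R * R) * (R * R)) : R := csel e s - slope a b e.
Let q2 e (s : (R * R) * (R * R)) : R := esel e s - icept c d e.
Let sv (e : bool) := if e then sigma_b ^+ 2 else sigma_a ^+ 2.
Let se (e : bool) := if e then sigma_d ^+ 2 else sigma_c ^+ 2.
(** The product of the residuals of parities e and e' has regression [tau] X^2 + [kap]. Equal
    parities give the two variance estimators, distinct ones the covariance estimator, so one proof
    covers all three. *)
Let tau (e e' : bool) := if e == e' then sv e else rho_ab.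
Let kap (e e' : bool) := if e == e' then se e else rho_cd.

Let mq1 e : measurable_fun setT (q1 e).
Proof. by apply: measurable_funB => //; exact: measurable_csel. Qed.
Let mq2 e : measurable_fun setT (q2 e).
Proof. by apply: measurable_funB => //; exact: measurable_esel. Qed.

Let mean_slope e k : (1 <= k)%N ->
  integ P (fun w => csel e (N k w)) /\ Ex P (fun w => csel e (N k w)) = slope a b e.
Proof.
move=> k1; case: model => _ _ _ /(_ _ _ (mem_GG_trunc_log k1))[ca cb _ _].
have := condexp_cst_Ex (@FFT _) ca; have := condexp_cst_Ex (@FFT _) cb.
by case: e.
Qed.

Let mean_icept e k : (1 <= k)%N ->
  integ P (fun w => esel e (N k w)) /\ Ex P (fun w => esel e (N k w)) = icept c d e.
Proof.
move=> k1; case: model => _ _ _ /(_ _ _ (mem_GG_trunc_log k1))[_ _ cc cd].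
have := condexp_cst_Ex (@FFT _) cc; have := condexp_cst_Ex (@FFT _) cd.
by case: e.
Qed.

Let L4q1 e k : (1 <= k)%N -> L4 P (fun w => q1 e (N k w)).
Proof.
move=> k1; split; first exact: measurableT_comp.
case: h4 => -[ma [mb [mc [md [_ _ hm]]]]] _ _.
have [ha hb _ _] := hm _ _ (mem_GG_trunc_log k1).
by case: e; [exact: (condexp_cst_Ex (@FFT _) hb).1|exact: (condexp_cst_Ex (@FFT _) ha).1].
Qed.

Let L4q2 e k : (1 <= k)%N -> L4 P (fun w => q2 e (N k w)).
Proof.
move=> k1; split; first exact: measurableT_comp.
case: h4 => -[ma [mb [mc [md [_ _ hm]]]]] _ _.
have [_ _ hc hd] := hm _ _ (mem_GG_trunc_log k1).
by case: e; [exact: (condexp_cst_Ex (@FFT _) hd).1|exact: (condexp_cst_Ex (@FFT _) hc).1].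
Qed.

Let Eq1 e k : (1 <= k)%N -> Ex P (fun w => q1 e (N k w)) = 0.
Proof.
move=> k1; have [i E] := mean_slope e k1.
by rewrite /q1 ExB ?E ?Ex_cst ?subrr//; exact: integ_cst.
Qed.

Let Eq2 e k : (1 <= k)%N -> Ex P (fun w => q2 e (N k w)) = 0.
Proof.
move=> k1; have [i E] := mean_icept e k1.
by rewrite /q2 ExB ?E ?Ex_cst ?subrr//; exact: integ_cst.
Qed.

Let Eq1q1 e e' k : (1 <= k)%N ->
  Ex P (fun w => q1 e (N k w) * q1 e' (N k w)) = tau e e'.
Proof.
move=> k1; have kG := mem_GG_trunc_log k1.
case: model => _ _ _ /(_ _ _ kG)[ca cb _ _].
case: h2 => _ _ _ _ /(_ _ _ kG)[va vb _ _].
case: h3 => _ _ _ _ /(_ _ _ kG)[_ rab].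
have ia := (L4q1 false k1).2; have ib := (L4q1 true k1).2.
rewrite /tau; case: e; case: e' => /=.
- by rewrite -(condvar_Ex (@FFT _) cb vb ib); apply: eq_Ex => w; rewrite expr2.
- have [_] := condexp_cst_Ex (@FFT _) rab; move=> <-.
  by apply: eq_Ex => w; rewrite mulrC.
- by have [_] := condexp_cst_Ex (@FFT _) rab; move=> <-.
- by rewrite -(condvar_Ex (@FFT _) ca va ia); apply: eq_Ex => w; rewrite expr2.
Qed.

Let Eq2q2 e e' k : (1 <= k)%N ->
  Ex P (fun w => q2 e (N k w) * q2 e' (N k w)) = kap e e'.
Proof.
move=> k1; have kG := mem_GG_trunc_log k1.
case: model => _ _ _ /(_ _ _ kG)[_ _ cc cd].
case: h2 => _ _ _ _ /(_ _ _ kG)[_ _ vc vd].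
case: h3 => _ _ _ _ /(_ _ _ kG)[rcd _].
have ic := (L4q2 false k1).2; have id := (L4q2 true k1).2.
rewrite /kap; case: e; case: e' => /=.
- by rewrite -(condvar_Ex (@FFT _) cd vd id); apply: eq_Ex => w; rewrite expr2.
- have [_] := condexp_cst_Ex (@FFT _) rcd; move=> <-.
  by apply: eq_Ex => w; rewrite mulrC.
- by have [_] := condexp_cst_Ex (@FFT _) rcd; move=> <-.
- by rewrite -(condvar_Ex (@FFT _) cc vc ic); apply: eq_Ex => w; rewrite expr2.
Qed.

Let selab e (u : R * R) : R := if e then u.2 else u.1.
Let mselab e : measurable_fun setT (selab e).
Proof. by case: e; [exact: measurable_snd|exact: measurable_fst]. Qed.

Let Eq1q2 e e' k : (1 <= k)%N -> Ex P (fun w => q1 e (N k w) * q2 e' (N k w)) = 0.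
Proof.
move=> k1.
have := Ex_abee (f := fun u => selab e u - slope a b e)
  (g := fun u => selab e' u - icept c d e') k1
  (measurable_funB (mselab e) (measurable_cst _))
  (measurable_funB (mselab e') (measurable_cst _))
  (L4_L2 (L4q1 e k1)) (L4_L2 (L4q2 e' k1)).
have E0 := Eq1 e k1.
have -> : (fun w => selab e (ab k w) - slope a b e) = (fun w => q1 e (N k w)) by [].
by rewrite E0 mul0r.
Qed.

Let L4csel e k : (1 <= k)%N -> L4 P (fun w => csel e (N k w)).
Proof.
move=> k1; have := L4D_cst (slope a b e) (L4q1 e k1).
by congr L4; apply/funext => w; rewrite /q1 subrK.
Qed.

Let L4esel e k : (1 <= k)%N -> L4 P (fun w => esel e (N k w)).
Proof.
move=> k1; have := L4D_cst (icept c d e) (L4q2 e k1).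
by congr L4; apply/funext => w; rewrite /q2 subrK.
Qed.

Let r e := Ex P (fun w => csel e (N 1%N w) ^+ 2).
Let r1 e : r e < 1.
Proof.
have [ha hb] := h1 (leqnn 1).
have i := L2_integ (L4_sqr (L4csel e (leqnn 1))).
move: i; rewrite /r; case: e => i.
- by move: hb; rewrite (expectation_Ex i) lte_fin.
- by move: ha; rewrite (expectation_Ex i) lte_fin.
Qed.

Let r0 e : 0 <= r e. Proof. by apply: Ex_ge0 => w; exact: sqr_ge0. Qed.

(** The inequality 2 |c| <= 1 + c^2 bounds the first absolute moment by (1 + r) / 2, which also
    exceeds the second moment r since r < 1. A single [rho] < 1 thus serves both decays. *)
Let rho := Num.max ((1 + r false) / 2) ((1 + r true) / 2).

Let rho_ge e : (1 + r e) / 2 <= rho.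
Proof. by rewrite /rho le_max; case: e; rewrite lexx ?orbT. Qed.

Let rho01 : 0 <= rho < 1.
Proof.
apply/andP; split; first by apply: le_trans (rho_ge false); have := r0 false; lra.
by rewrite /rho gt_max; apply/andP; split; [have := r1 false|have := r1 true]; lra.
Qed.

Let Erc e k : (1 <= k)%N -> Ex P (fun w => csel e (N k w) ^+ 2) = r e.
Proof.
move=> k1; apply: (lawN (phi := fun s => csel e s ^+ 2)) => //.
  by apply: measurable_funX; exact: measurable_csel.
by move=> s; exact: sqr_ge0.
Qed.

Let L2c e k : (1 <= k)%N -> L2 P (fun w => csel e (N k w)).
Proof. by move=> k1; exact: L4_L2 (L4csel e k1). Qed.
Let L2e e k : (1 <= k)%N -> L2 P (fun w => esel e (N k w)).
Proof. by move=> k1; exact: L4_L2 (L4esel e k1). Qed.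

Let Ec e k : (1 <= k)%N -> Ex P (fun w => csel e (N k w) ^+ 2) <= rho.
Proof.
move=> k1; rewrite Erc//; apply: le_trans (rho_ge e).
by have := r1 e; lra.
Qed.

Let Eabsc e k : (1 <= k)%N -> Ex P (fun w => `|csel e (N k w)|) <= rho.
Proof.
move=> k1; apply: le_trans (rho_ge e).
have i2 : integ P (fun w => 2^-1 * csel e (N k w) ^+ 2) by apply: integZ; exact: (L2c e k1).2.
apply: (@le_trans _ _ (Ex P (fun w => 2^-1 + 2^-1 * csel e (N k w) ^+ 2))).
  apply: le_Ex => [||w].
  - by apply: integ_norm; exact: L2_integ (L2c e k1).
  - by apply: integD => //; exact: integ_cst.
  rewrite -[_ ^+ 2]real_normK ?num_real//.
  by have := sqr_ge0 (`|csel e (N k w)| - 1); nra.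
rewrite ExD ?Ex_cst ?ExZ ?Erc//; [lra|exact: (L2c e k1).2|exact: integ_cst].
Qed.

Let ce := Num.max (Ex P (fun w => esel false (N 1%N w) ^+ 2))
  (Ex P (fun w => esel true (N 1%N w) ^+ 2)).

Let Ee e k : (1 <= k)%N -> Ex P (fun w => esel e (N k w) ^+ 2) <= ce.
Proof.
move=> k1; rewrite (lawN (phi := fun s => esel e s ^+ 2))//.
- by rewrite /ce le_max; case: e; rewrite lexx ?orbT.
- by apply: measurable_funX; exact: measurable_esel.
- by move=> s; exact: sqr_ge0.
Qed.

(** The even child of a node in state x has variance [sigma_a ^+ 2 * x ^+ 2 + sigma_c ^+ 2], which
    is positive, so it cannot be almost surely constant. *)
Let Hne x y : ~ {ae P, forall w,
  csel false (N 1%N w) * x + esel false (N 1%N w) = y}.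
Proof.
move=> h; have L1 := L4_L2 (L4q1 false (leqnn 1)); have L2' := L4_L2 (L4q2 false (leqnn 1)).
pose G w := x * q1 false (N 1%N w) + q2 false (N 1%N w).
pose z := y - a * x - c.
have LG : L2 P G by apply: L2D => //; exact: L2Z.
have Gz : {ae P, forall w, G w = z}.
  by apply: filterS h => w hw; rewrite /z -hw /G /q1 /q2 /slope /icept; ring.
have EG : Ex P G = 0.
  rewrite /G ExD ?ExZ ?Eq1 ?Eq2 ?mulr0 ?addr0//; [exact: L2_integ|exact: integZ (L2_integ L1)|exact: L2_integ].
have z0 : z = 0.
  by rewrite -EG -[LHS](Ex_cst P); apply: ae_Ex_eq; [exact: integ_cst|exact: L2_integ|apply: filterS Gz => w ->].
have EG2 : Ex P (fun w => G w ^+ 2) = 0.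
  rewrite -[RHS](Ex_cst P); apply: ae_Ex_eq; [exact: LG.2|exact: integ_cst|].
  by apply: filterS Gz => w ->; rewrite z0 expr0n.
have E : Ex P (fun w => G w ^+ 2) = x ^+ 2 * tau false false + kap false false.
  transitivity (Ex P (fun w => x ^+ 2 * (q1 false (N 1%N w) * q1 false (N 1%N w)) +
      2 * x * (q1 false (N 1%N w) * q2 false (N 1%N w)) +
      q2 false (N 1%N w) * q2 false (N 1%N w))).
    by apply: eq_Ex => w; rewrite /G; ring.
  have i11 := integM L1 L1; have i12 := integM L1 L2'; have i22 := integM L2' L2'.
  rewrite ExD ?ExD ?ExZ ?Eq1q1 ?Eq1q2 ?Eq2q2 ?mulr0 ?addr0//; try exact: integZ.
  by apply: integD; exact: integZ.
case: h2 => sa _ sc _ _.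
move: E; rewrite EG2 /tau /kap /sv /se /=.
by have := sqr_ge0 x; nra.
Qed.

(** Subtracting the two squares gives A E = 0 for the coefficient A and the innovation E.
    Independence turns this into E[A^2] E[E^2] = 0 with E[E^2] > 0, so A = 0 and E^2 = y^2 almost
    surely. Then the fourth moment of E is the square of its second moment, against the strict
    inequality in [H4]. *)
Let Hsq y : y != 0 -> ~ {ae P, forall w,
  (csel false (N 1%N w) * y + esel false (N 1%N w)) ^+ 2 = y ^+ 2 /\
  (csel false (N 1%N w) * - y + esel false (N 1%N w)) ^+ 2 = y ^+ 2}.
Proof.
move=> y0 h.
pose A w := csel false (N 1%N w); pose E w := esel false (N 1%N w).
have LA := L4_sqr (L4csel false (leqnn 1)); have LE := L4_sqr (L4esel false (leqnn 1)).
have AE0 : {ae P, forall w, A w ^+ 2 * E w ^+ 2 = 0 /\ A w ^+ 2 * y ^+ 2 + E w ^+ 2 = y ^+ 2}.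
  apply: filterS h => w; rewrite -/(A w) -/(E w) => -[e1 e2].
  have AE : A w * E w = 0.
    have : 4 * y * (A w * E w) = 0.
      have -> : 4 * y * (A w * E w) = (A w * y + E w) ^+ 2 - (A w * - y + E w) ^+ 2 by ring.
      by rewrite e1 e2 subrr.
    move=> /eqP; rewrite mulf_eq0 => /orP[|/eqP//].
    by rewrite mulf_eq0 (negbTE y0) orbF pnatr_eq0.
  split; first by rewrite -exprMn AE expr0n.
  move: e1; rewrite (_ : (A w * y + E w) ^+ 2 =
    A w ^+ 2 * y ^+ 2 + E w ^+ 2 + 2 * y * (A w * E w)); last by ring.
  by rewrite AE mulr0 addr0.
have prod := Ex_abee (f := fun u => u.1 ^+ 2) (g := fun u => u.1 ^+ 2) (leqnn 1)
  (measurable_funX _ measurable_fst) (measurable_funX _ measurable_fst) LA LE.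
have AE00 : Ex P (fun w => A w ^+ 2 * E w ^+ 2) = 0.
  rewrite -[RHS](Ex_cst P); apply: ae_Ex_eq; [exact: integM LA LE|exact: integ_cst|].
  by apply: filterS AE0 => w [-> _].
have iE := L2_integ LE; have iA := L2_integ LA.
have EE0 : 0 < Ex P (fun w => E w ^+ 2).
  have -> : Ex P (fun w => E w ^+ 2) = kap false false + c ^+ 2.
    have Lq := L4_L2 (L4q2 false (leqnn 1)).
    transitivity (Ex P (fun w => (q2 false (N 1%N w) * q2 false (N 1%N w) +
        2 * c * q2 false (N 1%N w)) + c ^+ 2)).
      by apply: eq_Ex => w; rewrite /q2 /icept -/(E w); ring.
    have iq := L2_integ Lq; have iqq := integM Lq Lq.
    have iqz := integZ (2 * c) iq; have ic2 := integ_cst P (c ^+ 2).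
    have isum := integD iqq iqz.
    by rewrite ExD// Ex_cst ExD// ExZ// Eq2q2// Eq2// mulr0 addr0.
  by case: h2 => _ _ sc _ _; rewrite /kap /se /= ltr_pwDl ?sqr_ge0.
have EA0 : Ex P (fun w => A w ^+ 2) = 0.
  move: prod; rewrite -/A -/E.
  rewrite (_ : Ex P (fun w => (ab 1 w).1 ^+ 2 * (ee 1 w).1 ^+ 2) = 0) => [/esym/eqP|]; last exact: AE00.
  by rewrite mulf_eq0 (gt_eqF EE0) orbF => /eqP.
have Aae := Ex_eq0 iA (fun w => sqr_ge0 (A w)) EA0.
have Eae : {ae P, forall w, E w ^+ 2 = y ^+ 2}.
  apply: filterS2 AE0 Aae => w [_ h'] Aw; have A0 : A w ^+ 2 = 0 := Aw.
  by move: h'; rewrite A0 mul0r add0r.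
case: h4 => _ /(_ _ (leqnn 1))[+ _] _ /=.
rewrite (expectation_Ex iE) (expectation_Ex (L4esel false (leqnn 1)).2).
have -> : Ex P (fun w => E w ^+ 2) = y ^+ 2.
  rewrite -[RHS](Ex_cst P); apply: ae_Ex_eq => //; exact: integ_cst.
have -> : Ex P (fun w => E w ^+ 4) = y ^+ 2 * y ^+ 2.
  rewrite -[RHS](Ex_cst P); apply: ae_Ex_eq => //; first exact: (L4esel false (leqnn 1)).2.
    exact: integ_cst.
  by apply: filterS Eae => w e; rewrite -expr2 -e -exprM.
by rewrite -EFinM lte_fin ltxx.
Qed.

Let X_E k w : (1 <= k)%N -> X_ k w = Y0 N k w + X_ 1%N w * Apath N k w.
Proof.
move=> k1; rewrite /Y0 /Apath -ar_affine//.
elim/half_ind: k / k1 => [|k k1 IH]; first by rewrite ar1.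
rewrite arS// -IH; case: model => rec _ _ _.
have h0 : (1 <= k./2)%N by lia.
have [re ro] := rec k./2 w h0.
rewrite /coef /innov; have := odd_double_half k; case: (odd k) => /= <-.
- by rewrite add1n /= uphalf_double ro.
- by rewrite add0n doubleK re.
Qed.

Let VresE e k w : (1 <= k)%N -> Vres (X_ ^~ w) a b c d e k =
  q1 e (N k w) * X_ k w + q2 e (N k w).
Proof.
move=> k1; case: model => /(_ k w k1)[re ro] _ _ _.
by case: e; rewrite /Vres /V_odd /V_even /= ?re ?ro /q1 /q2 /csel /esel /slope /icept /=; ring.
Qed.

Let GG1 n k : k \in GG n -> (1 <= k)%N.
Proof.
by rewrite mem_index_iota => /andP[+ _]; apply: leq_trans; rewrite expn_gt0.
Qed.

Let lln q (f : R -> R) cf : measurable_fun setT q ->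
  (forall k, (1 <= k)%N -> L2 P (fun w => q (N k w))) ->
  (forall k, (1 <= k)%N -> Ex P (fun w => q (N k w)) = 0) -> BL f cf ->
  {ae P, forall w, (\sum_(k <- GG n) f (X_ k w) * q (N k w)) / 2 ^+ n @[n --> \oo] --> 0}.
Proof.
move=> mq Lq q0 bf.
have Eqq k (k1 : (1 <= k)%N) := lawN (phi := fun s => q s ^+ 2) k1
  (measurable_funX _ mq) (fun s => sqr_ge0 _).
have := weighted_noise_lln mN indN rho01 L2c Eabsc mq Lq q0 Eqq bf.
(* The exceptional set does not depend on the initial state, so the random value [X_1(w)] may be
   substituted at each sample point. *)
apply: filterS => w /(_ (X_ 1%N w)).
rewrite (_ : (fun n => wsum N q f n (X_ 1%N w) w / 2 ^+ n) =
  (fun n => (\sum_(k <- GG n) f (X_ k w) * q (N k w)) / 2 ^+ n))//.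
apply/funext => n; congr (_ / _); rewrite /wsum big_seq [RHS]big_seq.
by apply: eq_bigr => k /GG1 k1; rewrite (X_E w k1).
Qed.

Let squares q (f : R -> R) cf : measurable_fun setT q ->
  (forall k, (1 <= k)%N -> L4 P (fun w => q (N k w))) ->
  (forall k, (1 <= k)%N -> Ex P (fun w => q (N k w)) = 0) -> BL f cf ->
  {ae P, forall w, exists M, forall n,
    \sum_(j < n) (\sum_(k <- GG j) f (X_ k w) * q (N k w)) ^+ 2 / 2 ^+ j <= M * n.+1%:R}.
Proof.
move=> mq L4q q0 bf.
have Lq k (k1 : (1 <= k)%N) := L4_L2 (L4q k k1).
have Lq2 k (k1 : (1 <= k)%N) := L4_sqr (L4q k k1).
pose s2 := Ex P (fun w => q (N 1%N w) ^+ 2).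
have Eqq k (k1 : (1 <= k)%N) : Ex P (fun w => q (N k w) ^+ 2) = s2 :=
  lawN (phi := fun s => q s ^+ 2) k1 (measurable_funX _ mq) (fun s => sqr_ge0 _).
have Eq4 k (k1 : (1 <= k)%N) : Ex P (fun w => (q (N k w) ^+ 2 - s2) ^+ 2) <=
    Ex P (fun w => (q (N 1%N w) ^+ 2 - s2) ^+ 2).
  rewrite (lawN (phi := fun s => (q s ^+ 2 - s2) ^+ 2) k1)//.
    by apply: measurable_funX; apply: measurable_funB => //; exact: measurable_funX.
  by move=> s; exact: sqr_ge0.
have := wsum_squares mN indN rho01 L2c Ec Eabsc mq Lq q0 Eqq bf Lq2 Eq4.
apply: filterS => w /(_ (X_ 1%N w))[M hM]; exists M => n.
rewrite (_ : \sum_(j < n) _ = \sum_(j < n) wsum N q f j (X_ 1%N w) w ^+ 2 / 2 ^+ j)//.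
apply: eq_bigr => j _; congr (_ ^+ 2 / _); rewrite /wsum big_seq [RHS]big_seq.
by apply: eq_bigr => k /GG1 k1; rewrite (X_E w k1).
Qed.

Lemma residual_squares : {ae P, forall w, forall i e, exists M, forall n,
  \sum_(j < n) (\sum_(k <- GG j) weight i (X_ k w) * Vres (X_ ^~ w) a b c d e k) ^+ 2
    / 2 ^+ j <= M * n.+1%:R}.
Proof.
apply/ae_foralln => i.
have one e : {ae P, forall w, exists M, forall n,
    \sum_(j < n) (\sum_(k <- GG j) weight i (X_ k w) * Vres (X_ ^~ w) a b c d e k) ^+ 2
      / 2 ^+ j <= M * n.+1%:R}.
  have [c1 [c2 [bw bwx]]] := @BL_weight R i.
  have s1 := squares (mq1 e) (L4q1 e) (Eq1 e) bwx.
  have s2 := squares (mq2 e) (L4q2 e) (Eq2 e) bw.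
  apply: filterS2 s1 s2 => w [M1 m1] [M2 m2]; exists (2 * (M1 + M2)) => n.
  apply: le_trans (_ : _ <= 2 * (\sum_(j < n) (\sum_(k <- GG j)
      weight i (X_ k w) * X_ k w * q1 e (N k w)) ^+ 2 / 2 ^+ j + \sum_(j < n)
      (\sum_(k <- GG j) weight i (X_ k w) * q2 e (N k w)) ^+ 2 / 2 ^+ j)) _; last first.
    by rewrite -[leRHS]mulrA ler_wpM2l// mulrDl; apply: lerD; [exact: m1|exact: m2].
  rewrite -big_split/= mulr_sumr; apply: ler_sum => j _.
  rewrite -mulrDl mulrA ler_wpM2r ?invr_ge0 ?exprn_ge0//.
  set S := \sum_(k <- _) _; set S1 := \sum_(k <- _) _; set S2 := \sum_(k <- _) _.
  have -> : S = S1 + S2.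
    rewrite /S /S1 /S2 -big_split/= big_seq [RHS]big_seq; apply: eq_bigr => k /GG1 k1.
    by rewrite VresE//; ring.
  by have := sqr_ge0 (S1 - S2); nra.
by apply: filterS2 (one true) (one false) => w ht hf [].
Qed.

Lemma residual_spread : {ae P, forall w, exists2 kappa, 0 < kappa &
  \forall n \near \oo, forall m, 0 <= m <= 1 -> kappa * 2 ^+ n <=
    \sum_(k <- TT n) (hw (X_ k w) - m) ^+ 2}.
Proof.
have := empirical_spread mN indN lawN rho01 L2c L2e Ec Eabsc Ee Hne Hsq.
apply: filterS => w /(_ (X_ 1%N w))[kappa k0 h]; exists kappa => //.
apply: filterS h => n h m m01; apply: le_trans (h m m01) _; apply: eq_ler.
rewrite big_seq [RHS]big_seq; apply: eq_bigr => k.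
by rewrite mem_index_iota => /andP[k1 _]; rewrite (X_E w k1).
Qed.

(** Expanding the product of two residuals in powers of the state gives three centered noise
    functions, q2 q2' - kap, q1 q2' + q1' q2 and q1 q1' - tau, with weights [phi], [phi * X] and
    [phi * X^2]. The weights are bounded Lipschitz, and the fourth moments of the noise make these
    products square integrable. *)
Lemma residual_lln e e' : {ae P, forall w, forall i : bool,
  (\sum_(k <- TT n) phi i (X_ k w) * (Vres (X_ ^~ w) a b c d e k *
     Vres (X_ ^~ w) a b c d e' k - (tau e e' * X_ k w ^+ 2 + kap e e')))
   / 2 ^+ n @[n --> \oo] --> 0}.
Proof.
have one i : {ae P, forall w,
  (\sum_(k <- TT n) phi i (X_ k w) * (Vres (X_ ^~ w) a b c d e k *
     Vres (X_ ^~ w) a b c d e' k - (tau e e' * X_ k w ^+ 2 + kap e e')))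
   / 2 ^+ n @[n --> \oo] --> 0}.
  have [c0 [c1 [c2 [b0 b1 b2]]]] := @BL_phi R i.
  have l0 : {ae P, forall w, (\sum_(k <- GG n) phi i (X_ k w) *
      (q2 e (N k w) * q2 e' (N k w) - kap e e')) / 2 ^+ n @[n --> \oo] --> 0}.
    apply: (lln (q := fun s => q2 e s * q2 e' s - kap e e') _ _ _ b0) => [|k k1|k k1].
    - by apply: measurable_funB => //; exact: measurable_funM.
    - by apply: L2B; [exact: L4M (L4q2 e k1) (L4q2 e' k1)|exact: L2_cst].
    - rewrite ExB ?Ex_cst ?Eq2q2 ?subrr//; last exact: integ_cst.
      exact: integM (L4_L2 (L4q2 e k1)) (L4_L2 (L4q2 e' k1)).
  have l1 : {ae P, forall w, (\sum_(k <- GG n) phi i (X_ k w) * X_ k w *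
      (q1 e (N k w) * q2 e' (N k w) + q1 e' (N k w) * q2 e (N k w)))
      / 2 ^+ n @[n --> \oo] --> 0}.
    apply: (lln (q := fun s => q1 e s * q2 e' s + q1 e' s * q2 e s) _ _ _ b1) => [|k k1|k k1].
    - by apply: measurable_funD; exact: measurable_funM.
    - by apply: L2D; [exact: L4M (L4q1 e k1) (L4q2 e' k1)|exact: L4M (L4q1 e' k1) (L4q2 e k1)].
    - rewrite ExD ?Eq1q2 ?addr0//.
        exact: integM (L4_L2 (L4q1 e k1)) (L4_L2 (L4q2 e' k1)).
      exact: integM (L4_L2 (L4q1 e' k1)) (L4_L2 (L4q2 e k1)).
  have l2 : {ae P, forall w, (\sum_(k <- GG n) phi i (X_ k w) * X_ k w ^+ 2 *
      (q1 e (N k w) * q1 e' (N k w) - tau e e')) / 2 ^+ n @[n --> \oo] --> 0}.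
    apply: (lln (q := fun s => q1 e s * q1 e' s - tau e e') _ _ _ b2) => [|k k1|k k1].
    - by apply: measurable_funB => //; exact: measurable_funM.
    - by apply: L2B; [exact: L4M (L4q1 e k1) (L4q1 e' k1)|exact: L2_cst].
    - rewrite ExB ?Ex_cst ?Eq1q1 ?subrr//; last exact: integ_cst.
      exact: integM (L4_L2 (L4q1 e k1)) (L4_L2 (L4q1 e' k1)).
  apply: filterS3 l0 l1 l2 => w l0 l1 l2.
  have l3 := cvgD (cvgD l0 l1) l2; rewrite !addr0 in l3.
  pose s n := \sum_(k <- GG n) phi i (X_ k w) * (Vres (X_ ^~ w) a b c d e k *
     Vres (X_ ^~ w) a b c d e' k - (tau e e' * X_ k w ^+ 2 + kap e e')).
  have sE n : s n / 2 ^+ n = (\sum_(k <- GG n) phi i (X_ k w) *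
      (q2 e (N k w) * q2 e' (N k w) - kap e e')) / 2 ^+ n +
      (\sum_(k <- GG n) phi i (X_ k w) * X_ k w *
      (q1 e (N k w) * q2 e' (N k w) + q1 e' (N k w) * q2 e (N k w))) / 2 ^+ n +
      (\sum_(k <- GG n) phi i (X_ k w) * X_ k w ^+ 2 *
      (q1 e (N k w) * q1 e' (N k w) - tau e e')) / 2 ^+ n.
    rewrite -!mulrDl -!big_split/=; congr (_ / _).
    rewrite /s big_seq [RHS]big_seq; apply: eq_bigr => k /GG1 k1.
    by rewrite !VresE//; ring.
  have sl : s n / 2 ^+ n @[n --> \oo] --> 0 by rewrite (funext sE); exact: l3.
  rewrite [X in X @ _ --> _](_ : _ = (fun n => (\sum_(j < n.+1) s j) / 2 ^+ n)).
    exact: geometric_prefix_cvg0.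
  by apply/funext => n; rewrite sum_TT.
by apply: filterS2 (one true) (one false) => w ht hf [].
Qed.

Lemma quad_est_residuals (theta0 : 'M[R]_2) e e' : {ae P, forall w,
  let x k := X_ k w in
  quad_est x (fun k => Vhat x theta0 e k * Vhat x theta0 e' k) n
    @[n --> \oo] --> col2 (tau e e') (kap e e') /\
  (fun n => enorm (quad_est x (fun k => Vhat x theta0 e k * Vhat x theta0 e' k) n -
     quad_est x (fun k => Vres x a b c d e k * Vres x a b c d e' k) n))
    =O_\oo (rate R)}.
Proof.
apply: filterS3 residual_squares residual_spread (residual_lln e e') => w sq [kappa k0 lo] l.
split.
- exact: (residual_product_cvg theta0 sq k0 lo l).
- exact: (residual_product_bigO theta0 sq k0 lo).
Qed.

End rcbar_process.

Theorem theorem5p5 (disp : measure_display) (T : measurableType disp)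
    (R : realType) (P : probability T R)
    (X_ a_ b_ eps_ : nat -> {RV P >-> R})
    (a b c d sigma_a sigma_b sigma_c sigma_d rho_ab rho_cd : R)
    (theta0 : 'M[R]_2)
    (model : rcbar P X_ a_ b_ eps_ a b c d)
    (h1 : H1 P a_ b_)
    (h2 : H2 P X_ a_ b_ eps_ sigma_a sigma_b sigma_c sigma_d)
    (h3 : H3 P X_ a_ b_ eps_ a b c d
            sigma_a sigma_b sigma_c sigma_d rho_ab rho_cd)
    (h4 : H4 P X_ a_ b_ eps_ a b c d
            sigma_a sigma_b sigma_c sigma_d rho_ab rho_cd)
    (h5 : H5 P X_ a_ b_ eps_ a b c d) :
  let x (w : T) (k : nat) : R := X_ k w in
  let eta := col2 (sigma_a ^+ 2) (sigma_c ^+ 2) in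
  let zeta := col2 (sigma_b ^+ 2) (sigma_d ^+ 2) in
  let nu := col2 rho_ab rho_cd in
  [/\ {ae P, forall w, eta_hat (x w) theta0 n @[n --> \oo] --> eta},
      {ae P, forall w, zeta_hat (x w) theta0 n @[n --> \oo] --> zeta},
      {ae P, forall w,
        (fun n => enorm (eta_hat (x w) theta0 n - eta_n (x w) a c n))
          =O_\oo (rate R)} /\
      {ae P, forall w,
        (fun n => enorm (zeta_hat (x w) theta0 n - zeta_n (x w) b d n))
          =O_\oo (rate R)},
      {ae P, forall w, nu_hat (x w) theta0 n @[n --> \oo] --> nu}
    & {ae P, forall w,
        (fun n => enorm (nu_hat (x w) theta0 n - nu_n (x w) a b c d n))
          =O_\oo (rate R)}].
Proof.
move=> x eta zeta nu.
have qs := quad_est_residuals model h1 h2 h3 h4 theta0.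
have h_eta := qs false false; have h_zeta := qs true true; have h_nu := qs false true.
have eta_hatE w : eta_hat (x w) theta0 = quad_est (x w)
    (fun k => Vhat (x w) theta0 false k * Vhat (x w) theta0 false k).
  by rewrite /eta_hat; congr quad_est; apply/funext => k; rewrite expr2.
have zeta_hatE w : zeta_hat (x w) theta0 = quad_est (x w)
    (fun k => Vhat (x w) theta0 true k * Vhat (x w) theta0 true k).
  by rewrite /zeta_hat; congr quad_est; apply/funext => k; rewrite expr2.
have eta_nE w : eta_n (x w) a c = quad_est (x w)
    (fun k => Vres (x w) a b c d false k * Vres (x w) a b c d false k).
  by rewrite /eta_n; congr quad_est; apply/funext => k; rewrite expr2.
have zeta_nE w : zeta_n (x w) b d = quad_est (x w)
    (fun k => Vres (x w) a b c d true k * Vres (x w) a b c d true k).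
  by rewrite /zeta_n; congr quad_est; apply/funext => k; rewrite expr2.
split.
- by apply: filterS h_eta => w [+ _]; rewrite eta_hatE.
- by apply: filterS h_zeta => w [+ _]; rewrite zeta_hatE.
- split.
  + by apply: filterS h_eta => w [_ +]; rewrite eta_hatE eta_nE.
  + by apply: filterS h_zeta => w [_ +]; rewrite zeta_hatE zeta_nE.
- by apply: filterS h_nu => w [+ _].
- by apply: filterS h_nu => w [_ +].
Qed.
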